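(* Let $\beta = \frac14 e^{-1/2}$. For every $\varepsilon > 0$ there exists $q_0(\varepsilon)$ such that for every cube-free integer $q \ge q_0(\varepsilon)$ and every integer $a$ with $\gcd(a,q)=1$ there exist integers $n_1,\ldots,n_{14}$ with $$n_1 n_2 \cdots n_{14} \equiv a \pmod q, \qquad 1 \le n_1,\ldots,n_{14} \le q^{\beta+\varepsilon}.$$
   Context: An integer $q\ge 1$ is cube-free if no prime $p$ satisfies $p^3 \mid q$. *)

(* Defs.v *)
From mathcomp Require Import all_boot all_order all_algebra.
From mathcomp Require Import reals sequences exp.
Set Implicit Arguments.
Unset Strict Implicit.
Unset Printing Implicit Defensive.

Local Open Scope ring_scope.

Definition cube_free (q : nat) : Prop :=
  (1 <= q)%N /\ forall p : nat, prime p -> ~ (p ^ 3 %| q)%N.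

Definition beta (R : realType) : R := 4^-1 * expR (- 2^-1).

(* Main.v *)
Require Import Defs.
From mathcomp Require Import all_boot all_order all_fingroup all_algebra.
From mathcomp Require Import all_solvable all_field all_character.
From mathcomp Require Import zify ring lra.
From mathcomp Require Import reals sequences exp.
From mathcomp Require boolp.
Set Implicit Arguments.
Unset Strict Implicit.
Unset Printing Implicit Defensive.
Import Order.TTheory GRing.Theory Num.Theory.
Local Open Scope ring_scope.

(* Let N be slightly larger than q^(1/4) and Y = q^(beta+eps). By Mertens' theorem fewer than half of
   the integers up to N have a prime factor above Y, since log(log N / log Y) < 1/2 exactly because
   beta = e^(-1/2)/4. Count the solutions of n1 n2 z1 ... zk = a mod q with n1, n2 <= N and the zi
   primes of size q^(1/200). Burgess's bound for cube-free q makes the nonprincipal characters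
   negligible as soon as one of n1, n2 runs over all integers up to N, so subtracting the solutions
   with a bad n1 or n2 leaves solutions with both Y-smooth. Each of these two splits into three
   factors up to Y, and the small primes zi are distributed greedily over 14 factors.
   Burgess's bound rests on Weil's bound for multiplicative characters of prime fields, obtained by
   Stepanov's method applied over the extensions of F_p of even degree. *)

(** * Stepanov's method *)

(** Why fourteen: besides n1 and n2 the product carries small primes whose product is about q^(3/2),
    so the whole has size about q^2, and 14 is the least k with k beta > 2 (14 beta is about 2.12).
    The size q^2 comes from the method: Cauchy-Schwarz cuts the sum over nonprincipal characters
    into two second moments, and orthogonality evaluates each without waste only when n times half
    of the small primes runs up to at least q. One prime is left over, so their number is odd. Its
    character sum supplies the saving that pays for lost powers, except at characters where that sum
    is large; a high moment shows these to be so rare that Burgess's bound on the complete factor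
    suffices. All losses are measured in powers of a base V, itself a tiny power of q, and not in
    logarithms, so Chebyshev-type counts of primes are enough. Cube-freeness is what keeps
    square-root cancellation in complete sums: modulo p^2 such a sum reduces to the zeros of a
    polynomial mod p. *)

Lemma exists_nontrivial_relation (K : fieldType) (T1 T2 : finType)
    (B : T1 -> T2 -> K) :
  (#|T2| < #|T1|)%N ->
  exists2 v : T1 -> K, (exists t, v t != 0) &
    forall t2, \sum_t1 v t1 * B t1 t2 = 0.
Proof.
move=> lt21.
pose A := \matrix_(i < #|T1|, j < #|T2|) B (enum_val i) (enum_val j).
have : kermx A != 0.
  rewrite kermx_eq0 /row_free; apply: contraL lt21 => /eqP rA.
  by rewrite -leqNgt -rA rank_leq_col.
case/rowV0Pn => v /sub_kermxP vA0 v_neq0.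
exists (fun t => v 0 (enum_rank t)).
  case/rV0Pn: v_neq0 => i vi; exists (enum_val i).
  by rewrite enum_valK.
move=> t2; have /matrixP/(_ 0 (enum_rank t2)) := vA0.
rewrite !mxE => sum0; rewrite -[RHS]sum0.
rewrite (reindex_onto (@enum_val _ [pred x : T1 | true]) enum_rank) /=; last first.
  by move=> i _; rewrite enum_rankK.
apply: eq_big => [i|i _]; rewrite enum_valK ?eqxx //.
by rewrite mxE enum_rankK.
Qed.

Lemma dvdp_prod_XsubC_exp (K : fieldType) (l : nat) (rs : seq K) (p : {poly K}) :
  uniq rs -> (forall x, x \in rs -> ('X - x%:P) ^+ l %| p) ->
  \prod_(x <- rs) ('X - x%:P) ^+ l %| p.
Proof.
elim: rs => [|x rs IH] /=; first by rewrite big_nil dvd1p.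
move=> /andP[x_notin uniq_rs] dvd_p; rewrite big_cons Gauss_dvdp.
  rewrite dvd_p ?mem_head //= IH // => y y_rs.
  by rewrite dvd_p // in_cons y_rs orbT.
rewrite big_seq; elim/big_rec: _ => [|y q y_rs co_q]; first exact: coprimep1.
rewrite coprimepMr co_q andbT coprimep_expl // coprimep_expr //.
by rewrite coprimep_XsubC2 // subr_eq0; apply: contraNneq x_notin => <-.
Qed.

Lemma dvdXn_coef0 (K : fieldType) (l : nat) (p : {poly K}) :
  (forall s, (s < l)%N -> p`_s = 0) -> 'X^l %| p.
Proof.
move=> p0; rewrite -(poly_take_drop l p).
suff -> : take_poly l p = 0 by rewrite add0r dvdp_mull.
by apply/polyP => i; rewrite coef_take_poly coef0; case: ifP => // /p0.
Qed.

Section PolyWeight.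
Variables (K : fieldType) (m : nat).

(* X-degrees of the coefficients of a polynomial in Y over K[X]: the
   substitution X |-> X + fY raises the X-degree by at most m = deg f for each
   factor Y. *)
Definition Yweight (D : nat) (g : {poly {poly K}}) :=
  forall s : nat, (size (g`_s)%R <= D + m * s + 1)%N.

Lemma YweightM D1 D2 g1 g2 :
  Yweight D1 g1 -> Yweight D2 g2 -> Yweight (D1 + D2) (g1 * g2).
Proof.
move=> w1 w2 s; rewrite coefM; apply: leq_trans (size_sum _ _ _) _.
apply/bigmax_leqP => i _; apply: leq_trans (size_polyMleq _ _) _.
have := w1 i; have := w2 (s - i)%N; have := ltn_ord i.
move: (size _) (size _) => a b lt_i hb ha.
have -> : (m * s = m * i + m * (s - i))%N by rewrite -mulnDr subnKC // -ltnS.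
lia.
Qed.

Lemma Yweight_sum I (r : seq I) (P : pred I) D (F : I -> {poly {poly K}}) :
  (forall i, P i -> Yweight D (F i)) -> Yweight D (\sum_(i <- r | P i) F i).
Proof.
move=> wF s; rewrite coef_sum.
elim/big_ind: _ => [|p q|i /wF->//]; first by rewrite size_poly0.
by move=> hp hq; apply: leq_trans (size_polyD _ _) _; rewrite geq_max hp.
Qed.

Lemma YweightW D1 D2 g : (D1 <= D2)%N -> Yweight D1 g -> Yweight D2 g.
Proof. by move=> le12 wg s; apply: leq_trans (wg s) _; lia. Qed.

Lemma YweightC D (c : {poly K}) : (size c <= D.+1)%N -> Yweight D c%:P.
Proof.
move=> sc s; rewrite coefC; case: eqP => _; last by rewrite size_poly0.
lia.
Qed.

Lemma YweightX D g : Yweight (D + m) g -> Yweight D ('X * g).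
Proof.
move=> wg [|s]; rewrite coefXM /=; first by rewrite size_poly0.
by apply: leq_trans (wg s) _; rewrite mulnS; lia.
Qed.

Lemma Yweight_exp D g n : Yweight D g -> Yweight (D * n) (g ^+ n).
Proof.
move=> wg; elim: n => [|n IH].
  by rewrite muln0 expr0; apply: YweightC; rewrite size_poly1.
by rewrite exprS mulnS; apply: YweightM.
Qed.

End PolyWeight.

Lemma exprDn_card (K : finFieldType) (x v : K) :
  (x%:P + v%:P * 'X) ^+ #|K| = x%:P + (v%:P * 'X) ^+ #|K|.
Proof.
have [p p_pr pK] := finPcharP K.
have pKX : p \in [pchar {poly K}] by rewrite pchar_poly.
rewrite exprDn_pchar -?polyC_exp ?expf_card //.
rewrite (eq_pnat _ (pcharf_eq pKX)).
by have := pprimeChar_pgroup pK; rewrite /pgroup cardsT.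
Qed.

Section Stepanov.
Variables (K : finFieldType) (l d c m J : nat) (f f1 : {poly K}) (zeta : K).
Hypotheses (fE : f = 'X * f1) (f1_0 : f1.[0] != 0) (size_f : (size f <= m.+1)%N).
Hypotheses (cardK : #|K| = (d * c).+1) (c_gt0 : (0 < c)%N) (zeta0 : zeta != 0).
Hypothesis (l_le : (l <= #|K|)%N).
(** Unknowns against equations: the auxiliary polynomial has [d * J * c] coefficients, and each of
    the [l] powers of [Y] to be killed carries a polynomial in [X] with at most [c + m * l + J]
    coefficients. *)
Hypothesis many : (l * (c + m * l + J) < d * J * c)%N.

Let u : {poly {poly K}} := ('X)%:P + f%:P * 'X.

Let u_weight : Yweight m 1 u.
Proof.
move=> s; rewrite coefD coefMX !coefC; case: s => [|[|s]] /=.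
- by rewrite addr0 size_polyX; lia.
- by rewrite add0r; apply: leq_trans size_f _; lia.
- by rewrite add0r size_poly0.
Qed.

(** Since [u - X = f Y], each [u^i - X^i] is divisible by [f Y], hence [f(u) = f (1 + Y G)]. The
    cofactor has weight 0, so its powers cost no degree in [X] beyond [m] for each factor [Y]. *)
Let subst_f : exists2 w, (map_poly (polyC \o polyC) f).[u] = f%:P * w & Yweight m 0 w.
Proof.
pose G := \sum_(i < size f) (f`_i)%:P%:P *
   \sum_(k < i) u ^+ (i.-1 - k) * ('X)%:P ^+ k.
have wu := u_weight.
exists (1 + 'X * G).
  rewrite mulrDr mulr1 mulrA.
  have fP : f%:P = \sum_(i < size f) (f`_i)%:P%:P * ('X)%:P ^+ i :> {poly {poly K}}.
    rewrite -{1}[f]coefK poly_def rmorph_sum; apply: eq_bigr => i _.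
    by rewrite -mul_polyC rmorphM rmorphXn.
  rewrite horner_coef size_map_inj_poly ?raddf0 //; last first.
    by move=> x y /polyC_inj/polyC_inj.
  apply/eqP; rewrite addrC -subr_eq {1}fP; apply/eqP; rewrite -sumrB mulr_sumr.
  apply: eq_bigr => i _; rewrite coef_map /= -mulrBr subrXX mulrCA.
  by congr (_ * (_ * _)); rewrite /u addrC addKr.
move=> s; rewrite coefD; apply: leq_trans (size_polyD _ _) _; rewrite geq_max.
apply/andP; split.
  have w1 : Yweight m 0 (1%:P : {poly {poly K}}) by apply: YweightC; rewrite size_poly1.
  exact: w1.
have wG : Yweight m (0 + m) G; last by have := YweightX wG; apply.
apply: Yweight_sum => i _; apply: YweightM.
  by apply: YweightC; rewrite size_polyC; case: (_ != _).
apply: Yweight_sum => k _.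
have wX : Yweight m 1 (('X : {poly K})%:P) by apply: YweightC; rewrite size_polyX.
apply: YweightW (YweightM (Yweight_exp (i.-1 - k) wu) (Yweight_exp k wX)).
have := ltn_ord k; have := ltn_ord i; lia.
Qed.

Let index := ('I_d * 'I_J * 'I_c)%type.
Let R_term (a : index) : {poly K} := 'X^(a.2 + a.1.2 * #|K|) * f ^+ (a.1.1 * c).
Let Phi_term (w : {poly {poly K}}) (a : index) : {poly {poly K}} :=
  (zeta ^+ a.1.1)%:P%:P * ('X^(a.1.2))%:P * u ^+ a.2 * w ^+ (a.1.1 * c).
Let ev x : {poly {poly K}} -> {poly K} := map_poly (horner_eval x).

Let Phi_weight w a : Yweight m 0 w -> (Yweight m (c + J - 1) (Phi_term w a)).
Proof.
move=> ww; have wu := u_weight.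
rewrite /Phi_term; case: a => [[i j] t] /=.
have w1 : Yweight m 0 ((zeta ^+ i)%:P%:P : {poly {poly K}}).
  by apply: YweightC; rewrite size_polyC; case: (_ != _).
have w2 : Yweight m j (('X^j)%:P : {poly {poly K}}).
  by apply: YweightC; rewrite size_polyXn.
apply: YweightW (YweightM (YweightM (YweightM w1 w2) (Yweight_exp t wu))
  (Yweight_exp (i * c) ww)).
have := ltn_ord i; have := ltn_ord j; have := ltn_ord t; lia.
Qed.

Let ev_u x : ev x u = x%:P + f.[x]%:P * 'X.
Proof.
by rewrite /ev rmorphD rmorphM /= !map_polyC map_polyX /= /horner_eval hornerX.
Qed.

Let ev_w x w : (map_poly (polyC \o polyC) f).[u] = f%:P * w ->
  f \Po (x%:P + f.[x]%:P * 'X) = f.[x]%:P * ev x w.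
Proof.
move=> /(congr1 (ev x)); rewrite {2}/ev rmorphM /= map_polyC /= => <-.
have -> : ev x (map_poly (polyC \o polyC) f).[u] =
    (map_poly (ev x) (map_poly (polyC \o polyC) f)).[ev x u] by rewrite /ev horner_map.
rewrite ev_u -map_poly_comp /comp_poly.
congr (_.[_]); apply: eq_map_poly => y /=.
by rewrite /ev map_polyC /= /horner_eval hornerC.
Qed.

Let R_Phi w a x : (map_poly (polyC \o polyC) f).[u] = f%:P * w ->
  f.[x] ^+ c = zeta ->
  'X^l %| R_term a \Po (x%:P + f.[x]%:P * 'X) - ev x (Phi_term w a).
Proof.
move=> hw fxc; case: a => [[i j] t]; rewrite /R_term /Phi_term /=.
rewrite rmorphM /= rmorphXn /= comp_polyX rmorphXn /= (ev_w _ hw).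
rewrite /ev !rmorphM !rmorphXn /= -/(ev x u) ev_u !map_polyC /=.
have E1 (W : {poly K}) : (f.[x]%:P * W) ^+ (i * c) = zeta%:P ^+ i * W ^+ (i * c).
  by rewrite exprMn {1}mulnC [f.[x]%:P ^+ _]exprM -[f.[x]%:P ^+ c]polyC_exp fxc.
rewrite E1 exprD mulnC exprM exprDn_card /horner_eval hornerC hornerX.
set wx := map_poly _ w; set ux := x%:P + f.[x]%:P * 'X.
set y := _ + _ ^+ _.
have -> : ux ^+ t * y ^+ j * (zeta%:P ^+ i * wx ^+ (i * c)) -
   zeta%:P ^+ i * x%:P ^+ j * ux ^+ t * wx ^+ (i * c) =
   (y ^+ j - x%:P ^+ j) * (ux ^+ t * zeta%:P ^+ i * wx ^+ (i * c)) by ring.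
rewrite dvdp_mulr // subrXX dvdp_mulr // /y addrC addKr exprMn dvdp_mull //.
by rewrite -(subnK l_le) exprD dvdp_mull.
Qed.

Let R_coprime (v : index -> K) : (exists a, v a != 0) -> \sum_a v a *: R_term a != 0.
Proof.
(* The order of [R_term a] at 0, since [f = X f1]. The index is recovered by dividing by [#|K|] and
   then by [c], because [t + i c < #|K|]. *)
pose e (a : index) := (a.2 + a.1.1 * c + a.1.2 * #|K|)%N.
have e_inj : injective e.
  move=> [[i j] t] [[i' j'] t']; rewrite /e /= => E.
  have := ltn_ord i; have := ltn_ord i'; have := ltn_ord t; have := ltn_ord t'.
  move=> lt1 lt2 lt3 lt4.
  have lt5 : (t + i * c < #|K|)%N by rewrite cardK; nia.
  have lt6 : (t' + i' * c < #|K|)%N by rewrite cardK; nia.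
  have Ej : j = j' :> nat.
    have := congr1 (divn^~ #|K|) E; rewrite /= ![(_ + _ * #|K|)%N]addnC !divnMDl ?cardK //.
    by rewrite -cardK !divn_small // !addn0.
  have Ei : (t + i * c = t' + i' * c)%N by move: E; rewrite Ej => /addIn.
  have Eii : i = i' :> nat.
    have := congr1 (divn^~ c) Ei; rewrite /= ![(_ + _ * c)%N]addnC !divnMDl //.
    by rewrite !divn_small // !addn0.
  have Et : t = t' :> nat by move: Ei; rewrite Eii => /addIn.
  by congr (_, _, _); apply: val_inj.
case=> a0 va0; case: (@arg_minnP _ a0 (fun a => v a != 0) e va0) => a va a_min.
apply/eqP => /(congr1 (fun p : {poly K} => p`_(e a))); rewrite coef0 coef_sum.
have R_E b : R_term b = f1 ^+ (b.1.1 * c) * 'X^(e b).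
  rewrite /R_term fE exprMn mulrA -exprD mulrC; congr (_ * 'X^_).
  by rewrite /e; lia.
rewrite (bigD1 a) //= big1 => [|b b_neq]; last first.
  rewrite coefZ R_E coefMXn; case: ltnP => [|le_ba]; first by rewrite mulr0.
  have [->|vb] := eqVneq (v b) 0; first by rewrite mul0r.
  have /e_inj b_a : e b = e a by apply/eqP; rewrite eqn_leq le_ba a_min.
  by rewrite b_a eqxx in b_neq.
rewrite addr0 coefZ R_E coefMXn ltnn subnn -horner_coef0 horner_exp.
by apply/eqP; rewrite mulf_neq0 // expf_neq0.
Qed.

(* With [Q = #|K|], the auxiliary polynomial [sum v_(i,j,t) X^(t + j Q) f^(i c)] is nonzero, its
   terms having distinct orders at 0. At a point [x] with [f(x)^c = zeta], substituting
   [X = x + f(x) Y] turns [f^(i c)] into [zeta^i w^(i c)] and [X^Q] into [x], modulo [Y^l]; so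
   vanishing to order [l] at all such [x] follows from linear conditions that do not depend on [x]. *)
Lemma stepanov_bound :
  (#|[set x | f.[x] ^+ c == zeta]| * l < (J + m) * #|K|)%N.
Proof.
have [w hw ww] := subst_f.
pose U := (c + m * l + J)%N.
have [|v v_neq0 v_sol] := @exists_nontrivial_relation K index ('I_l * 'I_U)%type
    (fun a b => (Phi_term w a)`_(b.1)`_(b.2)).
  by rewrite !card_prod !card_ord.
pose R := \sum_a v a *: R_term a; have R_neq0 : R != 0 by apply: R_coprime.
pose Phi := \sum_a (v a)%:P%:P * Phi_term w a.
have Phi0 s : (s < l)%N -> Phi`_s = 0.
  move=> lt_sl; apply/polyP => t; rewrite coef0.
  have PE : Phi`_s`_t = \sum_a v a * (Phi_term w a)`_s`_t.
    rewrite /Phi coef_sum coef_sum; apply: eq_bigr => a _.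
    by rewrite coefCM coefCM.
  case: (ltnP t U) => [lt_tU|le_Ut].
    by rewrite PE (v_sol (Ordinal lt_sl, Ordinal lt_tU)).
  rewrite PE big1 // => a _; rewrite [_`_t]nth_default ?mulr0 //.
  apply: leq_trans (Phi_weight a ww s) _; apply: leq_trans le_Ut; rewrite /U.
  have := ltn_ord a.1.2; nia.
have dvd_root x : f.[x] ^+ c = zeta -> ('X - x%:P) ^+ l %| R.
  move=> fxc; pose v0 := f.[x].
  have v0_neq0 : v0 != 0.
    by apply: contraNneq zeta0 => v00; rewrite -fxc -/v0 v00 expr0n; case: (c) c_gt0.
  have dvd1 : 'X^l %| R \Po (x%:P + v0%:P * 'X).
    have -> : R \Po (x%:P + v0%:P * 'X) =
       \sum_a (v a)%:P * (R_term a \Po (x%:P + v0%:P * 'X) - ev x (Phi_term w a)) + ev x Phi.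
      rewrite /ev /R /Phi !rmorph_sum -big_split /=; apply: eq_bigr => a _.
      have -> : map_poly (horner_eval x) ((v a)%:P%:P * Phi_term w a) =
          v a *: map_poly (horner_eval x) (Phi_term w a).
        by rewrite rmorphM /= map_polyC /= /horner_eval hornerC mul_polyC.
      by rewrite comp_polyZ [(v a)%:P * _]mul_polyC -scalerDr subrK.
    apply: dvdp_add.
      elim/big_rec: _ => [|a p _ dvd_p]; first exact: dvdp0.
      by apply: dvdp_add => //; rewrite dvdp_mull // R_Phi.
    apply: dvdXn_coef0 => s lt_sl.
    by rewrite /ev coef_map Phi0 //= /horner_eval horner0.
  (* Undo the substitution: [Y = (X - x) / f(x)] turns [Y^l] into a nonzero multiple of
     [(X - x)^l]. *)
  have := dvdp_comp_poly ((v0^-1)%:P * ('X - x%:P)) dvd1.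
  rewrite -comp_polyA rmorphD /= comp_polyC rmorphM /= comp_polyC comp_polyX.
  rewrite mulrA -polyCM divff // mul1r [x%:P + _]addrC subrK comp_polyXr.
  rewrite rmorphXn /= comp_polyX exprMn -polyC_exp mul_polyC dvdpZl //.
  by rewrite expf_neq0 // invr_eq0.
have dvd_prod : \prod_(x <- enum [set x | f.[x] ^+ c == zeta]) ('X - x%:P) ^+ l %| R.
  apply: dvdp_prod_XsubC_exp (enum_uniq _) _ => x.
  by rewrite mem_enum inE => /eqP; apply: dvd_root.
have := dvdp_leq R_neq0 dvd_prod; rewrite prodrXl.
set P := \prod_(x <- _) _; have := size_exp P l.
rewrite size_prod_XsubC -cardE /= => sP le_R.
have size_R : (size R <= (J + m) * #|K|)%N.
  rewrite /R; elim/big_ind: _ => [|p q sp sq|a _]; first by rewrite size_poly0.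
    by apply: leq_trans (size_polyD _ _) _; rewrite geq_max sp.
  apply: leq_trans (size_scale_leq _ _) _; apply: leq_trans (size_polyMleq _ _) _.
  have := size_poly_exp_leq f (a.1.1 * c); rewrite size_polyXn.
  have le_f : ((size f).-1 * (a.1.1 * c) <= m * (a.1.1 * c))%N.
    by rewrite leq_mul2r; apply/orP; right; lia.
  have := ltn_ord a.1.1; have := ltn_ord a.1.2; have := ltn_ord a.2.
  have lt_c : (a.1.1 * c < #|K|)%N by have := ltn_ord a.1.1; rewrite cardK; nia.
  have lt_d : (a.1.1 * c + c <= #|K|)%N by have := ltn_ord a.1.1; rewrite cardK; nia.
  move: le_f; move: (nat_of_ord a.1.1) (nat_of_ord a.1.2) (nat_of_ord a.2) (size _) (size _) lt_c lt_d => i j t s1 s2 lt_c lt_d.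
  nia.
have P_neq0 : P ^+ l != 0 by apply: contraTneq dvd_prod; rewrite prodrXl => ->; rewrite dvd0p.
rewrite -sP; apply: leq_trans size_R; apply: leq_trans le_R.
by rewrite prednK // size_poly_gt0.
Qed.

End Stepanov.

(** * The L-function of a multiplicative character *)

Section MonicPolynomials.
Variable F : finFieldType.
Implicit Types P h g : {poly F}.

Definition monics (n : nat) : seq {poly F} :=
  [seq 'X^n + rVpoly v | v <- enum [set: 'rV[F]_n]].

Lemma mem_monics n h : (h \in monics n) = (h \is monic) && (size h == n.+1).
Proof.
apply/mapP/andP => [[v _ ->]|[h_monic /eqP sh]].
  have lt_v : (size (rVpoly v) < size ('X^n : {poly F})%R)%N.
    by rewrite size_polyXn ltnS size_poly.
  by rewrite monicE lead_coefDl // lead_coefXn size_polyDl // size_polyXn !eqxx.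
exists (poly_rV (h - 'X^n)); first by rewrite mem_enum in_setT.
rewrite poly_rV_K; first by rewrite addrC subrK.
apply/leq_sizeP => j le_nj.
rewrite coefB coefXn; case: eqP le_nj => [->|neq] le_nj.
  by move: h_monic; rewrite monicE /lead_coef sh => /eqP ->; rewrite subrr.
by rewrite nth_default ?subrr // sh; lia.
Qed.

Lemma monics_uniq n : uniq (monics n).
Proof.
rewrite map_inj_uniq ?enum_uniq // => u v /addrI.
exact: (can_inj rVpolyK).
Qed.

Lemma size_monics n : size (monics n) = (#|F| ^ n)%N.
Proof. by rewrite size_map -cardE cardsT card_mx mul1n. Qed.

Definition irreducible_monics (e : nat) : seq {poly F} :=
  [seq P <- monics e | boolp.asbool (irreducible_poly P)].

Lemma mem_irreducible_monics e P :
  reflect [/\ P \is monic, size P = e.+1 & irreducible_poly P]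
          (P \in irreducible_monics e).
Proof.
rewrite mem_filter mem_monics; apply: (iffP idP).
  by move=> /and3P[/boolp.asboolP irrP mP /eqP sP].
by case=> mP sP irrP; rewrite mP sP eqxx !andbT; apply/boolp.asboolP.
Qed.

Lemma irreducible_divisor h :
  (1 < size h)%N -> exists2 P, P \is monic /\ irreducible_poly P & P %| h.
Proof.
have [n] := ubnP (size h); elim: n h => // n IH h lt_hn h_gt1.
have h_neq0 : h != 0 by rewrite -size_poly_gt0; apply: ltn_trans h_gt1.
case: (boolp.pselect (irreducible_poly h)) => [irr_h|red_h].
  have l0 : (lead_coef h)^-1 != 0 by rewrite invr_eq0 lead_coef_eq0.
  exists ((lead_coef h)^-1 *: h); last by rewrite dvdpZl.
  split; first by rewrite monicE lead_coefZ mulVf // lead_coef_eq0.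
  case: irr_h => h1 hirr; split; first by rewrite size_scale.
  move=> g g1; rewrite dvdpZr // => /(hirr _ g1) /eqp_trans; apply.
  by rewrite eqp_sym eqp_scale.
have [g [g1 gh ngh]] : exists g, [/\ size g != 1, g %| h & ~~ (g %= h)].
  apply: boolp.contrapT => H; apply: red_h; split=> // g g1 gh.
  by apply: boolp.contrapT => /negP ngh; apply: H; exists g.
have g_neq0 : g != 0 by apply: contraTneq gh => ->; rewrite dvd0p.
have lt_gh : (size g < size h)%N.
  rewrite ltn_neqAle dvdp_leq // andbT.
  by apply: contra ngh => /eqP sgh; rewrite -(dvdp_size_eqp gh) sgh.
have [|| P irrP Pg] := IH g; first by apply: leq_trans lt_gh _.
  by rewrite ltn_neqAle eq_sym g1 size_poly_gt0.
by exists P => //; apply: dvdp_trans gh.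
Qed.

Lemma irreducible_monic_coprime P Q :
  P \is monic -> Q \is monic -> irreducible_poly P -> irreducible_poly Q ->
  P != Q -> coprimep P Q.
Proof.
move=> mP mQ irrP irrQ; apply: contraNT; rewrite /coprimep => g1.
have := irrP.2 _ g1 (dvdp_gcdl P Q); have := irrQ.2 _ g1 (dvdp_gcdr P Q).
rewrite eqp_sym => /eqp_trans QP /QP.
by rewrite eqp_sym eqp_monic.
Qed.

(** The multiplicity of [P] in [h] once [B] is at least the degree of [h]. Counting powers lets a
    sum over [h] be taken first, over the multiples of [P^j]. *)
Definition multiplicity_sum (B : nat) P h := (\sum_(1 <= j < B.+1) (P ^+ j %| h)%R)%N.

(** Induction on the degree: removing one irreducible factor [P0] lowers the multiplicity of [P0] by
    one and leaves those of the other irreducible polynomials unchanged. *)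
Lemma degree_multiplicity B n h : h \in monics n -> (n <= B)%N ->
  n = (\sum_(1 <= e < B.+1) \sum_(P <- irreducible_monics e) e * multiplicity_sum B P h)%N.
Proof.
elim/ltn_ind: n h => -[|n] IH h; rewrite mem_monics => /andP[mh /eqP sh] le_nB.
  rewrite big1 // => e _; rewrite big_seq big1 // => P /mem_irreducible_monics[mP sP irrP].
  rewrite /multiplicity_sum big1_seq ?muln0 // => j /andP[_]; rewrite mem_index_iota => /andP[j1 _].
  have /eqP -> : h == 1 by rewrite -eqp_monic ?monic1 // -size_poly_eq1 sh.
  rewrite dvdp1; apply/eqP; rewrite eqb0.
  apply/negP => /eqP Pj; have := size_exp P j; rewrite Pj /=.
  have e_gt0 : (0 < e)%N by have := irrP.1; rewrite sP.
  by move/eqP; rewrite sP eq_sym muln_eq0 !gtn_eqF.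
have [|P0 [mP0 irrP0] /dvdpP [g hE]] := @irreducible_divisor h; first by rewrite sh.
have P0_neq0 : P0 != 0 by rewrite monic_neq0.
have mg : g \is monic by rewrite -(monicMr _ mP0) -hE.
have g_neq0 := monic_neq0 mg.
have [e0 sP0] : exists e0, size P0 = e0.+1 by exists (size P0).-1; rewrite prednK ?size_poly_gt0.
have e0_gt0 : (0 < e0)%N by have := irrP0.1; rewrite sP0.
have [d sg] : exists d, size g = d.+1 by exists (size g).-1; rewrite prednK ?size_poly_gt0.
have nE : (n.+1 = e0 + d)%N.
  by move: sh; rewrite hE size_mul // sg sP0; lia.
have gd : g \in monics d by rewrite mem_monics mg sg eqxx.
have mult_neq P : P \is monic -> irreducible_poly P -> P != P0 ->
    multiplicity_sum B P h = multiplicity_sum B P g.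
  move=> mP irrP neqP; apply: eq_bigr => j _; rewrite hE Gauss_dvdpl //.
  by rewrite coprimep_expl // irreducible_monic_coprime.
have mult_eq : multiplicity_sum B P0 h = (multiplicity_sum B P0 g).+1.
  rewrite /multiplicity_sum big_add1 /=.
  rewrite (eq_bigr (fun j => ((P0 ^+ j %| g)%R : nat))) => [|j _]; last first.
    by rewrite hE exprSr dvdp_mul2r.
  have ndvd : (P0 ^+ B.-1.+1 %| g)%R = false.
    apply/negP => /(dvdp_leq g_neq0); rewrite sg leqNgt => /negP; apply.
    have := size_exp P0 B.-1.+1; rewrite sP0 /=.
    have := leq_pmull B.-1.+1 e0_gt0; move: (size (P0 ^+ B.-1.+1)%R) => S.
    move: (e0 * _)%N => T; lia.
  have -> : B = B.-1.+1 by lia.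
  rewrite big_nat_recl // expr0 dvd1p big_add1 /= big_nat_recr //= ndvd addn0.
  by rewrite add1n.
have dB : (d <= B)%N by lia.
have := IH d _ g gd dB; rewrite nE => IHd; rewrite {1}IHd; last by lia.
have e0B : e0 \in index_iota 1 B.+1 by rewrite mem_index_iota; lia.
rewrite (bigD1_seq e0) ?iota_uniq //= [RHS](bigD1_seq e0) ?iota_uniq //= addnA; congr (_ + _)%N.
  have P0e : P0 \in irreducible_monics e0 by apply/mem_irreducible_monics.
  have uI : uniq (irreducible_monics e0) by rewrite filter_uniq ?monics_uniq.
  rewrite (bigD1_seq P0) //= [RHS](bigD1_seq P0) //= mult_eq mulnS addnA; congr (_ + _)%N.
  rewrite big_seq_cond [RHS]big_seq_cond; apply: eq_bigr => P.
  by case/andP => /mem_irreducible_monics[mP _ irrP] neqP; rewrite mult_neq.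
apply: eq_bigr => e neq_e; rewrite big_seq [RHS]big_seq; apply: eq_bigr => P.
case/mem_irreducible_monics => mP sP irrP; rewrite mult_neq //.
by apply: contraNneq neq_e => PP0; rewrite -eqSS -sP -sP0 PP0.
Qed.

Lemma perm_map_multiples n e j P : P \is monic -> size P = e.+1 -> (e * j <= n)%N ->
  perm_eq [seq h <- monics n | P ^+ j %| h] [seq g * P ^+ j | g <- monics (n - e * j)].
Proof.
move=> mP sP le_n; have mPj : P ^+ j \is monic by apply: rpredX.
have Pj_neq0 := monic_neq0 mPj.
have sPj : size (P ^+ j) = (e * j).+1.
  have := size_exp P j; rewrite sP /= => <-; rewrite prednK // size_poly_gt0 //.
apply: uniq_perm; first by rewrite filter_uniq // monics_uniq.
  by rewrite map_inj_uniq ?monics_uniq // => g1 g2 /mulIf; apply.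
move=> h; rewrite mem_filter mem_monics; apply/idP/mapP.
  case/and3P => /dvdpP[g ->] mh /eqP sh; exists g => //.
  have mg : g \is monic by rewrite -(monicMr _ mPj).
  rewrite mem_monics mg; have := monic_neq0 mg => g_neq0.
  move: sh; rewrite size_mul // sPj => sh; apply/eqP; move: sh.
  by move: (size g) => S; lia.
case=> g; rewrite mem_monics => /andP[mg /eqP sg] ->.
by rewrite dvdp_mull //= monicMr // mg size_mul ?monic_neq0 // sg sPj; apply/eqP; lia.
Qed.

Lemma reindex_multiples (V : zmodType) (G : nat -> nat -> V) (e n : nat) : (0 < e)%N ->
  \sum_(1 <= j < n.+1 | (e * j <= n)%N) G j (e * j)%N =
  \sum_(1 <= k < n.+1 | (e %| k)%N) G (k %/ e)%N k.
Proof.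
move=> e0.
rewrite -[LHS]big_filter -[RHS]big_filter.
transitivity (\sum_(k <- [seq (e * j)%N | j <- [seq j <- index_iota 1 n.+1 | (e * j <= n)%N]])
    G (k %/ e)%N k).
  by rewrite big_map; apply: eq_bigr => j _; rewrite mulKn.
apply: perm_big; apply: uniq_perm.
- rewrite map_inj_uniq ?filter_uniq ?iota_uniq // => i j /eqP.
  by rewrite eqn_pmul2l // => /eqP.
- by rewrite filter_uniq ?iota_uniq.
move=> k; rewrite mem_filter mem_index_iota; apply/mapP/and3P.
  case=> j; rewrite mem_filter mem_index_iota => /and3P[le_n j1 _] ->.
  by rewrite dvdn_mulr // ltnS le_n muln_gt0 e0.
case=> /dvdnP[j ->] k1 kn; exists j; last by rewrite mulnC.
rewrite mem_filter mem_index_iota [(e * j)%N]mulnC -ltnS kn /=.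
move: k1; rewrite muln_gt0 => /andP[-> _] /=; apply: leq_ltn_trans kn.
by rewrite leq_pmulr.
Qed.

Section LFunction.
Variable lam : {poly F} -> algC.
Hypotheses (lam1 : lam 1 = 1) (lamM : {morph lam : g h / g * h}).

Definition Lcoef (n : nat) : algC := \sum_(h <- monics n) lam h.

(* The coefficients of [T L'/L], where [L] is the power series with coefficients [Lcoef]. *)
Definition prime_power_sum (k : nat) : algC :=
  \sum_(1 <= e < k.+1 | (e %| k)%N)
    \sum_(P <- irreducible_monics e) e%:R * lam P ^+ (k %/ e).

Lemma lamX g n : lam (g ^+ n) = lam g ^+ n.
Proof. by elim: n => [|n IH]; rewrite ?expr0 // !exprS lamM IH. Qed.

Lemma Lcoef0 : Lcoef 0 = 1.
Proof.
rewrite /Lcoef (_ : monics 0 = [:: 1]) ?big_seq1 //; apply: perm_small_eq => //.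
apply: uniq_perm => //; first exact: monics_uniq.
move=> h; rewrite mem_monics inE; apply/andP/eqP => [[mh sh]|->].
  by apply/eqP; rewrite -eqp_monic ?monic1 // -size_poly_eq1.
by rewrite monic1 size_poly1.
Qed.

Lemma sum_monic_multiples n e j P : P \is monic -> size P = e.+1 ->
  \sum_(h <- monics n) (P ^+ j %| h)%R%:R * lam h =
  if (e * j <= n)%N then lam P ^+ j * Lcoef (n - e * j) else 0.
Proof.
move=> mP sP; case: ifP => [le_n|gt_n].
  transitivity (\sum_(h <- [seq h <- monics n | P ^+ j %| h]) lam h).
    rewrite big_filter [RHS]big_mkcond; apply: eq_bigr => h _.
    by case: (_ %| _); rewrite ?mul1r ?mul0r.
  rewrite (perm_big _ (perm_map_multiples mP sP le_n)) big_map mulr_sumr.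
  by apply: eq_bigr => g _; rewrite lamM lamX mulrC.
rewrite big_seq big1 // => h; rewrite mem_monics => /andP[mh /eqP sh].
case: (boolP (_ %| _)) => [dvd_h|_]; last by rewrite mul0r.
have := dvdp_leq (monic_neq0 mh) dvd_h; have := size_exp P j; rewrite sP sh /=.
by move: (size (P ^+ j)%R) gt_n => S; lia.
Qed.

(** This is [T L' = (T L'/L) L], read off coefficientwise. Weighting each [h] by its degree and
    expanding the degree by [degree_multiplicity] leaves sums over the multiples of [P^j], where
    multiplicativity of [lam] applies. *)
Lemma Lcoef_newton n :
  n%:R * Lcoef n = \sum_(1 <= k < n.+1) prime_power_sum k * Lcoef (n - k).
Proof.
transitivity (\sum_(1 <= e < n.+1) \sum_(P <- irreducible_monics e)
    \sum_(1 <= j < n.+1) e%:R * \sum_(h <- monics n) (P ^+ j %| h)%R%:R * lam h).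
  rewrite /Lcoef mulr_sumr big_seq.
  under eq_bigr => h hn do
    rewrite {1}(degree_multiplicity hn (leqnn n)) raddf_sum mulr_suml.
  rewrite -big_seq exchange_big /=; apply: eq_bigr => e _.
  under eq_bigr => h _ do rewrite raddf_sum mulr_suml.
  rewrite exchange_big /=; apply: eq_bigr => P _.
  under eq_bigr => h _ do rewrite natrM /multiplicity_sum raddf_sum mulr_sumr mulr_suml.
  rewrite exchange_big /=; apply: eq_bigr => j _; rewrite mulr_sumr.
  by apply: eq_bigr => h _; rewrite mulrA.
transitivity (\sum_(1 <= e < n.+1) \sum_(1 <= k < n.+1 | (e %| k)%N)
    \sum_(P <- irreducible_monics e) e%:R * lam P ^+ (k %/ e) * Lcoef (n - k)).
  rewrite big_nat [RHS]big_nat; apply: eq_bigr => e /andP[e0 _].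
  rewrite [RHS]exchange_big /= big_seq [RHS]big_seq; apply: eq_bigr => P.
  case/mem_irreducible_monics => mP sP irrP.
  rewrite -(@reindex_multiples _ (fun j k => e%:R * lam P ^+ j * Lcoef (n - k))) //.
  rewrite [RHS]big_mkcond; apply: eq_bigr => j _; rewrite (sum_monic_multiples _ _ mP sP).
  by case: ifP => _; rewrite ?mulr0 // mulrA.
under eq_bigr => e _ do rewrite big_mkcond.
rewrite exchange_big /= big_nat [RHS]big_nat; apply: eq_bigr => k /andP[k1 kn].
rewrite -big_mkcond /prime_power_sum mulr_suml.
rewrite [RHS](big_nat_widen _ _ n.+1) //; apply: eq_big => [e|e _].
  case: (boolP (e %| k)%N) => //= dvd_k; rewrite ltnS dvdn_leq //.
by rewrite mulr_suml.
Qed.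

End LFunction.

(** Here [L = 1 / (1 - #|F| T)]. The value counts irreducible polynomials, which is how the fibres
    of [min_poly] are later found to be full. *)
Lemma prime_power_sum1 k : (0 < k)%N -> prime_power_sum (fun=> 1) k = (#|F| ^ k)%:R.
Proof.
have LE n : Lcoef (fun=> 1) n = (#|F| ^ n)%:R.
  by rewrite /Lcoef big_const_seq count_predT size_monics iter_addr_0.
elim/ltn_ind: k => -[//|k] IH _.
have := @Lcoef_newton (fun=> 1) erefl (fun _ _ => esym (mulr1 1)) k.+1.
rewrite big_nat_recr //= subnn LE [X in _ = _ + _ * X]LE expn0 mulr1.
have -> : \sum_(1 <= i < k.+1) prime_power_sum (fun=> 1) i * Lcoef (fun=> 1) (k.+1 - i) =
    k%:R * (#|F| ^ k.+1)%:R.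
  rewrite big_nat (eq_bigr (fun=> (#|F| ^ k.+1)%:R)) => [|i /andP[i1 ik]].
    by rewrite -big_nat big_const_nat subn1 iter_addr_0 mulr_natl.
  by rewrite IH // LE -natrM -expnD subnKC // ltnW.
rewrite -addn1 natrD mulrDl mul1r => /addrI <-.
by rewrite addn1.
Qed.

End MonicPolynomials.

(** * Multiplicative characters evaluated on monic polynomials *)

Definition mulchar (F : finFieldType) (chi : F -> algC) :=
  [/\ chi 1 = 1, {morph chi : x y / x * y >-> x * y} & forall x, (chi x == 0) = (x == 0)].

Section MultiplicativeCharacter.
Variables (F : finFieldType) (chi : F -> algC).
Hypothesis chi_char : mulchar chi.

Lemma mulcharX x n : chi (x ^+ n) = chi x ^+ n.
Proof.
case: chi_char => chi1 chiM _.
by elim: n => [|n IH]; rewrite ?expr0 // !exprS chiM IH.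
Qed.

Lemma mulchar0 : chi 0 = 0.
Proof. by case: chi_char => _ _ chi0; apply/eqP; rewrite chi0. Qed.

Lemma mulchar_order x : x != 0 -> chi x ^+ #|F|.-1 = 1.
Proof.
move=> x0; have [chi1 _ _] := chi_char; rewrite -mulcharX -chi1; congr chi.
apply: (mulfI x0); rewrite -exprS mulr1 prednK ?expf_card //.
by apply/card_gt0P; exists 0.
Qed.

Lemma card_field_pred_gt0 : (0 < #|F|.-1)%N.
Proof.
rewrite -ltnS prednK; last by apply/card_gt0P; exists 0.
by rewrite (cardD1 0) (cardD1 1) !inE oner_neq0.
Qed.

Lemma mulchar_norm x : x != 0 -> `|chi x| = 1.
Proof.
move=> x0; apply/eqP; rewrite -(pexpr_eq1 card_field_pred_gt0) ?normr_ge0 //.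
by rewrite -normrX mulchar_order // normr1.
Qed.

Hypothesis chi_nontrivial : exists2 z, z != 0 & chi z != 1.

(** Turns conjugated factors into repeated unconjugated ones, the only kind that occurs in
    [char_at]. *)
Lemma mulchar_conj x : (chi x)^* = chi x ^+ (#|F|.-1).-1.
Proof.
have [chi1 chiM chi0] := chi_char.
have [->|x0] := eqVneq x 0.
  (* At [x = 0] the exponent must be positive. It is 0 only for the field with two elements, where
     every character is trivial. *)
  rewrite mulchar0 conjC0 expr0n; case: eqP => // F1.
  case: chi_nontrivial => z z0; have := mulchar_order z0.
  by rewrite -(prednK card_field_pred_gt0) F1 expr1 => ->; rewrite eqxx.
have cx0 : chi x != 0 by rewrite chi0.
apply: (mulfI cx0); rewrite -normCK mulchar_norm // expr1n -exprS.
by rewrite prednK ?card_field_pred_gt0 // mulchar_order.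
Qed.

Lemma mulchar_sum : \sum_x chi x = 0.
Proof.
case: chi_nontrivial => z z0 chiz; have [_ chiM _] := chi_char.
apply/eqP; have : (chi z - 1) * \sum_x chi x = 0.
  rewrite mulrBl mul1r mulr_sumr [X in _ - X](reindex_inj (mulfI z0)) -sumrB.
  by rewrite big1 // => x _; rewrite chiM subrr.
by move/eqP; rewrite mulf_eq0 subr_eq0 (negPf chiz).
Qed.

Lemma mulchar_sum_affine u v : v != 0 -> \sum_t chi (u + t * v) = 0.
Proof.
move=> v0; rewrite -[RHS]mulchar_sum [RHS](reindex_inj (addrI u)).
by rewrite [RHS](reindex_inj (mulIf v0)).
Qed.

(** A completely multiplicative function of [h] whose degree-one coefficient, over the polynomials
    [X + x], is the character sum to be bounded. This is what attaches an L-function to the sum. *)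
Definition char_at (s : seq F) (h : {poly F}) := \prod_(b <- s) chi h.[b].

Lemma char_at1 s : char_at s 1 = 1.
Proof.
by rewrite /char_at big1 // => b _; rewrite hornerC; case: chi_char.
Qed.

Lemma char_atM s : {morph char_at s : g h / g * h >-> g * h}.
Proof.
move=> g h; rewrite /char_at -big_split; apply: eq_bigr => b _.
by rewrite hornerM; case: chi_char => _ ->.
Qed.

(* Translating [h] by multiples of a polynomial that vanishes on [s] but not at [b0] averages the
   factor [chi h.[b0]] over all of [F] and leaves the other factors unchanged. *)
Lemma Lcoef_eq0 b0 s n : b0 \notin s -> (size (undup s) < n)%N ->
  Lcoef (char_at (b0 :: s)) n = 0.
Proof.
move=> b0s lt_n.
pose g := \prod_(b <- undup s) ('X - b%:P).
have sg : size g = (size (undup s)).+1 by rewrite size_prod_XsubC.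
have g_s b : b \in s -> g.[b] = 0.
  by move=> bs; apply/eqP; rewrite -/(root g b) root_prod_XsubC mem_undup.
have g_b0 : g.[b0] != 0 by rewrite -/(root g b0) root_prod_XsubC mem_undup.
have shift_perm t : perm_eq (monics F n) [seq h + t *: g | h <- monics F n].
  have lt_tg : (size (t *: g) < n.+1)%N.
    by apply: leq_ltn_trans (size_scale_leq _ _) _; rewrite sg.
  apply: uniq_perm; first exact: monics_uniq.
    by rewrite map_inj_uniq ?monics_uniq // => ? ? /addIr.
  have shift c h : (size (c *: g) < n.+1)%N -> h \in monics F n -> h + c *: g \in monics F n.
    rewrite !mem_monics => lt_cg /andP[mh /eqP sh].
    by rewrite monicE lead_coefDl ?sh // (monicP mh) size_polyDl ?sh // !eqxx.
  move=> h; apply/idP/mapP => [hn|[h' hn ->]]; last exact: shift.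
  exists (h + (- t) *: g); last by rewrite scaleNr subrK.
  by apply: shift; rewrite // scaleNr size_polyN.
have q0 : (#|F|%:R : algC) != 0.
  by rewrite pnatr_eq0 -lt0n; apply/card_gt0P; exists 0.
apply: (mulfI q0); rewrite mulr0 mulr_natl -sumr_const.
transitivity (\sum_(t in F) \sum_(h <- monics F n) char_at (b0 :: s) (h + t *: g)).
  by apply: eq_bigr => t _; rewrite /Lcoef (perm_big _ (shift_perm t)) big_map.
rewrite exchange_big /= big1 // => h _.
transitivity (\sum_t chi (h.[b0] + t * g.[b0]) * \prod_(b <- s) chi h.[b]).
  apply: eq_bigr => t _; rewrite /char_at big_cons hornerD hornerZ; congr (_ * _).
  apply: eq_big_seq => b bs.
  by rewrite hornerD hornerZ g_s // mulr0 addr0.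
by rewrite -mulr_suml mulchar_sum_affine // mul0r.
Qed.

Lemma Lcoef_1 s : Lcoef (char_at s) 1 = \sum_x \prod_(b <- s) chi (x + b).
Proof.
rewrite /Lcoef /monics big_map big_enum_cond /=.
pose r (x : F) : 'rV[F]_1 := const_mx x.
rewrite (reindex r); last first.
  exists (fun v : 'rV[F]_1 => v 0 0) => [x _|v _]; first by rewrite mxE.
  by apply/rowP => i; rewrite mxE !ord1.
apply: eq_big => [x|x _]; first by rewrite inE.
apply: eq_bigr => b _; congr chi.
have -> : rVpoly (r x) = x%:P.
  apply/polyP => i; rewrite coef_rVpoly coefC; case: insubP => [j _ <-|] /=.
    by rewrite mxE ord1.
  by case: i.
by rewrite expr1 hornerD hornerX hornerC addrC.
Qed.

End MultiplicativeCharacter.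

(** * Frobenius orbits, irreducible polynomials over the prime field, and the norm *)

Section FrobeniusOrbits.
Variables (p k : nat) (K : finFieldType) (iota : {rmorphism 'F_p -> K}).
Hypotheses (p_pr : prime p) (k_gt0 : (0 < k)%N) (cardK : #|K| = (p ^ k)%N).

Let pK : p \in [pchar K].
Proof. by apply: (rmorph_pchar iota); apply: pchar_Fp. Qed.

Let phi : K -> K := pFrobenius_aut pK.

Let cardF : #|'F_p| = p. Proof. exact: card_Fp. Qed.

Let phiE x : phi x = x ^+ p. Proof. exact: pFrobenius_autE. Qed.

Let phi_inj : injective phi. Proof. exact: fmorph_inj. Qed.

Let iter_phi i x : iter i phi x = x ^+ (p ^ i).
Proof. by elim: i => [|i IH] /=; rewrite ?expr1 // IH phiE -exprM expnSr. Qed.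

Let phi_k x : iter k phi x = x. Proof. by rewrite iter_phi -cardK expf_card. Qed.

Let iter_mod x m : iter m phi x = iter (m %% fingraph.order phi x) phi x.
Proof.
rewrite {1}(divn_eq m (fingraph.order phi x)) addnC iterD; congr (iter _ _ _).
elim: (m %/ _)%N => [|a IH]; first by rewrite mul0n.
by rewrite mulSn iterD IH (iter_order phi_inj).
Qed.

Let order_dvd x : (fingraph.order phi x %| k)%N.
Proof.
have lt_r : (k %% fingraph.order phi x < fingraph.order phi x)%N by rewrite ltn_pmod.
by have := findex_iter lt_r; rewrite -iter_mod phi_k findex0 /dvdn => <-.
Qed.

Let iota_inj : injective iota. Proof. exact: fmorph_inj. Qed.

Let iota_fixed z : phi (iota z) = iota z.
Proof. by rewrite phiE -rmorphXn -[X in z ^+ X]cardF expf_card. Qed.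

(* [0] outside the prime field. *)
Definition inv_iota (c : K) : 'F_p := odflt 0 [pick z | iota z == c].

Lemma inv_iotaK z : inv_iota (iota z) = z.
Proof.
rewrite /inv_iota; case: pickP => [y /eqP/iota_inj //|/(_ z)].
by rewrite eqxx.
Qed.

(** The fixed points of Frobenius are the roots of [X^p - X], which splits over the image of the
    prime field. *)
Let iotaK c : phi c = c -> iota (inv_iota c) = c.
Proof.
move=> phic; suff [z ->] : exists z, c = iota z by rewrite inv_iotaK.
have := congr1 (map_poly iota) (finField_genPoly 'F_p).
rewrite rmorphB /= map_polyXn map_polyX rmorph_prod /= cardF.
move=> /(congr1 (fun P : {poly K} => P.[c])); rewrite !hornerE horner_prod -phiE phic subrr.
move/esym/eqP/prodf_eq0 => [z _].
rewrite rmorphB /= map_polyX map_polyC /= hornerXsubC subr_eq0 => /eqP ->.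
by exists z.
Qed.

Let conj_poly x : {poly K} := \prod_(y <- fingraph.orbit phi x) ('X - y%:P).

(** Applying [inv_iota] to the coefficients loses nothing: Frobenius permutes the orbit, so it fixes
    the coefficients of [conj_poly x], which therefore lie in the prime field. *)
Definition min_poly x : {poly 'F_p} := map_poly inv_iota (conj_poly x).

Let perm_orbit x : perm_eq (map phi (fingraph.orbit phi x)) (fingraph.orbit phi x).
Proof.
have uphi : uniq (map phi (fingraph.orbit phi x)) by rewrite (map_inj_uniq phi_inj) orbit_uniq.
apply: uniq_perm; rewrite ?orbit_uniq //.
have sub : {subset map phi (fingraph.orbit phi x) <= fingraph.orbit phi x}.
  by move=> _ /mapP[y yx ->]; apply: fingraph.mem_orbit.
have [|_ //] := uniq_min_size uphi sub; by rewrite size_map.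
Qed.

Let iota_min_poly x : map_poly iota (min_poly x) = conj_poly x.
Proof.
have phi_conj : map_poly phi (conj_poly x) = conj_poly x.
  rewrite rmorph_prod /= /conj_poly -[RHS](perm_big _ (perm_orbit x)) big_map.
  by apply: eq_bigr => y _; rewrite rmorphB /= map_polyX map_polyC.
apply/polyP => i; rewrite coef_map coef_map_id0 /=; last by rewrite -(rmorph0 iota) inv_iotaK.
by apply: iotaK; rewrite -[RHS](congr1 (fun q : {poly K} => q`_i) phi_conj) coef_map.
Qed.

Let size_min_poly x : size (min_poly x) = (fingraph.order phi x).+1.
Proof. by rewrite -(size_map_poly iota) iota_min_poly size_prod_XsubC size_orbit. Qed.

Let root_orbit (g : {poly 'F_p}) x y : root (map_poly iota g) x ->
  y \in fingraph.orbit phi x -> root (map_poly iota g) y.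
Proof.
move=> gx; rewrite -fconnect_orbit => /iter_findex <-.
elim: (findex _ _ _) => //= i; set z := iter i phi x => gz.
have fix_g : map_poly phi (map_poly iota g) = map_poly iota g.
  by rewrite -map_poly_comp; apply: eq_map_poly => c /=; apply: iota_fixed.
by rewrite -fix_g /root horner_map (rootP gz) rmorph0.
Qed.

(** A nonconstant divisor over the prime field has a root in the orbit of [x]; Frobenius fixes its
    coefficients, so it vanishes on the whole orbit. *)
Let min_poly_irreducible x : min_poly x \in irreducible_monics 'F_p (fingraph.order phi x).
Proof.
apply/mem_irreducible_monics; split; last 1 first.
- split; first by rewrite size_min_poly ltnS fingraph.order_gt0.
  move=> g g1; rewrite -(dvdp_map iota) iota_min_poly => dvd_g.
  have min_neq0 : conj_poly x != 0 by rewrite monic_neq0 // monic_prod_XsubC.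
  have g_neq0 : map_poly iota g != 0 by apply: contraTneq dvd_g => ->; rewrite dvd0p.
  suff dvd_xg : conj_poly x %| map_poly iota g.
    by rewrite /eqp -!(dvdp_map iota) iota_min_poly dvd_g.
  have [msk [_ eq_g]] : exists msk, true /\ map_poly iota g %= \prod_(y <- mask msk (fingraph.orbit phi x)) ('X - y%:P).
    by have [msk ?] := dvdp_prod_XsubC dvd_g; exists msk.
  have : (1 < size (map_poly iota g))%N.
    by rewrite size_map_poly ltn_neqAle eq_sym g1 size_poly_gt0 -(map_poly_eq0 iota).
  rewrite (eqp_size eq_g) size_prod_XsubC ltnS.
  case E : (mask _ _) => [//|y r] _.
  have yx : y \in fingraph.orbit phi x by apply: (mem_mask (m := msk)); rewrite E mem_head.
  have gy : root (map_poly iota g) y.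
    by rewrite (eqp_root eq_g) root_prod_XsubC E mem_head.
  apply: uniq_roots_dvdp; last by rewrite uniq_rootsE orbit_uniq.
  apply/allP => z zx; apply: root_orbit gy _; rewrite -fconnect_orbit.
  rewrite (connect_trans (y := x)) ?fconnect_orbit //.
  by rewrite -fconnect_orbit fconnect_sym // fconnect_orbit.
- by rewrite -(map_monic iota) iota_min_poly monic_prod_XsubC.
- exact: size_min_poly.
Qed.

Let fibre_le e P : P \in irreducible_monics 'F_p e ->
  (#|[set x | min_poly x == P]| <= e)%N.
Proof.
case/mem_irreducible_monics => mP sP _.
have P0 : map_poly iota P != 0 by rewrite map_poly_eq0 monic_neq0.
have := max_poly_roots P0 _ (enum_uniq [set x | min_poly x == P]).
rewrite size_map_poly sP -cardE ltnS; apply.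
apply/allP => x; rewrite mem_enum inE => /eqP <-.
by rewrite iota_min_poly root_prod_XsubC in_orbit.
Qed.

Let sum_fibres (V : nzRingType) (G : {poly 'F_p} -> nat -> V) :
  \sum_(x : K) G (min_poly x) (fingraph.order phi x) =
  \sum_(1 <= e < k.+1 | (e %| k)%N) \sum_(P <- irreducible_monics 'F_p e)
     #|[set x | min_poly x == P]|%:R * G P e.
Proof.
transitivity (\sum_(x : K) \sum_(1 <= e < k.+1 | (e %| k)%N)
   \sum_(P <- irreducible_monics 'F_p e) (min_poly x == P)%:R * G P e).
  apply: eq_bigr => x _.
  have ox : fingraph.order phi x \in [seq e <- index_iota 1 k.+1 | (e %| k)%N].
    by rewrite mem_filter order_dvd mem_index_iota fingraph.order_gt0 ltnS dvdn_leq.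
  have uI e : uniq (irreducible_monics 'F_p e) by rewrite filter_uniq ?monics_uniq.
  rewrite -big_filter (bigD1_seq (fingraph.order phi x)) ?filter_uniq ?iota_uniq //=.
  rewrite [X in _ + X]big1 => [|e neq_e].
    rewrite addr0 (bigD1_seq (min_poly x)) ?min_poly_irreducible ?uI //= eqxx mul1r big1 ?addr0 // => P.
    by rewrite eq_sym => /negPf ->; rewrite mul0r.
  rewrite big_seq big1 // => P /mem_irreducible_monics[_ sP _].
  case: eqP => [E|]; last by rewrite mul0r.
  by case/negP: neq_e; apply/eqP; apply: succn_inj; rewrite -sP -E size_min_poly.
rewrite exchange_big /=; apply: eq_bigr => e _.
rewrite exchange_big /=; apply: eq_bigr => P _.
rewrite -mulr_suml -natr_sum; congr (_%:R * _).
by rewrite -sum1_card [RHS]big_mkcond; apply: eq_bigr => x _; rewrite inE; case: eqP.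
Qed.

(** Totals are compared, with no appeal to splitting fields. The fibres add up to [#|K| = p^k]; by
    [prime_power_sum1] the degrees [e], summed over the same irreducible polynomials, also add up to
    [p^k]; and no fibre exceeds its [e]. *)
Let fibre_card e P : (0 < e)%N -> (e %| k)%N -> P \in irreducible_monics 'F_p e ->
  #|[set x | min_poly x == P]| = e.
Proof.
move=> e0 ek Pe; apply/eqP; rewrite eqn_leq fibre_le //=.
have E1 := @sum_fibres algC (fun _ _ => 1).
have E2 := prime_power_sum1 'F_p k_gt0.
have EK : \sum_(x : K) 1 = (p ^ k)%:R :> algC.
  by rewrite -cardK -sum1_card natr_sum; apply: eq_bigl => x; rewrite inE.
rewrite cardF -EK E1 {E1 EK} in E2.
have {}E2 : (\sum_(1 <= e < k.+1 | (e %| k)%N) \sum_(P <- irreducible_monics 'F_p e) e)%N =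
  (\sum_(1 <= e < k.+1 | (e %| k)%N) \sum_(P <- irreducible_monics 'F_p e)
      #|[set x | min_poly x == P]|)%N.
  have cast (G : nat -> {poly 'F_p} -> nat) :
      (\sum_(1 <= e < k.+1 | (e %| k)%N) \sum_(P <- irreducible_monics 'F_p e) G e P)%:R =
      \sum_(1 <= e < k.+1 | (e %| k)%N) \sum_(P <- irreducible_monics 'F_p e) (G e P)%:R :> algC.
    by rewrite natr_sum; apply: eq_bigr => i _; rewrite natr_sum.
  apply/eqP; rewrite -(eqr_nat algC) !cast; apply/eqP; apply: etrans (etrans _ E2) _.
    by apply: eq_bigr => i _; apply: eq_bigr => Q _; rewrite expr1n mulr1.
  by apply: eq_bigr => i _; apply: eq_bigr => Q _; rewrite mulr1.
rewrite leqNgt; apply/negP => lt_e.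
have : (\sum_(1 <= e < k.+1 | (e %| k)%N) \sum_(P <- irreducible_monics 'F_p e)
      #|[set x | min_poly x == P]| <
   \sum_(1 <= e < k.+1 | (e %| k)%N) \sum_(P <- irreducible_monics 'F_p e) e)%N.
  have ek1 : e \in [seq e <- index_iota 1 k.+1 | (e %| k)%N].
    by rewrite mem_filter ek mem_index_iota e0 ltnS dvdn_leq.
  have uI : uniq (irreducible_monics 'F_p e) by rewrite filter_uniq ?monics_uniq.
  have le_in i : (\sum_(P <- irreducible_monics 'F_p i) #|[set x | min_poly x == P]| <=
     \sum_(P <- irreducible_monics 'F_p i) i)%N.
    by rewrite big_seq [X in (_ <= X)%N]big_seq; apply: leq_sum => Q; apply: fibre_le.
  rewrite -big_filter (bigD1_seq e) ?filter_uniq ?iota_uniq //=.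
  rewrite -[X in (_ < X)%N]big_filter [X in (_ < X)%N](bigD1_seq e) ?filter_uniq ?iota_uniq //=.
  rewrite -addSn leq_add //; last by apply: leq_sum => i _.
  rewrite (bigD1_seq P) //= [X in (_ < X)%N](bigD1_seq P) //=.
  rewrite -addSn leq_add // big_seq_cond [X in (_ <= X)%N]big_seq_cond.
  by apply: leq_sum => Q /andP[/fibre_le].
by rewrite E2 ltnn.
Qed.

Lemma prime_power_sum_field (lam : {poly 'F_p} -> algC) :
  prime_power_sum lam k = \sum_(x : K) lam (min_poly x) ^+ (k %/ fingraph.order phi x).
Proof.
rewrite (sum_fibres (fun P e => lam P ^+ (k %/ e))) /prime_power_sum.
rewrite big_nat_cond [RHS]big_nat_cond; apply: eq_bigr => e /andP[/andP[e0 _] ek].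
by apply: eq_big_seq => P Pe; rewrite (fibre_card e0 ek Pe).
Qed.

(** The factors [iota b - x^(p^i)] with [i < k] run [k / e] times through the conjugates. Both sides
    are the norm of [iota b - x] to the prime field. *)
Let orbit_prod x (b : 'F_p) :
  iota ((min_poly x).[b] ^+ (k %/ fingraph.order phi x)) = (iota b - x) ^+ (\sum_(i < k) p ^ i).
Proof.
set e := fingraph.order phi x; set z := iota b - x.
have zi i : iota b - iter i phi x = z ^+ (p ^ i).
  rewrite -iter_phi; elim: i => //= i <-.
  have -> : phi (iota b - iter i phi x) = phi (iota b) - phi (iter i phi x).
    exact: (rmorphB (pFrobenius_aut pK)).
  by rewrite iota_fixed.
have ze : z ^+ (p ^ e) = z by rewrite -zi (iter_order phi_inj).
pose w := \prod_(0 <= i < e) z ^+ (p ^ i).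
have wE : iota (min_poly x).[b] = w.
  rewrite -horner_map /= iota_min_poly horner_prod /fingraph.orbit -/e /w.
  elim: e {ze w} => [|e IH]; first by rewrite big_nil big_nil.
  rewrite trajectSr -cats1 big_cat /= big_seq1 big_nat_recr //= IH.
  by rewrite hornerXsubC zi.
have -> : (\sum_(i < k) p ^ i = \sum_(i < k %/ e * e) p ^ i)%N.
  by rewrite (divnK (order_dvd x)).
rewrite rmorphXn /= wE.
elim: (k %/ e)%N => [|a IH]; first by rewrite mul0n big_ord0 !expr0.
rewrite exprSr IH mulSnr -[in RHS](big_mkord xpredT (fun i => p ^ i)%N).
rewrite (@big_cat_nat _ _ _ (a * e)) //= ?leq_addr // exprD big_mkord; congr (_ * _).
have pa : z ^+ (p ^ (a * e)) = z.
  by elim: a {IH} => [|a IH]; rewrite ?expr1 // mulSn expnD exprM ze IH.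
rewrite -{1}[(a * e)%N]add0n big_addn addKn expr_sum; apply: eq_bigr => i _.
by rewrite expnD mulnC exprM pa.
Qed.

Lemma prime_power_sum_norm (chi : 'F_p -> algC) (s : seq 'F_p) : mulchar chi ->
  prime_power_sum (char_at chi s) k =
  \sum_(x : K) \prod_(b <- s) chi (inv_iota ((iota b - x) ^+ (\sum_(i < k) p ^ i))).
Proof.
move=> chi_char; rewrite prime_power_sum_field; apply: eq_bigr => x _.
rewrite /char_at -prodrXl; apply: eq_bigr => b _.
by rewrite -orbit_prod inv_iotaK mulcharX.
Qed.

(** With [c = 1 + p + ... + p^(k-1)] one has [c p + 1 = c + p^k], so [y^c] is fixed by Frobenius and
    lies in the prime field. *)
Lemma inv_iota_norm y :
  iota (inv_iota (y ^+ (\sum_(i < k) p ^ i))) = y ^+ (\sum_(i < k) p ^ i).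
Proof.
apply: iotaK; rewrite phiE -exprM; set c := (\sum_(i < k) _)%N.
have c0 : (0 < c)%N by rewrite /c -(prednK k_gt0) big_ord_recl.
have [->|y0] := eqVneq y 0; first by rewrite !expr0n muln_eq0 (gtn_eqF c0) (gtn_eqF (prime_gt0 p_pr)).
apply: (mulfI y0); rewrite -!exprS; have -> : ((c * p).+1 = c + p ^ k)%N.
  have := predn_exp p k; rewrite -/c; have := prime_gt0 p_pr.
  have : (0 < p ^ k)%N by rewrite expn_gt0 prime_gt0.
  by case: p => // p' ; rewrite /= mulnS; move: (_ ^ k)%N => X; lia.
by rewrite exprD -cardK expf_card -exprSr.
Qed.

End FrobeniusOrbits.

(** * Weil's bound *)

Lemma finite_field_extension (p k : nat) : prime p -> (0 < k)%N ->
  exists (K : finFieldType) (iota : {rmorphism 'F_p -> K}), #|K| = (p ^ k)%N.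
Proof.
move=> p_pr k0; have [K0 pK cK] := pPrimePowerField p_pr k0.
exists (pPrimeCharType pK : finFieldType).
by exists (in_alg (pPrimeCharType pK)); rewrite -cK.
Qed.

Section PowerSums.
Implicit Types (rs : seq algC).

Definition one_minus_prod rs : {poly algC} := \prod_(a <- rs) (1 - a *: 'X).

(** Induction on [rs]: a new member [a] multiplies the polynomial by [1 - a X], and the powers of
    [a] that it brings telescope. *)
Lemma newton_identity rs n :
  n%:R * (one_minus_prod rs)`_n =
  - \sum_(1 <= k < n.+1) (\sum_(a <- rs) a ^+ k) * (one_minus_prod rs)`_(n - k).
Proof.
elim: rs n => [|a rs IH] n.
  rewrite /one_minus_prod big_nil coef1 big1 ?oppr0 => [|k _]; last by rewrite big_nil mul0r.
  by case: n => [|n]; rewrite ?mul0r // mulr0.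
set e := fun i => (one_minus_prod rs)`_i; set s := fun k => \sum_(a <- rs) a ^+ k.
have eE i : (one_minus_prod (a :: rs))`_i = e i - a * (if i is i'.+1 then e i' else 0).
  rewrite /one_minus_prod big_cons mulrBl mul1r coefB -scalerAl coefZ coefXM.
  by case: i.
case: n => [|n]; first by rewrite big_geq // mul0r oppr0.
have IH1 : n.+1%:R * e n.+1 = - \sum_(1 <= k < n.+2) s k * e (n.+1 - k)%N by apply: IH.
have IH0 : n%:R * e n = - \sum_(1 <= k < n.+1) s k * e (n - k)%N by apply: IH.
have telescope : \sum_(1 <= k < n.+2) a ^+ k * (one_minus_prod (a :: rs))`_(n.+1 - k) = a * e n.
  rewrite big_add1 /= big_mkord.
  have T (m : nat) : \sum_(i < m.+1) a ^+ i.+1 * (one_minus_prod (a :: rs))`_(m - i) = a * e m.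
    elim: m => [|m IHm]; first by rewrite big_ord_recl big_ord0 addr0 eE mulr0 subr0 expr1.
    rewrite big_ord_recl /= subn0 expr1 eE.
    under eq_bigr => i _ do rewrite /bump /= add1n subSS exprS -mulrA.
    by rewrite -mulr_sumr IHm mulrBr subrK.
  by rewrite -T; apply: eq_bigr => i _; rewrite subSS.
under eq_bigr => k _ do rewrite big_cons mulrDl.
rewrite big_split /= telescope.
have -> : \sum_(1 <= k < n.+2) s k * (one_minus_prod (a :: rs))`_(n.+1 - k) =
    \sum_(1 <= k < n.+2) s k * e (n.+1 - k)%N - a * \sum_(1 <= k < n.+1) s k * e (n - k)%N.
  rewrite big_nat_recr //= subnn eE mulr0 subr0 [in RHS]big_nat_recr //= subnn.
  rewrite addrAC; congr (_ + _); rewrite mulr_sumr -sumrB.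
  rewrite big_nat [RHS]big_nat; apply: eq_bigr => k /andP[k1 kn].
  by rewrite subSn ?ltnS // eE mulrBr mulrCA.
rewrite eE; move: IH1 IH0; set A := \sum_(_ <= _ < _) _; set B := \sum_(_ <= _ < _) _.
move=> IH1 IH0; have -> : n.+1%:R * (e n.+1 - a * e n) = n.+1%:R * e n.+1 - a * (n%:R * e n) - a * e n.
  by rewrite -addn1 natrD; ring.
by rewrite IH1 IH0; ring.
Qed.

Lemma bernoulli_algC (x : algC) n : 0 <= x -> 1 + n%:R * x <= (1 + x) ^+ n.
Proof.
move=> x0; elim: n => [|n IH]; first by rewrite mul0r addr0 expr0.
rewrite exprS; apply: le_trans (ler_wpM2l _ IH); last by rewrite addr_ge0.
have -> : (1 + x) * (1 + n%:R * x) = 1 + n.+1%:R * x + n%:R * x ^+ 2.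
  by rewrite -addn1 natrD; ring.
by rewrite lerDl mulr_ge0 // exprn_ge0.
Qed.

Lemma growth_le (x y c C : algC) (t0 : nat) : 0 <= x -> 0 < y -> 0 < c ->
  (forall t, (t0 <= t)%N -> c * x ^+ t <= C * y ^+ t) -> x <= y.
Proof.
move=> x0 y0 c0 H; have xr : x \is Num.real by apply: ger0_real.
have yr : y \is Num.real by apply: gtr0_real.
rewrite real_leNgt //; apply/negP => lt_yx.
pose r := x / y - 1; have r0 : 0 < r by rewrite subr_gt0 ltr_pdivlMr // mul1r.
have bound t : (t0 <= t)%N -> 1 + t%:R * r <= C / c.
  move=> /H; rewrite -ler_pdivrMr ?exprn_gt0 // -mulrA -expr_div_n mulrC -ler_pdivlMr //.
  apply: le_trans; have -> : x / y = 1 + r by rewrite /r addrC subrK.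
  by rewrite bernoulli_algC // ltW.
have Cc : 0 <= C / c.
  by apply: le_trans (bound _ (leqnn t0)); rewrite addr_ge0 // mulr_ge0 // ltW.
have Cr : 0 <= C / c / r by rewrite divr_ge0 // ltW.
have := archi_boundP Cr; set N := Num.bound _; rewrite ltr_pdivrMr // => ltN.
suff : C / c < C / c by rewrite ltxx.
apply: (lt_le_trans ltN); apply: le_trans (bound (maxn t0 N) (leq_maxl _ _)).
rewrite ler_wpDl // ler_wpM2r //; first exact: ltW.
by rewrite ler_nat leq_maxr.
Qed.

(** A polynomial [h] vanishing at every other member of [rs] gives a fixed combination of
    consecutive power sums equal to [b^t h(b)] times the multiplicity of [b]. So [|b|^t] is at most
    a constant times [y^t]: cancellation between members cannot hide a large one. *)
Lemma power_sums_bound rs (C y : algC) (t0 : nat) : 0 < y ->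
  (forall t, (t0 <= t)%N -> `|\sum_(a <- rs) a ^+ t| <= C * y ^+ t) ->
  forall a, a \in rs -> `|a| <= y.
Proof.
move=> y0 H b b_rs.
pose h := \prod_(a <- rem b (undup rs)) ('X - a%:P).
have hb : h.[b] != 0.
  rewrite -/(root h b) root_prod_XsubC mem_rem_uniqF ?undup_uniq //.
have h_rs a : a \in rs -> a != b -> h.[a] = 0.
  move=> a_rs ab; apply/eqP; rewrite -/(root h a) root_prod_XsubC.
  by rewrite mem_rem_uniq ?undup_uniq // !inE ab mem_undup.
have key t : \sum_(i < size h) h`_i * (\sum_(a <- rs) a ^+ (t + i)) = (count_mem b rs)%:R * (b ^+ t * h.[b]).
  under eq_bigr => i _ do rewrite mulr_sumr.
  rewrite exchange_big /= (bigID (pred1 b)) /= [X in _ + X]big_seq_cond [X in _ + X]big1 => [|a].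
    rewrite addr0 -big_filter (eq_big_seq (fun=> b ^+ t * h.[b])) => [|a]; last first.
      rewrite mem_filter /= => /andP[/eqP -> _]; rewrite horner_coef mulr_sumr.
      by apply: eq_bigr => i _; rewrite exprD mulrCA.
    by rewrite big_const_seq count_predT size_filter iter_addr_0 mulr_natl.
  case/andP => a_rs ab; transitivity (a ^+ t * h.[a]); last by rewrite h_rs // mulr0.
  rewrite horner_coef mulr_sumr; apply: eq_bigr => i _; rewrite exprD mulrCA //.
apply: (@growth_le _ _ ((count_mem b rs)%:R * `|h.[b]|) (\sum_(i < size h) `|h`_i| * (C * y ^+ i)) t0) => //.
  by rewrite mulr_gt0 ?normr_gt0 // ltr0n -has_count has_pred1.
move=> t le_t.
have -> : (count_mem b rs)%:R * `|h.[b]| * `|b| ^+ t = `|(count_mem b rs)%:R * (b ^+ t * h.[b])|.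
  by rewrite !normrM normrX normr_nat; ring.
rewrite -key; apply: le_trans (ler_norm_sum _ _ _) _; rewrite mulr_suml; apply: ler_sum => i _.
rewrite normrM -mulrA ler_wpM2l //; apply: le_trans (H _ _) _.
  by apply: leq_trans le_t (leq_addr _ _).
by rewrite exprD mulrA mulrAC.
Qed.

(* The numbers [- S k] are the power sums of the inverse roots of the polynomial with coefficients
   [c], and a bound for all large even power sums bounds each inverse root. *)
Lemma first_coefficient_bound (c S : nat -> algC) (M t0 : nat) (C y : algC) :
  0 < y -> c 0%N = 1 -> (forall n, (M < n)%N -> c n = 0) ->
  (forall n, n%:R * c n = \sum_(1 <= k < n.+1) S k * c (n - k)%N) ->
  (forall t, (t0 <= t)%N -> `|S (2 * t)%N| <= C * y ^+ t) ->
  `|c 1%N| <= M%:R * sqrtC y.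
Proof.
move=> y0 c0 cM cS Sb; pose Q := \poly_(i < M.+1) c i.
have Qc i : Q`_i = c i.
  by rewrite coef_poly; case: ltnP => // /cM ->.
have [r Qr] := closed_field_poly_normal Q.
have Q0 : Q != 0 by apply: contra_eq_neq c0 => E; rewrite -Qc E coef0 eq_sym oner_neq0.
have r_neq0 z : z \in r -> z != 0.
  move=> zr; apply/eqP => z0; move/eqP: c0; apply/negP; rewrite -Qc -horner_coef0 Qr hornerZ.
  have -> : (\prod_(z <- r) ('X - z%:P)).[0] = 0.
    by apply/eqP; rewrite -/(root _ 0) root_prod_XsubC -z0.
  by rewrite mulr0 eq_sym oner_neq0.
pose rs := [seq z^-1 | z <- r].
have QE : Q = one_minus_prod rs.
  have E : \prod_(z <- r) ('X - z%:P) = (\prod_(z <- r) - z) *: one_minus_prod rs.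
    rewrite /one_minus_prod /rs big_map -mul_polyC rmorph_prod -big_split /=.
    apply: eq_big_seq => z /r_neq0 z0; rewrite rmorphN /= mulrBr mulr1 -scalerAr.
    by rewrite mulNr mul_polyC scalerN scalerA mulVf // scale1r opprK addrC.
  have one0 s : (one_minus_prod s)`_0 = 1.
    rewrite -horner_coef0 /one_minus_prod horner_prod big1 // => a _.
    by rewrite hornerD hornerN hornerZ hornerX hornerC mulr0 subr0.
  have := Qr; rewrite E scalerA => Q2; rewrite Q2 -[RHS]scale1r; congr (_ *: _).
  by have := congr1 (fun q : {poly algC} => q`_0) Q2; rewrite coefZ one0 mulr1 Qc c0.
have size_rs : (size rs <= M)%N.
  have: (size Q <= M.+1)%N by apply: size_poly.
  by rewrite Qr size_scale ?lead_coef_eq0 // size_prod_XsubC ltnS size_map.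
have cN n : n%:R * c n = - \sum_(1 <= k < n.+1) (\sum_(a <- rs) a ^+ k) * c (n - k)%N.
  rewrite -Qc QE newton_identity; congr (- _); apply: eq_bigr => k _.
  by rewrite -Qc QE.
have SE k : (0 < k)%N -> S k = - \sum_(a <- rs) a ^+ k.
  elim/ltn_ind: k => -[//|k] IH _; have := cS k.+1; rewrite cN.
  rewrite big_nat_recr //= [in RHS]big_nat_recr //= subnn c0 !mulr1 opprD -sumrN.
  have -> : \sum_(1 <= i < k.+1) - ((\sum_(a <- rs) a ^+ i) * c (k.+1 - i)%N) =
      \sum_(1 <= i < k.+1) S i * c (k.+1 - i)%N.
    by rewrite big_nat [RHS]big_nat; apply: eq_bigr => i /andP[i1 ik]; rewrite IH // mulNr.
  by move/addrI.
have sy : 0 <= sqrtC y by rewrite sqrtC_ge0 ltW.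
have norm_rs a : a \in rs -> `|a| <= sqrtC y.
  move=> a_rs; rewrite -(@ler_pXn2r _ 2) ?nnegrE // sqrtCK -normrX.
  (* Power sums of even order are the power sums of the squares, so [y] bounds [|a|^2]. *)
  apply: (@power_sums_bound [seq a ^+ 2 | a <- rs] C y t0.+1) => //; last first.
    by apply/mapP; exists a.
  move=> t lt_t; rewrite big_map; under eq_bigr => i _ do rewrite -exprM.
  by rewrite -normrN -SE ?muln_gt0 ?(leq_trans _ lt_t) // Sb // ltnW.
have := cN 1%N; rewrite mul1r big_nat1 subnn c0 mulr1 => ->.
rewrite normrN; apply: le_trans (ler_norm_sum _ _ _) _.
apply: (@le_trans _ _ (\sum_(a <- rs) sqrtC y)).
  by rewrite big_seq [leRHS]big_seq; apply: ler_sum => a /norm_rs; rewrite expr1.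
rewrite big_const_seq count_predT iter_addr_0 -[leLHS]mulr_natl ler_wpM2r //.
by rewrite ler_nat.
Qed.

End PowerSums.

Section WeilBound.
Variables (p : nat) (chi : 'F_p -> algC) (b0 : 'F_p) (s : seq 'F_p).
Hypotheses (p_pr : prime p) (chi_char : mulchar chi).
Hypothesis chi_nontrivial : exists2 z, z != 0 & chi z != 1.
Hypothesis b0s : b0 \notin s.

Let m := (size s).+1.
Let D := (p.-1 * (2 * m + 4))%N.

(** With [J = q0 + m + 4] the terms on the left are at most about [(q0 + 1) l^2], [m l^2] and
    [2 l^2], and the right side is [J (l^2 - 1)]; the 4 leaves one [l^2] to spare. The order [l] is
    the square root of the field size, hence the extensions of even degree. *)
Lemma stepanov_parameters (l d c q0 r : nat) : (0 < d)%N -> (l = q0 * d + r)%N ->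
  (r < d)%N -> (l * l = (d * c).+1)%N -> (m + 4 <= l)%N ->
  (l * (c + m * l + (q0 + m + 4)) < d * (q0 + m + 4) * c)%N.
Proof.
move=> d0 lE r_lt QE le_l.
have -> : (d * (q0 + m + 4) * c = (q0 + m + 4) * (d * c))%N by rewrite mulnAC mulnC.
have h1 : (l * c <= (q0 + 1) * (d * c))%N.
  by rewrite mulnA leq_mul2r; apply/orP; right; nia.
have h2 : (q0 <= l)%N by nia.
have h3 : (l * (q0 + m + 4) <= 2 * (l * l))%N by nia.
have -> : (l * (c + m * l + (q0 + m + 4)) = l * c + m * (l * l) + l * (q0 + m + 4))%N by nia.
have h4 : (m + 4 <= l * l)%N by nia.
move: h1 h3 h4; rewrite QE; move: (d * c)%N (l * c)%N (l * _)%N => X Y Z h1 h3 h4.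
nia.
Qed.

(* The fibres of the norm of [f] add up to [#|K|] and each is bounded above by Stepanov's method;
   the deficits are therefore nonnegative with a small sum, which bounds the character sum. *)
Lemma even_power_sum_bound j : (m + 4 <= p ^ j)%N ->
  `|prime_power_sum (char_at chi (b0 :: s)) (2 * j)| <= (D + m)%:R * p%:R ^+ j.
Proof.
move=> le_j; set l := (p ^ j)%N.
have p_gt1 := prime_gt1 p_pr.
have j_gt0 : (0 < j)%N by case: j le_j {l} => // ; rewrite expn0; lia.
have k_gt0 : (0 < 2 * j)%N by rewrite muln_gt0.
have [K [iota cardK]] := finite_field_extension p_pr k_gt0.
have cardK2 : #|K| = (l * l)%N by rewrite cardK /l -expnD addnn mul2n.
rewrite (@prime_power_sum_norm p (2 * j) K iota p_pr k_gt0 cardK chi _ chi_char).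
set c := (\sum_(i < 2 * j) p ^ i)%N.
have cE : #|K| = (p.-1 * c).+1.
  rewrite cardK -predn_exp prednK // expn_gt0; lia.
have c_gt0 : (0 < c)%N by case: (c) cE => //; rewrite muln0 cardK2; nia.
have d_gt0 : (0 < p.-1)%N by lia.
(* Replacing [x] by [iota b0 - x] moves the root belonging to [b0] to 0, where [b0s] makes it
   simple. Stepanov's argument reads off orders of vanishing at this point. *)
pose f1 : {poly K} := \prod_(b <- s) ('X - (iota (b0 - b))%:P).
pose f : {poly K} := 'X * f1.
have f1_0 : f1.[0] != 0.
  rewrite horner_prod prodf_seq_neq0; apply/allP => b bs /=.
  rewrite hornerXsubC sub0r oppr_eq0 fmorph_eq0 subr_eq0.
  by apply: contraNneq b0s => ->.
have size_f : size f = m.+1.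
  rewrite /f mulrC size_mulX; last by apply: contraNneq f1_0 => ->; rewrite horner0.
  by rewrite size_prod_XsubC.
pose Nz z := #|[set x | f.[x] ^+ c == iota z]|.
have memE z x : (inv_iota iota (f.[x] ^+ c) == z) = (f.[x] ^+ c == iota z).
  apply/eqP/eqP => [<-|H]; first by rewrite (@inv_iota_norm p (2 * j) K iota p_pr k_gt0 cardK).
  by apply: (fmorph_inj iota); rewrite (@inv_iota_norm p (2 * j) K iota p_pr k_gt0 cardK).
have sumE : \sum_(x : K) \prod_(b <- b0 :: s) chi (inv_iota iota ((iota b - x) ^+ c)) =
    \sum_z chi z * (Nz z)%:R.
  have inv_norm y := @inv_iota_norm p (2 * j) K iota p_pr k_gt0 cardK y : iota (inv_iota iota (y ^+ c)) = y ^+ c.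
  rewrite (reindex_inj (can_inj (subKr (iota b0)))) /=.
  have E x : \prod_(b <- b0 :: s) chi (inv_iota iota ((iota b - (iota b0 - x)) ^+ c)) =
      chi (inv_iota iota (f.[x] ^+ c)).
    transitivity (chi (\prod_(b <- b0 :: s) inv_iota iota ((iota b - (iota b0 - x)) ^+ c))).
      case: (chi_char) => chi1 chiM _.
      by elim/big_rec2: _ => [|b y z _ ->]; rewrite ?chi1 ?chiM.
    congr chi; apply: (fmorph_inj iota); rewrite inv_norm rmorph_prod /=.
    rewrite (eq_bigr _ (fun b _ => inv_norm _)) prodrXl; congr (_ ^+ _).
    rewrite big_cons opprB addrCA subrr addr0 /f hornerM hornerX; congr (_ * _).
    rewrite horner_prod; apply: eq_bigr => b _.
    by rewrite hornerXsubC rmorphB /=; ring.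
  rewrite (eq_bigr _ (fun x _ => E x)) (partition_big (fun x => inv_iota iota (f.[x] ^+ c)) xpredT) //=.
  apply: eq_bigr => z _; rewrite (eq_bigr (fun=> chi z)) => [|x /eqP -> //].
  rewrite sumr_const mulr_natr; congr (_ *+ _).
  by apply: eq_card => x; rewrite [RHS]inE -memE.
rewrite sumE.
have sumN : (\sum_z Nz z = l * l)%N.
  rewrite -cardK2 -sum1_card (partition_big (fun x => inv_iota iota (f.[x] ^+ c)) xpredT) //=.
  apply: eq_bigr => z _; rewrite sum1_card.
  by apply: eq_card => x; rewrite [LHS]inE -memE.
have N0 : (Nz 0%R <= m)%N.
  have f_neq0 : f != 0 by rewrite -size_poly_gt0 size_f.
  have := max_poly_roots f_neq0 _ (enum_uniq [set x | f.[x] ^+ c == iota 0]).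
  rewrite size_f -cardE ltnS; apply; apply/allP => x.
  by rewrite mem_enum inE rmorph0 expf_eq0 c_gt0.
have NzB z : z != 0 -> (p.-1 * Nz z <= l * l + D * l)%N.
  move=> z0; pose J := (l %/ p.-1 + m + 4)%N.
  have := divn_eq l p.-1; have := ltn_pmod l d_gt0.
  move: (l %% p.-1)%N => r r_lt lE.
  have le_f : (size f <= m.+1)%N by rewrite size_f.
  have iz0 : iota z != 0 by rewrite fmorph_eq0.
  have le_l : (l <= #|K|)%N by rewrite cardK2; nia.
  have many : (l * (c + m * l + J) < p.-1 * J * c)%N.
    by apply: stepanov_parameters lE _ _ _ => //; rewrite -?cE.
  have := @stepanov_bound K l p.-1 c m J f f1 (iota z) erefl f1_0 le_f cE c_gt0 iz0 le_l many.
  rewrite -/(Nz z) cardK2 => N.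
  have {}N : (Nz z < (J + m) * l)%N by move: N; rewrite mulnA ltn_pmul2r //; nia.
  have : (p.-1 * Nz z <= p.-1 * ((J + m) * l))%N by rewrite leq_mul2l ltnW ?orbT.
  move/leq_trans; apply.
  have -> : (p.-1 * ((J + m) * l) = p.-1 * (l %/ p.-1) * l + p.-1 * (2 * m + 4) * l)%N.
    by rewrite /J; nia.
  by rewrite leq_add2r leq_mul2r [(p.-1 * _)%N]mulnC leq_trunc_div orbT.
set S := \sum_z _; pose D2 := (l * l + D * l)%N.
have chi0 := mulchar0 chi_char.
have dS : p.-1%:R * S = - \sum_(z | z != 0) chi z * (D2 - p.-1 * Nz z)%N%:R.
  have -> : \sum_(z | z != 0) chi z * (D2 - p.-1 * Nz z)%N%:R =
      D2%:R * \sum_z chi z - p.-1%:R * S.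
    rewrite /S [X in D2%:R * X](bigD1 0) //= [X in _ - _ * X](bigD1 0) //= chi0 mul0r !add0r.
    rewrite !mulr_sumr -sumrB; apply: eq_bigr => z z0.
    by rewrite natrB ?NzB // natrM; ring.
  by rewrite (mulchar_sum chi_char chi_nontrivial) mulr0 sub0r opprK.
have dS_le : `|p.-1%:R * S| <= (p.-1 * ((D + m) * l))%N%:R.
  rewrite dS normrN; apply: le_trans (ler_norm_sum _ _ _) _.
  apply: (@le_trans _ _ (\sum_(z : 'F_p | z != 0) (D2 - p.-1 * Nz z)%N)%:R).
    rewrite natr_sum; apply: ler_sum => z z0.
    by rewrite normrM (mulchar_norm chi_char z0) mul1r normr_nat.
  rewrite ler_nat sumnB; last by move=> z; apply: NzB.
  rewrite sum_nat_const -big_distrr /= cardC1 card_Fp //.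
  move: sumN; rewrite (bigD1 0) //= => sumN.
  rewrite /D2; move: N0 sumN; move: (Nz 0%R) (\sum_(i | _) _)%N => N0 T N0m sumN.
  have l1 : (1 <= l)%N by lia.
  rewrite -mulnBr leq_mul2l; apply/orP; right; nia.
move: dS_le; rewrite normrM normr_nat natrM ler_pM2l ?ltr0n // => /le_trans; apply.
by rewrite natrM /l natrX.
Qed.

(** The shift [b0] occurs exactly once, so the product is nontrivial whatever the order of [chi].
    The other shifts may repeat, and only the distinct ones among them are counted, because their
    number bounds the degree of the L-polynomial. *)
Theorem weil_bound :
  `|\sum_x \prod_(b <- b0 :: s) chi (x + b)| <= (size (undup s))%:R * sqrtC p%:R.
Proof.
rewrite -(Lcoef_1 chi (b0 :: s)).
apply: (@first_coefficient_bound (Lcoef (char_at chi (b0 :: s))) (prime_power_sum (char_at chi (b0 :: s))) _ (m + 4) (D + m)%:R).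
- by rewrite ltr0n prime_gt0.
- by apply: Lcoef0; apply: char_at1.
- by move=> n; apply: Lcoef_eq0.
- by move=> n; apply: Lcoef_newton; [apply: char_at1|apply: char_atM].
move=> t le_t; apply: even_power_sum_bound; apply: leq_trans le_t _.
by apply: ltnW; apply: ltn_expl; apply: prime_gt1.
Qed.

End WeilBound.

(** * Complete character sums to cube-free moduli *)

Definition dchar (q : nat) (chi : nat -> algC) :=
  [/\ chi 1%N = 1, {morph chi : m n / (m * n)%N >-> m * n},
      forall m n, m = n %[mod q] -> chi m = chi n &
      forall n, (chi n == 0) = ~~ coprime n q].

(* Equivalently, [chi] has conductor [q]: it does not factor through any [q %/ p]. *)
Definition primitive (q : nat) (chi : nat -> algC) :=
  forall p, prime p -> (p %| q)%N ->
  exists n, [/\ n = 1 %[mod q %/ p], coprime n q & chi n != 1].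

Definition complete_sum (q : nat) (chi : nat -> algC) (us vs : seq nat) : algC :=
  \sum_(x < q) (\prod_(b <- us) chi (x + b)%N) * (\prod_(b <- vs) chi (x + b)%N)^*.

(* The absolute difference, as one of the truncated subtractions is [0]. *)
Definition ndist (m n : nat) := (m - n + (n - m))%N.

Section DirichletCharacter.
Variables (q : nat) (chi : nat -> algC).
Hypotheses (q_gt0 : (0 < q)%N) (chi_char : dchar q chi).

Lemma dchar_mod n : chi (n %% q) = chi n.
Proof. by case: chi_char => _ _ chiP _; apply: chiP; rewrite modn_mod. Qed.

Lemma dcharX m n : chi (m ^ n)%N = chi m ^+ n.
Proof.
case: chi_char => chi1 chiM _ _; elim: n => [|n IH]; first by rewrite expn0 chi1.
by rewrite expnS exprS chiM IH.
Qed.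

Lemma dchar_norm1 n : coprime n q -> `|chi n| = 1.
Proof.
move=> co_n; have [chi1 _ chiP _] := chi_char.
have t0 : (0 < totient q)%N by rewrite totient_gt0.
apply/eqP; rewrite -(pexpr_eq1 t0) ?normr_ge0 // -normrX -dcharX.
by rewrite (chiP _ _ (Euler_exp_totient co_n)) chi1 normr1.
Qed.

Lemma dchar_norm_le1 n : `|chi n| <= 1.
Proof.
have [co_n|] := boolP (coprime n q); first by rewrite dchar_norm1.
by case: chi_char => _ _ _ <- /eqP ->; rewrite normr0 ler01.
Qed.

Lemma prod_dchar_norm_le1 (F : nat -> nat) s : `|\prod_(b <- s) chi (F b)| <= 1.
Proof.
elim: s => [|b s IH]; first by rewrite big_nil normr1.
by rewrite big_cons normrM mulr_ile1 ?normr_ge0 // dchar_norm_le1.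
Qed.

Lemma complete_sum_trivial us vs : `|complete_sum q chi us vs| <= q%:R.
Proof.
apply: le_trans (ler_norm_sum _ _ _) _.
rewrite -[X in _ <= X%:R]card_ord -sumr_const; apply: ler_sum => x _.
by rewrite normrM norm_conjC mulr_ile1 ?normr_ge0 // (prod_dchar_norm_le1 (addn x)).
Qed.

End DirichletCharacter.

Section CompleteSumPrime.
Variables (p : nat) (chi : nat -> algC).
Hypotheses (p_pr : prime p) (chi_char : dchar p chi).

Let chiF (x : 'F_p) := chi x.

Let chiF_nat n : chiF (n%:R) = chi n.
Proof. by rewrite /chiF /= val_Fp_nat // (dchar_mod chi_char). Qed.

Let chiF_char : mulchar chiF.
Proof.
have [chi1 chiM chiP chi0] := chi_char; have p_gt1 := prime_gt1 p_pr.
split=> [|x y|x]; first by rewrite -[1]/(1%:R) chiF_nat.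
  by rewrite -[in LHS](natr_Zp x) -[in LHS](natr_Zp y) -natrM chiF_nat chiM.
rewrite /chiF chi0 coprime_sym prime_coprime // negbK.
apply/idP/eqP => [dvd_p|->]; last by rewrite dvdn0.
by rewrite -[x]natr_Zp; apply/eqP; rewrite -(dvdn_pcharf (pchar_Fp p_pr)).
Qed.

Lemma complete_sum_prime b0 s vs : (exists2 n, coprime n p & chi n != 1) ->
  (forall b, b \in s ++ vs -> b <> b0 %[mod p]) ->
  `|complete_sum p chi (b0 :: s) vs| <= (size (s ++ vs))%:R * sqrtC p%:R.
Proof.
case=> n co_n chin neq_b0; have p_gt1 := prime_gt1 p_pr.
have nontriv : exists2 z, z != 0 & chiF z != 1.
  exists (n%:R : 'F_p); last by rewrite chiF_nat.
  by rewrite -(dvdn_pcharf (pchar_Fp p_pr)) -prime_coprime // coprime_sym.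
pose toF (b : nat) : 'F_p := b%:R.
(* Conjugation is the power [p - 2], so [vs] is repeated that many times. The repetition is free, as
   [weil_bound] counts distinct shifts. *)
pose s' := map toF s ++ flatten (nseq (#|'F_p|.-1).-1 (map toF vs)).
have sub_s' : {subset s' <= map toF (s ++ vs)}.
  move=> x; rewrite map_cat !mem_cat => /orP[->//|/flattenP[y]].
  by rewrite mem_nseq => /andP[_ /eqP ->] ->; rewrite orbT.
have b0s' : toF b0 \notin s'.
  apply/negP => /sub_s' /mapP[b b_s /(congr1 val)].
  by rewrite /= !val_Fp_nat // => E; apply: (neq_b0 b).
have -> : complete_sum p chi (b0 :: s) vs = \sum_(x : 'F_p) \prod_(b <- toF b0 :: s') chiF (x + b).
  have E : forall x : 'F_p, (\prod_(b <- b0 :: s) chi (x + b)%N) * (\prod_(b <- vs) chi (x + b)%N)^* =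
     \prod_(b <- toF b0 :: s') chiF (x + b).
    move=> x; have chix b : chi (x + b)%N = chiF (x + toF b).
      by rewrite -chiF_nat natrD natr_Zp.
    rewrite !big_cons /s' big_cat /= big_map -mulrA; congr (_ * (_ * _)) => //.
      by apply: eq_bigr => b _; rewrite chix.
    rewrite rmorph_prod (eq_bigr _ (fun b _ => congr1 _ (chix b))).
    rewrite (eq_bigr _ (fun b _ => mulchar_conj chiF_char nontriv _)).
    elim: (#|'F_p|.-1).-1 => [|k IH] /=; first by rewrite big_nil big1.
    by rewrite big_cat /= big_map -IH -big_split; apply: eq_bigr => b _; rewrite exprS.
  rewrite /complete_sum -(eq_bigr _ (fun x _ => E x)).
  by rewrite -[in LHS](Fp_cast p_pr).
apply: le_trans (weil_bound p_pr chiF_char nontriv b0s') _.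
rewrite ler_wpM2r ?sqrtC_ge0 ?ler0n // ler_nat.
rewrite -(size_map toF (s ++ vs)); apply: uniq_leq_size; first exact: undup_uniq.
by move=> x; rewrite mem_undup => /sub_s'.
Qed.

End CompleteSumPrime.

Lemma sum_ord_mul (V : zmodType) (m n : nat) (F : nat -> V) :
  \sum_(x < m * n) F x = \sum_(i < m) \sum_(j < n) F (j + n * i)%N.
Proof.
rewrite -(big_mkord xpredT F); elim: m => [|m IH]; first by rewrite mul0n big_geq // big_ord0.
rewrite big_ord_recr /= -IH mulSnr (@big_cat_nat _ _ _ (m * n)) //= ?leq_addr //.
congr (_ + _); rewrite -{1}[(m * n)%N]add0n big_addn addKn big_mkord.
by apply: eq_bigr => j _; rewrite mulnC.
Qed.

Section CompleteSumPrimeSquare.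
Variables (p : nat) (chi : nat -> algC).
Hypotheses (p_pr : prime p) (chi_char : dchar (p * p) chi).

Let zeta := chi (1 + p)%N.

(** Modulo [p^2] the product [(1 + p t) (1 + p)] equals [1 + p (t + 1)]: on these residues a
    multiplicative character is additive in [t]. *)
Lemma chi_1p t : chi (1 + p * t)%N = chi (1 + p)%N ^+ t.
Proof.
have [chi1 chiM chiP _] := chi_char.
elim: t => [|t IH]; first by rewrite muln0 chi1.
rewrite exprSr -IH -chiM; apply: chiP; have -> : ((1 + p * t) * (1 + p) = t * (p * p) + (1 + p * t.+1))%N by ring.
by rewrite modnMDl.
Qed.

Let zeta_p : zeta ^+ p = 1.
Proof.
have [chi1 _ chiP _] := chi_char; rewrite -chi_1p -chi1.
by apply: chiP; rewrite modnDr.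
Qed.

Let log_derivative (F : fieldType) (s : seq F) (u : F) : (forall b, b \in s -> u + b != 0) ->
  (\prod_(b <- s) ('X + b%:P))^`().[u] =
  (\prod_(b <- s) ('X + b%:P)).[u] * \sum_(b <- s) (u + b)^-1.
Proof.
elim: s => [|b s IH] ub; first by rewrite !big_nil derivC horner0 mulr0.
rewrite !big_cons derivM derivD derivX derivC addr0 mul1r hornerD !hornerM.
rewrite IH => [|c cs]; last by apply: ub; rewrite in_cons cs orbT.
rewrite hornerD hornerX hornerC mulrDr; congr (_ + _); last by rewrite mulrA.
by rewrite mulrAC divff ?mul1r // ub // mem_head.
Qed.

Let inv_mod (n : nat) := (n ^ (totient (p * p)).-1)%N.

Let inv_modP n : coprime n p -> n * inv_mod n = 1 %[mod p * p].
Proof.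
move=> co_n; rewrite /inv_mod -expnS prednK ?totient_gt0 ?muln_gt0 ?prime_gt0 //.
by apply: Euler_exp_totient; rewrite coprimeMr co_n.
Qed.

(* The lifts of a residue mod [p] contribute a sum of an additive character, whose frequency is the
   logarithmic derivative at that residue of a rational function; only its roots survive. *)
Lemma complete_sum_prime_square b0 s vs : chi (1 + p)%N != 1 ->
  (forall b, b \in s ++ vs -> b <> b0 %[mod p]) ->
  `|complete_sum (p * p) chi (b0 :: s) vs| <= (size (s ++ vs))%:R * p%:R.
Proof.
rewrite -/zeta => zeta1 neq_b0; have p_gt1 := prime_gt1 p_pr; have p_gt0 := prime_gt0 p_pr.
have [chi1 chiM chiP chi0] := chi_char.
have pp_gt0 : (0 < p * p)%N by rewrite muln_gt0 p_gt0.
set us := b0 :: s.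
pose g x := (\prod_(b <- us) chi (x + b)%N) * (\prod_(b <- vs) chi (x + b)%N)^*.
pose good (u : nat) := all (fun b => coprime (u + b) p) (us ++ vs).
(* The frequency of the additive character on the lifts [u + p v]. Conjugated factors count
   negatively, and [p.-1] stands for -1 in the exponent of a [p]-th root of unity. *)
pose e (u : nat) := (\sum_(b <- us) inv_mod (u + b) + p.-1 * \sum_(b <- vs) inv_mod (u + b))%N.
have chi_shift u v b : coprime (u + b) p ->
    chi (u + p * v + b)%N = chi (u + b)%N * zeta ^+ (v * inv_mod (u + b)).
  move=> co_ub; rewrite -chi_1p -chiM; apply: chiP.
  rewrite mulnDr muln1 (_ : ((u + b) * (p * (v * inv_mod (u + b))) = p * v * ((u + b) * inv_mod (u + b)))%N); last by ring.
  have E : p * v * ((u + b) * inv_mod (u + b)) = p * v %[mod p * p].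
    by rewrite -modnMmr inv_modP // modnMmr muln1.
  by rewrite -[RHS]modnDmr E modnDmr addnAC.
have co1p : coprime (1 + p) (p * p).
  by rewrite coprimeMr andbb coprime_sym /coprime gcdnDr gcdn1.
have zeta_norm : zeta^* = zeta ^+ p.-1.
  have z0 : zeta != 0.
    by rewrite /zeta chi0 negbK.
  apply: (mulfI z0); rewrite -normCK -exprS prednK // zeta_p.
  by rewrite (dchar_norm1 pp_gt0 chi_char) ?expr1n.
have g_good u v : good u -> g (u + p * v)%N = g u * (zeta ^+ e u) ^+ v.
  move=> gu; have co_b b : b \in us ++ vs -> coprime (u + b) p by apply: (allP gu).
  have prodE ws : {subset ws <= us ++ vs} ->
    \prod_(b <- ws) chi (u + p * v + b)%N =
    \prod_(b <- ws) chi (u + b)%N * zeta ^+ (v * \sum_(b <- ws) inv_mod (u + b))%N.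
    move=> sub; rewrite big_distrr /= expr_sum -big_split /=; apply: eq_big_seq => b bw.
    by rewrite chi_shift // co_b // sub.
  rewrite /g !prodE; last 2 first.
  - by move=> b bu; rewrite mem_cat bu.
  - by move=> b bv; rewrite mem_cat bv orbT.
  rewrite rmorphM /= rmorphXn /= zeta_norm -!exprM /e mulrACA -exprD; congr (_ * _ ^+ _).
  by ring.
have g_bad u v : ~~ good u -> g (u + p * v)%N = 0.
  case/allPn => b b_in nco_b.
  have chib0 : chi (u + p * v + b)%N = 0.
    apply/eqP; rewrite chi0 coprimeMr andbb; apply: contra nco_b.
    by rewrite -!(coprime_sym p) !prime_coprime // addnAC dvdn_addl // dvdn_mulr.
  have prod0 ws : b \in ws -> \prod_(b <- ws) chi (u + p * v + b)%N = 0.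
    by move=> bw; apply/eqP; rewrite prodf_seq_eq0; apply/hasP; exists b; rewrite ?chib0 /=.
  move: b_in; rewrite mem_cat /g => /orP[] /prod0 ->; first by rewrite mul0r.
  by rewrite rmorph0 mulr0.
have geom (w : algC) : w ^+ p = 1 -> w != 1 -> \sum_(v < p) w ^+ v = 0.
  move=> wp w1; apply/eqP; have := subrX1 w p; rewrite wp subrr => /esym/eqP.
  by rewrite mulf_eq0 subr_eq0 (negPf w1).
have zeta_prim : p.-primitive_root zeta.
  have [k k_prim k_dvd] := prim_order_exists p_gt0 zeta_p.
  suff <- : k = p by [].
  apply/eqP; move/primeP: p_pr => [_ /(_ _ k_dvd)].
  case/orP => // /eqP k1; move: k_prim; rewrite k1 => /prim_expr_order.
  by rewrite expr1 => z1; rewrite z1 eqxx in zeta1.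
pose toF (b : nat) : 'F_p := b%:R.
pose A := \prod_(b <- map toF us) ('X + b%:P); pose B := \prod_(b <- map toF vs) ('X + b%:P).
(* The numerator of the logarithmic derivative of [A / B]. At [- toF b0], a simple root of [A] where
   [B] does not vanish, only the term with the derivative of [A] survives, so [R] is not zero. *)
pose R := A^`() * B - A * B^`().
have toF0 n : (toF n != 0) = coprime n p.
  by rewrite -(dvdn_pcharf (pchar_Fp p_pr)) -prime_coprime // coprime_sym.
have R_root u : good u -> (p %| e u)%N -> root R (toF u).
  move=> gu dvd_e; have ub b : b \in us ++ vs -> toF u + toF b != 0.
    by move=> b_in; rewrite -natrD toF0; apply: (allP gu).
  have inv_F b : b \in us ++ vs -> toF (inv_mod (u + b)) = (toF u + toF b)^-1.
    move=> b_in; apply: (mulfI (ub b b_in)); rewrite divff ?ub // -natrD -natrM.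
    have co_b : coprime (u + b) p by apply: (allP gu).
    set X := (_ * _)%N; have Xp : X = 1 %[mod p].
      by rewrite -(modn_dvdm X (dvdn_mulr p (dvdnn p))) inv_modP // modn_dvdm // dvdn_mulr.
    by rewrite -(Fp_nat_mod p_pr X) Xp Fp_nat_mod.
  rewrite /root /R hornerD hornerN !hornerM !log_derivative; last 2 first.
  - by move=> _ /mapP[b bv ->]; rewrite ub // mem_cat bv orbT.
  - by move=> _ /mapP[b bu ->]; rewrite ub // mem_cat bu.
  have -> : forall a b c d : 'F_p, a * c * b - a * (b * d) = a * b * (c - d).
    by move=> a b c d; ring.
  rewrite mulf_eq0; apply/orP; right; rewrite !big_map.
  have e0 : toF (e u) = 0 by apply/eqP; rewrite -(dvdn_pcharf (pchar_Fp p_pr)).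
  have p1 : (p.-1)%:R = - 1 :> 'F_p.
    by rewrite -subn1 natrB // (pcharf0 (pchar_Fp p_pr)) sub0r.
  move: e0; rewrite /toF /e natrD natrM !natr_sum p1 mulN1r => e0.
  rewrite -[X in _ == X]e0.
  apply/eqP; congr (_ - _); apply: eq_big_seq => b b_in; rewrite -inv_F // mem_cat b_in ?orbT //.
have R_neq0 : R != 0.
  suff : R.[- toF b0] != 0 by apply: contraNneq => ->; rewrite horner0.
  have prod_neq0 ws : {subset ws <= s ++ vs} ->
      (\prod_(b <- map toF ws) ('X + b%:P)).[- toF b0] != 0.
    move=> sub; rewrite horner_prod prodf_seq_neq0; apply/allP => _ /mapP[b bw ->] /=.
    rewrite hornerD hornerX hornerC addrC subr_eq0; apply/negP => /eqP /(congr1 val).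
    by rewrite /= !val_Fp_nat //; apply/neq_b0/sub.
  rewrite /R /A /us /= big_cons derivM derivD derivX derivC addr0 mul1r.
  rewrite hornerD hornerN !hornerM !hornerD !hornerM !hornerD hornerX hornerC addNr !mul0r.
  rewrite addr0 oppr0 addr0 mulf_neq0 //; apply: prod_neq0 => b b_in; rewrite mem_cat b_in ?orbT //.
have size_prodX (ws : seq 'F_p) : size (\prod_(b <- ws) ('X + b%:P)) = (size ws).+1.
  elim: ws => [|b ws IH]; first by rewrite big_nil size_poly1.
  by rewrite big_cons -[b]opprK rmorphN size_monicM ?monicXsubC ?size_XsubC ?IH // -size_poly_gt0 IH.
have size_R : (size R <= (size (s ++ vs)).+1)%N.
  have size_d (P : {poly 'F_p}) : (size P^`() <= (size P).-1)%N by apply: size_poly.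
  rewrite /R; apply: leq_trans (size_polyD _ _) _; rewrite size_polyN geq_max.
  have sA : size A = (size s).+2 by rewrite size_prodX size_map.
  have sB : size B = (size vs).+1 by rewrite size_prodX size_map.
  apply/andP; split; apply: leq_trans (size_polyMleq _ _) _; rewrite size_cat.
    have := size_d A; rewrite sA sB /=; move: (size A^`()%R) => S; lia.
  have := size_d B; rewrite sA sB /=; move: (size B^`()%R) => S; lia.
have inner u : \sum_(v < p) g (u + p * v)%N = if good u && (p %| e u)%N then g u * p%:R else 0.
  case: ifP => [/andP[gu dvd_e]|].
    rewrite (eq_bigr (fun=> g u)) => [|v _]; last first.
      by rewrite g_good // (eqP (_ : zeta ^+ e u == 1)) ?expr1n ?mulr1 // -(prim_order_dvd zeta_prim).
    by rewrite sumr_const card_ord mulr_natr.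
  have [gu /= ndvd|gu _] := boolP (good u); last by rewrite big1 // => v _; apply: g_bad.
  rewrite (eq_bigr (fun v : 'I_p => g u * (zeta ^+ e u) ^+ v)) => [|v _]; last exact: g_good.
  rewrite -mulr_sumr geom ?mulr0 // -?exprM ?[(e u * p)%N]mulnC ?exprM ?zeta_p ?expr1n //.
  by rewrite -(prim_order_dvd zeta_prim) ndvd.
have -> : complete_sum (p * p) chi us vs = \sum_(u < p) (if good u && (p %| e u)%N then g u * p%:R else 0).
  transitivity (\sum_(u < p) \sum_(v < p) g (u + p * v)%N).
    by rewrite exchange_big /=; apply: (sum_ord_mul p p g).
  by apply: eq_bigr => u _; apply: inner.
have g_le1 u : `|g u| <= 1.
  by rewrite /g normrM norm_conjC mulr_ile1 ?normr_ge0 // (prod_dchar_norm_le1 pp_gt0 chi_char (addn u)).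
rewrite -big_mkcond; apply: le_trans (ler_norm_sum _ _ _) _.
apply: (@le_trans _ _ (\sum_(u < p | good u && (p %| e u)%N) p%:R)).
  apply: ler_sum => u _; rewrite normrM normr_nat.
  by rewrite -[leRHS]mul1r ler_wpM2r.
rewrite sumr_const -[leLHS]mulr_natl ler_wpM2r ?ler0n // ler_nat.
pose us0 := [set u : 'I_p | good u && (p %| e u)%N].
have toF_inj : {in enum us0 &, injective (fun u : 'I_p => toF u)}.
  move=> u v _ _ /(congr1 val); rewrite /= !val_Fp_nat // !modn_small // => uv.
  exact: val_inj.
have := max_poly_roots R_neq0 (rs := [seq toF (u : 'I_p) | u <- enum us0]) _ _.
rewrite size_map -cardE (_ : #|us0| = #|[pred u : 'I_p | good u && (p %| e u)%N]|); last first.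
  by apply: eq_card => u; rewrite !inE.
move=> H; rewrite -ltnS; apply: leq_trans size_R; apply: H.
  by apply/allP => _ /mapP[u u_in ->]; move: u_in; rewrite mem_enum inE => /andP[]; apply: R_root.
by rewrite map_inj_in_uniq // enum_uniq.
Qed.

End CompleteSumPrimeSquare.

Section CharacterFactor.
Variables (u v : nat) (chi : nat -> algC).
Hypotheses (co_uv : coprime u v) (u_gt0 : (0 < u)%N) (v_gt0 : (0 < v)%N).
Hypothesis chi_char : dchar (u * v) chi.

Definition char_left (n : nat) := chi (chinese u v n 1).

Let chi_eq x y : x = y %[mod u] -> x = y %[mod v] -> chi x = chi y.
Proof.
case: chi_char => _ _ chiP _ E1 E2; apply: chiP.
by apply/eqP; rewrite chinese_remainder // E1 E2 !eqxx.
Qed.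

Let coprime_mod m n d : m = n %[mod d] -> coprime m d = coprime n d.
Proof. by move=> E; rewrite -coprime_modl E coprime_modl. Qed.

Lemma char_left_dchar : dchar u char_left.
Proof.
have [chi1 chiM chiP chi0] := chi_char; split.
- by rewrite -chi1; apply: chi_eq; rewrite ?chinese_modl ?chinese_modr.
- move=> m n; rewrite -chiM; apply: chi_eq.
    by rewrite -modnMm !chinese_modl // modnMm.
  by rewrite -modnMm !chinese_modr // modnMm.
- by move=> m n E; apply: chi_eq; rewrite ?chinese_modl ?chinese_modr.
move=> n; rewrite /char_left chi0 coprimeMr.
rewrite (coprime_mod (chinese_modl co_uv n 1)) (coprime_mod (chinese_modr co_uv n 1)).
by rewrite coprime1n andbT.
Qed.

Lemma char_left_primitive : primitive (u * v) chi -> primitive u char_left.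
Proof.
move=> chi_prim p p_pr pu; have [n [n1 co_n chin]] := chi_prim p p_pr (dvdn_mulr v pu).
have upv : (u * v %/ p = (u %/ p) * v)%N by rewrite -divn_mulAC.
move: n1; rewrite upv => n1.
have nv : n = 1 %[mod v] by rewrite -(modn_dvdm n (dvdn_mull (u %/ p) (dvdnn v))) n1 modn_dvdm // dvdn_mull.
have nu : n = 1 %[mod u %/ p] by rewrite -(modn_dvdm n (dvdn_mulr v (dvdnn (u %/ p)))) n1 modn_dvdm // dvdn_mulr.
exists n; split=> //; first by move: co_n; rewrite coprimeMr => /andP[].
suff -> : char_left n = chi n by [].
by apply: chi_eq; rewrite ?chinese_modl ?chinese_modr.
Qed.

End CharacterFactor.

Section ChineseRemainder.
Variables (u v : nat) (chi : nat -> algC).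
Hypotheses (co_uv : coprime u v) (u_gt0 : (0 < u)%N) (v_gt0 : (0 < v)%N).
Hypothesis chi_char : dchar (u * v) chi.

Let co_vu : coprime v u. Proof. by rewrite coprime_sym. Qed.
Let chi_char_vu : dchar (v * u) chi. Proof. by rewrite mulnC. Qed.

Lemma char_left_right n : chi n = char_left u v chi n * char_left v u chi n.
Proof.
have [_ chiM chiP _] := chi_char; rewrite -chiM; apply: chiP; apply/eqP.
rewrite chinese_remainder //; apply/andP; split; apply/eqP; rewrite -[RHS]modnMm.
  by rewrite (chinese_modl co_uv) (chinese_modr co_vu) modnMm muln1.
by rewrite (chinese_modr co_uv) (chinese_modl co_vu) modnMm mul1n.
Qed.

Lemma complete_sum_mul us vs :
  complete_sum (u * v) chi us vs =
  complete_sum u (char_left u v chi) us vs * complete_sum v (char_left v u chi) us vs.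
Proof.
have [_ _ chiPl _] := char_left_dchar co_uv chi_char.
have [_ _ chiPr _] := char_left_dchar co_vu chi_char_vu.
have uv_gt0 : (0 < u * v)%N by rewrite muln_gt0 u_gt0.
pose h (z : 'I_(u * v)) : 'I_u * 'I_v := (Ordinal (ltn_pmod z u_gt0), Ordinal (ltn_pmod z v_gt0)).
pose k (xy : 'I_u * 'I_v) : 'I_(u * v) := Ordinal (ltn_pmod (chinese u v xy.1 xy.2) uv_gt0).
have kh z : k (h z) = z.
  by apply: val_inj; rewrite /= -chinese_mod // modn_small.
have hk xy : h (k xy) = xy.
  case: xy => x y; congr (_, _); apply: val_inj => /=.
    by rewrite modn_dvdm ?dvdn_mulr // chinese_modl // modn_small.
  by rewrite modn_dvdm ?dvdn_mull // chinese_modr // modn_small.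
rewrite /complete_sum mulr_suml (eq_bigr _ (fun x _ => mulr_sumr _ _ _ _)) pair_big /=.
rewrite (reindex h) /=; last by exists k => z _.
apply: eq_bigr => z _.
have prodE ws : \prod_(b <- ws) chi (z + b)%N =
    \prod_(b <- ws) char_left u v chi (z %% u + b)%N *
    \prod_(b <- ws) char_left v u chi (z %% v + b)%N.
  rewrite -big_split; apply: eq_bigr => b _; rewrite char_left_right.
  by congr (_ * _); [apply: chiPl|apply: chiPr]; rewrite modnDml.
by rewrite !prodE rmorphM mulrACA.
Qed.

End ChineseRemainder.

Lemma size_primes_coprime m n : (0 < m)%N -> (0 < n)%N -> coprime m n ->
  size (primes (m * n)) = (size (primes m) + size (primes n))%N.
Proof.
move=> m0 n0 co_mn; rewrite -size_cat; apply: perm_size; apply: uniq_perm.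
- exact: primes_uniq.
- by rewrite cat_uniq !primes_uniq andbT /= -coprime_has_primes.
by move=> p; rewrite primesM // mem_cat.
Qed.

Lemma gcdn_mul_coprime_le d u v : (0 < u)%N -> (0 < v)%N -> coprime u v ->
  (gcdn d u * gcdn d v <= gcdn d (u * v))%N.
Proof.
move=> u0 v0 co_uv; apply: dvdn_leq; first by rewrite gcdn_gt0 muln_gt0 u0 v0 orbT.
rewrite Gauss_dvd; last first.
  by apply: coprime_dvdl (dvdn_gcdr _ _) (coprime_dvdr (dvdn_gcdr _ _) co_uv).
rewrite !dvdn_gcd !dvdn_gcdl /=; apply/andP; split.
  exact: dvdn_trans (dvdn_gcdr _ _) (dvdn_mulr _ (dvdnn _)).
exact: dvdn_trans (dvdn_gcdr _ _) (dvdn_mull _ (dvdnn _)).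
Qed.

Lemma ndist_mod m n d : (m == n %[mod d]) = (d %| ndist m n)%N.
Proof.
rewrite /ndist; case: (leqP m n) => [le_mn|/ltnW le_nm].
  by rewrite (eqP le_mn) add0n eq_sym eqn_mod_dvd.
by rewrite (eqP le_nm) addn0 eqn_mod_dvd.
Qed.

(** Induction on [q], splitting off the full power of one prime, whose exponent is 1 or 2. If
    another shift meets [b0] modulo [p], the trivial bound serves: it exceeds square-root size by a
    factor of at most [p], and [p] divides one of the gcds on the right. *)
Theorem complete_sum_bound q chi b0 s vs : (0 < q)%N ->
  (forall p, prime p -> ~~ (p ^ 3 %| q)%N) ->
  dchar q chi -> primitive q chi ->
  `|complete_sum q chi (b0 :: s) vs| <=
  ((size (s ++ vs)).+1 ^ size (primes q) * \prod_(b <- s ++ vs) gcdn (ndist b b0) q)%N%:R * sqrtC q%:R.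
Proof.
have [n] := ubnP q; elim: n q chi => // n IH q chi lt_qn q_gt0 q_cf chi_char chi_prim.
have sqrt0 (x : nat) : 0 <= sqrtC x%:R :> algC by rewrite sqrtC_ge0 ler0n.
have [q1|q1] := leqP q 1.
  have {q1} q1 : q = 1%N by apply/eqP; rewrite eqn_leq q1.
  apply: le_trans (complete_sum_trivial q_gt0 chi_char _ _) _.
  rewrite q1 /= expn0 mul1n sqrtC1 mulr1 ler_nat.
  by rewrite big1 // => b _; rewrite gcdn1.
pose p := pdiv q; have p_pr : prime p by apply: pdiv_prime.
have pq : (p %| q)%N by apply: pdiv_dvd.
have [v co_pv qE] := pfactor_coprime p_pr q_gt0.
set e := logn p q in qE; set u := (p ^ e)%N in qE.
have e_gt0 : (0 < e)%N by rewrite /e logn_gt0 mem_primes p_pr q_gt0.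
have e_le2 : (e <= 2)%N by rewrite leqNgt -pfactor_dvdn // q_cf.
have p_gt1 := prime_gt1 p_pr; have p_gt0 := prime_gt0 p_pr.
have u_gt0 : (0 < u)%N by rewrite expn_gt0 p_gt0.
have v_gt0 : (0 < v)%N by move: q_gt0; rewrite qE muln_gt0 => /andP[].
have co_uv : coprime u v by rewrite coprimeXl.
rewrite mulnC in qE.
have chi_char2 : dchar (u * v) chi by rewrite -qE.
have chi_prim2 : primitive (u * v) chi by rewrite -qE.
rewrite {1}qE complete_sum_mul // normrM.
have lt_vq : (v < n)%N.
  rewrite -ltnS; apply: leq_ltn_trans lt_qn; rewrite qE ltn_Pmull //.
  by rewrite /u -(prednK e_gt0) expnS; apply: leq_trans (leq_pmulr _ _); rewrite ?expn_gt0 ?p_gt0.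
have vq : (v %| q)%N by rewrite qE dvdn_mull.
have v_cf r : prime r -> ~~ (r ^ 3 %| v)%N.
  by move/q_cf; apply: contra => /dvdn_trans; apply.
have [co_vu chi_char3 chi_prim3] : [/\ coprime v u, dchar (v * u) chi & primitive (v * u) chi].
  by rewrite coprime_sym mulnC.
have {IH} IHv := IH v (char_left v u chi) lt_vq v_gt0 v_cf (char_left_dchar co_vu chi_char3)
  (char_left_primitive co_vu chi_char3 chi_prim3).
set K := (size (s ++ vs)).+1 in IHv *.
suff local : `|complete_sum u (char_left u v chi) (b0 :: s) vs| <=
    (K * \prod_(b <- s ++ vs) gcdn (ndist b b0) u)%N%:R * sqrtC u%:R.
  apply: le_trans (ler_pM (normr_ge0 _) (normr_ge0 _) local IHv) _.
  rewrite mulrACA -natrM -sqrtCM ?nnegrE ?ler0n // -natrM -qE.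
  rewrite ler_wpM2r ?sqrt0 // ler_nat.
  have -> : size (primes q) = (size (primes v)).+1.
    by rewrite {1}qE size_primes_coprime // primesX // primes_prime.
  rewrite mulnACA -expnS leq_mul2l; apply/orP; right.
  rewrite -big_split /=; apply: leq_prod => b _; rewrite qE.
  exact: gcdn_mul_coprime_le.
have chiu_char := char_left_dchar co_uv chi_char2.
have chiu_prim := char_left_primitive co_uv chi_char2 chi_prim2.
have pu : (p %| u)%N by rewrite /u -(prednK e_gt0) expnS dvdn_mulr.
have [/allP far|/allPn[b b_in]] := boolP (all (fun b => b != b0 %[mod p]) (s ++ vs)); last first.
  rewrite negbK ndist_mod => dvd_p.
  apply: le_trans (complete_sum_trivial u_gt0 chiu_char _ _) _.
  rewrite -[X in X <= _]sqrtCK expr2 ler_wpM2r ?sqrt0 //.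
  apply: (@le_trans _ _ p%:R).
    rewrite -(@ler_pXn2r _ 2) ?nnegrE ?sqrt0 ?ler0n // sqrtCK -natrX ler_nat /u.
    by rewrite leq_exp2l.
  rewrite ler_nat; apply: leq_trans (leq_pmull _ _) => //.
  have prod_gt0 : (0 < \prod_(b <- s ++ vs) gcdn (ndist b b0) u)%N.
    by rewrite prodn_gt0 // => c; rewrite gcdn_gt0 u_gt0 orbT.
  apply: dvdn_leq => //.
  have : (p %| gcdn (ndist b b0) u)%N by rewrite dvdn_gcd dvd_p.
  move=> /dvdn_trans; apply; elim: (s ++ vs) b_in => // c ws IHw.
  rewrite in_cons big_cons => /orP[/eqP <-|/IHw]; first exact: dvdn_mulr.
  exact: dvdn_mull.
have {}far b : b \in s ++ vs -> b <> b0 %[mod p] by move=> /far/eqP.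
have prod_gt0 : (1 <= \prod_(b <- s ++ vs) gcdn (ndist b b0) u)%N.
  by rewrite prodn_gt0 // => c; rewrite gcdn_gt0 u_gt0 orbT.
have sizeK : (size (s ++ vs) <= K * \prod_(b <- s ++ vs) gcdn (ndist b b0) u)%N.
  by apply: leq_trans (leq_pmulr _ prod_gt0); rewrite leqnSn.
have [n1 [n1_1 co_n1 chin1]] := chiu_prim p p_pr pu.
have /orP[/eqP e1|/eqP e2] : (e == 1%N) || (e == 2%N) by case: (e) e_gt0 e_le2 => [|[|[]]].
  have up : u = p by rewrite /u e1 expn1.
  move: chiu_char; rewrite up => chiu_char.
  apply: le_trans (complete_sum_prime p_pr chiu_char _ far) _.
    by exists n1; rewrite // -up.
  by rewrite ler_wpM2r ?sqrt0 // ler_nat -up.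
have up : u = (p * p)%N by rewrite /u e2 expnS expn1.
move: chiu_char n1_1; rewrite up mulnK // => chiu_char n1_1.
apply: le_trans (complete_sum_prime_square p_pr chiu_char _ far) _.
  have n1E : n1 = (1 + p * (n1 %/ p))%N.
    by rewrite {1}(divn_eq n1 p) n1_1 (modn_small p_gt1) addnC mulnC.
  apply: contra chin1 => /eqP zeta1.
  by rewrite up n1E (chi_1p chiu_char) zeta1 expr1n.
have -> : sqrtC (p * p)%N%:R = p%:R :> algC by rewrite natrM -expr2 sqrCK ?ler0n.
by rewrite ler_wpM2r ?ler0n // ler_nat -up.
Qed.

(** * Moments and Burgess's bound *)

Lemma prod_primes_dvd (ps : seq nat) q : uniq ps -> (forall p, p \in ps -> prime p /\ (p %| q)%N) ->
  (\prod_(p <- ps) p %| q)%N.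
Proof.
elim: ps => [|p ps IH] /=; first by rewrite big_nil dvd1n.
case/andP=> p_notin uniq_ps H; have [p_pr pq] := H p (mem_head _ _).
have Hps r : r \in ps -> prime r /\ (r %| q)%N by move=> rps; apply: H; rewrite in_cons rps orbT.
rewrite big_cons Gauss_dvd ?pq ?IH // big_seq.
elim/big_rec: _ => [|r x r_ps co_x]; first exact: coprimen1.
rewrite coprimeMr co_x andbT prime_coprime // dvdn_prime2 //; last by have [] := Hps _ r_ps.
by apply: contraNneq p_notin => ->.
Qed.

(** A prime [p >= c^T] pays for its own factor [c^T], since the product of the primes of [q] divides
    [q]. At most [c^T] primes are smaller, and they go into the constant. *)
Lemma omega_bound (c T : nat) : (0 < c)%N ->
  exists2 C : nat, (0 < C)%N & forall q, (0 < q)%N -> ((c ^ size (primes q)) ^ T <= C * q)%N.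
Proof.
move=> c0; set X := (c ^ T)%N; have X0 : (0 < X)%N by rewrite expn_gt0 c0.
exists (X ^ X)%N => [|q q0]; first by rewrite expn_gt0 X0.
rewrite -expnM mulnC expnM -/X.
have -> : (X ^ size (primes q) = \prod_(p <- primes q) X)%N.
  by rewrite big_const_seq count_predT iter_muln_1.
apply: (@leq_trans (\prod_(p <- primes q) ((if p < X then X else 1) * p))%N).
  rewrite big_seq [X in (_ <= X)%N]big_seq; apply: leq_prod => p; rewrite mem_primes => /and3P[p_pr _ _].
  case: ltnP => [_|]; last by rewrite mul1n.
  by rewrite leq_pmulr // prime_gt0.
rewrite big_split /= leq_mul //; last first.
  apply: dvdn_leq => //; apply: prod_primes_dvd; first exact: primes_uniq.
  by move=> p; rewrite mem_primes => /and3P[].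
rewrite -big_mkcond big_const_seq iter_muln_1 leq_pexp2l // -size_filter.
rewrite -[leqRHS](size_iota 0); apply: uniq_leq_size; first by rewrite filter_uniq ?primes_uniq.
by move=> p; rewrite mem_filter mem_iota => /andP[].
Qed.

Lemma size_divisors_cube_free q : (0 < q)%N -> (forall p, prime p -> ~~ (p ^ 3 %| q)%N) ->
  (size (divisors q) <= 3 ^ size (primes q))%N.
Proof.
move=> q0 q_cf; set w := size (primes q).
pose F d : {ffun 'I_w -> 'I_3} := [ffun i : 'I_w => inord (logn (nth 0%N (primes q) i) d)].
have F_inj : {in divisors q &, injective F}.
  move=> d1 d2; rewrite -!dvdn_divisors // => dvd1 dvd2 /ffunP E.
  have log_le d p : (d %| q)%N -> (logn p d <= 2)%N.
    move=> dq; have [p_pr|np] := boolP (prime p); last by rewrite lognE (negPf np).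
    apply: leq_trans (dvdn_leq_log _ q0 dq) _.
    by rewrite leqNgt -pfactor_dvdn // q_cf.
  have d0 d : (d %| q)%N -> (0 < d)%N by apply: dvdn_gt0.
  apply: eqn_from_log; rewrite ?d0 // => p.
  have [p_in|p_notin] := boolP (p \in primes q); last first.
    have log0 d : (d %| q)%N -> logn p d = 0%N.
      move=> dq; apply/eqP; move: p_notin; apply: contraNT; rewrite -lt0n logn_gt0 !mem_primes.
      by case/and3P=> -> _ pd; rewrite q0 (dvdn_trans pd dq).
    by rewrite !log0.
  have lt_i : (index p (primes q) < w)%N by rewrite index_mem.
  have := E (Ordinal lt_i); rewrite !ffunE /= nth_index // => /(congr1 val).
  by rewrite /= !inordK // ltnS log_le.
rewrite -(size_map F); apply: (@leq_trans #|{: {ffun 'I_w -> 'I_3}}|).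
  rewrite cardE; apply: uniq_leq_size; last by move=> f _; rewrite mem_enum.
  by rewrite map_inj_in_uniq // divisors_uniq.
by rewrite card_ffun !card_ord.
Qed.

Lemma sum_gcd_le B q : (0 < q)%N ->
  (\sum_(1 <= h < B) gcdn h q <= size (divisors q) * B)%N.
Proof.
move=> q0.
apply: (@leq_trans (\sum_(1 <= h < B) \sum_(g <- divisors q) (g %| h) * g)%N).
  apply: leq_sum => h _; rewrite (bigD1_seq (gcdn h q)) ?divisors_uniq //=.
    by rewrite dvdn_gcdl mul1n leq_addr.
  by rewrite -dvdn_divisors // dvdn_gcdr.
rewrite exchange_big /=.
apply: (@leq_trans (\sum_(g <- divisors q) B)%N).
  apply: leq_sum => g _; rewrite -big_distrl /=.
  case: B => [|B]; first by rewrite big_geq.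
  by rewrite -divn_count_dvd; apply: leq_trans (leq_trunc_div _ _) _.
by rewrite big_const_seq count_predT iter_addn_0 mulnC.
Qed.

Lemma weighted_cauchy_schwarz (I : finType) (w u v : I -> algC) :
  (forall i, 0 <= w i) -> (forall i, u i \is Num.real) -> (forall i, v i \is Num.real) ->
  (\sum_i w i * (u i * v i)) ^+ 2 <= (\sum_i w i * u i ^+ 2) * (\sum_i w i * v i ^+ 2).
Proof.
move=> w0 ur vr.
have : 0 <= \sum_i \sum_j w i * w j * (u i * v j - u j * v i) ^+ 2.
  apply: sumr_ge0 => i _; apply: sumr_ge0 => j _; apply: mulr_ge0; first exact: mulr_ge0.
  by rewrite real_exprn_even_ge0 // realB // realM.
have -> : \sum_i \sum_j w i * w j * (u i * v j - u j * v i) ^+ 2 =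
   2%:R * ((\sum_i w i * u i ^+ 2) * (\sum_i w i * v i ^+ 2) - (\sum_i w i * (u i * v i)) ^+ 2).
  pose P := \sum_i \sum_j (w i * u i ^+ 2) * (w j * v j ^+ 2).
  pose Q := \sum_i \sum_j (w i * (u i * v i)) * (w j * (u j * v j)).
  have PE : (\sum_i w i * u i ^+ 2) * (\sum_i w i * v i ^+ 2) = P.
    by rewrite mulr_suml; apply: eq_bigr => i _; rewrite mulr_sumr.
  have QE : (\sum_i w i * (u i * v i)) ^+ 2 = Q.
    by rewrite expr2 mulr_suml; apply: eq_bigr => i _; rewrite mulr_sumr.
  have P2 : P = \sum_i \sum_j (w j * u j ^+ 2) * (w i * v i ^+ 2) by rewrite /P exchange_big.
  rewrite PE QE mulr_natl mulr2n.
  rewrite {2}P2 /P /Q -!sumrB -big_split /=; apply: eq_bigr => i _.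
  rewrite -!sumrB -big_split /=; apply: eq_bigr => j _; ring.
by rewrite pmulr_rge0 ?ltr0n // subr_ge0.
Qed.

Lemma jensen_pow2 (I : finType) (w t : I -> algC) (s : nat) :
  (forall i, 0 <= w i) -> (forall i, 0 <= t i) ->
  (\sum_i w i * t i) ^+ (2 ^ s) <= (\sum_i w i) ^+ (2 ^ s).-1 * \sum_i w i * t i ^+ (2 ^ s).
Proof.
move=> w0 t0; elim: s => [|s IH]; first by rewrite expn0 !expr1 expr0 mul1r.
have s0 : (0 < 2 ^ s)%N by rewrite expn_gt0.
have W0 : 0 <= \sum_i w i by apply: sumr_ge0.
have T0 k : 0 <= \sum_i w i * t i ^+ k by apply: sumr_ge0 => i _; rewrite mulr_ge0 // exprn_ge0.
have := @weighted_cauchy_schwarz I w (fun=> 1) (fun i => t i ^+ (2 ^ s)) w0 (fun=> rpred1 _).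
move=> /(_ (fun i => ger0_real (exprn_ge0 _ (t0 i)))).
under eq_bigr => i _ do rewrite mul1r.
under [X in _ <= X * _]eq_bigr => i _ do rewrite expr1n mulr1.
under [X in _ <= _ * X]eq_bigr => i _ do rewrite -exprM -expnSr.
move=> CS; rewrite expnSr exprM.
apply: le_trans (_ : ((\sum_i w i) ^+ (2 ^ s).-1 * \sum_i w i * t i ^+ (2 ^ s)) ^+ 2 <= _).
  rewrite ler_pXn2r // nnegrE ?exprn_ge0 ?sumr_ge0 // => [i _|]; first by rewrite mulr_ge0.
  by rewrite mulr_ge0 // exprn_ge0.
rewrite exprMn -exprM; apply: le_trans (ler_wpM2l _ CS) _; first by rewrite exprn_ge0.
have E : (((2 ^ s).-1 * 2).+1 = (2 ^ s * 2).-1)%N by lia.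
by rewrite mulrA -exprSr expnSr E.
Qed.

(** Hoelder's inequality obtained from Cauchy-Schwarz alone. Only powers of two are reached in this
    way, which is why [r] is a power of two in Burgess's argument. *)
Lemma holder_pow2 (I : finType) (w t : I -> algC) (s : nat) :
  (forall i, 0 <= w i) -> (forall i, 0 <= t i) ->
  (\sum_i w i * t i) ^+ (2 ^ s.+1) <=
  (\sum_i w i) ^+ (2 ^ s.+1 - 2) * ((\sum_i w i ^+ 2) * \sum_i t i ^+ (2 ^ s.+1)).
Proof.
move=> w0 t0; have W0 : 0 <= \sum_i w i by apply: sumr_ge0.
have s0 : (0 < 2 ^ s)%N by rewrite expn_gt0.
have := @weighted_cauchy_schwarz I (fun=> 1) w (fun i => t i ^+ (2 ^ s)) (fun=> ler01).
move=> /(_ (fun i => ger0_real (w0 i)) (fun i => ger0_real (exprn_ge0 _ (t0 i)))).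
under eq_bigr => i _ do rewrite mul1r.
under [X in _ <= X * _]eq_bigr => i _ do rewrite mul1r.
under [X in _ <= _ * X]eq_bigr => i _ do rewrite mul1r -exprM -expnSr.
move=> CS; rewrite {1}expnSr exprM.
apply: le_trans (_ : ((\sum_i w i) ^+ (2 ^ s).-1 * \sum_i w i * t i ^+ (2 ^ s)) ^+ 2 <= _).
  rewrite ler_pXn2r ?jensen_pow2 // nnegrE.
    by rewrite exprn_ge0 // sumr_ge0 // => i _; rewrite mulr_ge0.
  by rewrite mulr_ge0 ?exprn_ge0 // sumr_ge0 // => i _; rewrite mulr_ge0 // exprn_ge0.
rewrite exprMn -exprM (_ : ((2 ^ s).-1 * 2 = 2 ^ s.+1 - 2)%N); last by rewrite expnSr; lia.
by rewrite ler_wpM2l // exprn_ge0.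
Qed.

(** * High moments of very short character sums *)

Section Moment.
Variables (q : nat) (chi : nat -> algC) (r B : nat).
Hypotheses (q_gt0 : (0 < q)%N) (q_cf : forall p, prime p -> ~~ (p ^ 3 %| q)%N).
Hypotheses (chi_char : dchar q chi) (chi_prim : primitive q chi) (r_gt0 : (0 < r)%N).

(** Positions in the expanded moment: [true] marks the plain factors and [false] the conjugated
    ones. *)
Let T := (bool * 'I_r)%type.
Let side (c : bool) (f : {ffun T -> 'I_B}) : seq nat := [seq (f (c, i) : nat) | i <- enum 'I_r].
Let K := (r + r)%N.

(* Some shift of the tuple occurs only once: the case in which [complete_sum_bound] applies. *)
Let lone (f : {ffun T -> 'I_B}) j := [forall j', (j' != j) ==> (f j' != f j)].

Let complete_sum_conj us vs : `|complete_sum q chi us vs| = `|complete_sum q chi vs us|.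
Proof.
rewrite -[LHS]norm_conjC /complete_sum rmorph_sum; congr `|_|.
by apply: eq_bigr => x _; rewrite rmorphM /= conjCK mulrC.
Qed.

Let complete_sum_perm us us' vs : perm_eq us us' ->
  complete_sum q chi us vs = complete_sum q chi us' vs.
Proof. by move=> us_us'; apply: eq_bigr => x _; rewrite (perm_big _ us_us'). Qed.

Let W := (K ^ size (primes q))%N.

(** The lone shift takes the role of [b0]. If it sits among the conjugated factors, conjugating the
    whole sum first brings it to the other side. *)
Let lone_bound (f : {ffun T -> 'I_B}) j : lone f j ->
  `|complete_sum q chi (side true f) (side false f)| <=
  (W * \prod_(j' | j' != j) gcdn (ndist (f j') (f j)) q)%N%:R * sqrtC q%:R.
Proof.
case: j => c i /forallP lone_j.
have -> : `|complete_sum q chi (side true f) (side false f)| =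
          `|complete_sum q chi (side c f) (side (~~ c) f)|.
  by case: c {lone_j}; rewrite // complete_sum_conj.
set rest := [seq (f (c, k) : nat) | k <- rem i (enum 'I_r)].
have perm_side : perm_eq (side c f) ((f (c, i) : nat) :: rest).
  have i_in : i \in enum 'I_r by rewrite mem_enum.
  exact: (perm_map (fun k => nat_of_ord (f (c, k))) (perm_to_rem i_in)).
rewrite (complete_sum_perm _ perm_side).
apply: le_trans (complete_sum_bound _ _ _ q_gt0 q_cf chi_char chi_prim) _.
have -> : (size (rest ++ side (~~ c) f)).+1 = K.
  rewrite size_cat size_map size_rem ?mem_enum // size_enum_ord size_map size_enum_ord /K.
  by move: r_gt0; lia.
rewrite -/W ler_wpM2r ?sqrtC_ge0 ?ler0n // ler_nat leq_mul2l; apply/orP; right.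
apply: eq_leq; pose G j' := gcdn (ndist (f j') (f (c, i))) q.
transitivity (\prod_(j' <- [seq (c, k) | k <- rem i (enum 'I_r)] ++
                           [seq (~~ c, k) | k <- enum 'I_r]) G j')%N.
  by rewrite big_cat [RHS]big_cat /= /rest /side !big_map.
rewrite -[RHS]big_filter; apply: perm_big; apply: uniq_perm.
- rewrite cat_uniq; apply/and3P; split.
  + by rewrite map_inj_uniq ?rem_uniq ?enum_uniq // => x y [].
  + apply/hasPn => _ /mapP[k _ ->]; apply/mapP => -[k' _ [E _]].
    by case: (c) E.
  + by rewrite map_inj_uniq ?enum_uniq // => x y [].
- by rewrite filter_uniq // index_enum_uniq.
move=> [c' k]; rewrite mem_filter mem_index_enum andbT mem_cat.
apply/orP/idP => [[/mapP[k' k'in [-> ->]]|/mapP[k' _ [-> _]]]|neq].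
- apply: contraTneq k'in => -[->]; by rewrite mem_rem_uniqF ?enum_uniq.
- by apply/eqP => -[E _]; case: (c) E.
have [E|E] := eqVneq c' c; last first.
  by right; apply/mapP; exists k; rewrite ?mem_enum //; case: (c) (c') E => [] [].
left; apply/mapP; exists k; rewrite ?E // mem_rem_uniq ?enum_uniq // !inE mem_enum andbT.
by apply: contraNneq neq => ->; rewrite E.
Qed.

Let M := (2 * (size (divisors q) * B))%N.

Let sum_gcd_dist (c : 'I_B) : (\sum_(b < B | b != c) gcdn (ndist b c) q <= M)%N.
Proof.
apply: (@leq_trans (\sum_(b < B) \sum_(1 <= h < B) (ndist b c == h) * gcdn h q)%N).
  rewrite big_mkcond /=; apply: leq_sum => b _; case: ifP => // neq_bc.
  have d_in : ndist b c \in index_iota 1 B.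
    rewrite mem_index_iota /ndist; have := ltn_ord b; have := ltn_ord c.
    by move: neq_bc; rewrite -val_eqE /=; lia.
  by rewrite (bigD1_seq _ d_in) ?iota_uniq //= eqxx mul1n leq_addr.
rewrite exchange_big /= /M; apply: leq_trans (leq_mul (leqnn 2) (sum_gcd_le B q_gt0)).
rewrite big_distrr /=; apply: leq_sum => h _; rewrite -big_distrl /= leq_mul2r; apply/orP; right.
rewrite -big_mkcond /= sum1_card.
have inj : {in enum [pred b : 'I_B | ndist b c == h] &, injective (@nat_of_ord B)}.
  by move=> x y _ _; apply: val_inj.
rewrite cardE -(size_map (@nat_of_ord B)); apply: (@uniq_leq_size _ _ [:: (c + h)%N; (c - h)%N]).
  by rewrite map_inj_in_uniq ?enum_uniq.
move=> _ /mapP[b b_in ->]; move: b_in; rewrite mem_enum unfold_in /= !inE /ndist => /eqP.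
lia.
Qed.

(** Once the value [c] of the lone entry is fixed, the other entries vary independently, and each
    contributes a sum of gcds controlled by the divisors of [q]. *)
Let sum_lone j : (\sum_f lone f j * \prod_(j' | j' != j) gcdn (ndist (f j') (f j)) q
   <= B * M ^ K.-1)%N.
Proof.
pose g (b c : 'I_B) := if b == c then 0%N else gcdn (ndist b c) q.
pose h (c : 'I_B) (j' : T) (b : 'I_B) : nat := if j' == j then nat_of_bool (b == c) else g b c.
apply: (@leq_trans (\sum_(f : {ffun T -> 'I_B}) \sum_(c < B) \prod_j' h c j' (f j'))%N).
  apply: leq_sum => f _; case: (boolP (lone f j)) => [/forallP lone_j|]; last by rewrite mul0n.
  rewrite mul1n (bigD1 (f j)) //=; apply: leq_trans (leq_addr _ _).
  rewrite [X in (_ <= X)%N](bigD1 j) //= /h eqxx eqxx mul1n; apply: eq_leq.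
  apply: eq_bigr => j' neq; rewrite (negPf neq) /g.
  by have /implyP/(_ neq)/negPf -> := lone_j j'.
rewrite exchange_big /=.
apply: (@leq_trans (\sum_(c < B) M ^ K.-1)%N); last by rewrite sum_nat_const card_ord.
apply: leq_sum => c _; rewrite -bigA_distr_bigA /= (bigD1 j) //=.
have -> : (\sum_(b < B) h c j b = 1)%N.
  rewrite (bigD1 c) //= /h eqxx eqxx big1 ?addn0 // => b neq.
  by rewrite (negPf neq).
rewrite mul1n; apply: (@leq_trans (\prod_(j' | j' != j) M)%N).
  apply: leq_prod => j' neq; rewrite /h (negPf neq); apply: leq_trans (sum_gcd_dist c).
  rewrite [X in (_ <= X)%N]big_mkcond /=; apply: leq_sum => b _.
  by rewrite /g; case: eqP.
by rewrite prod_nat_const cardC1 card_prod card_bool card_ord mul2n -addnn.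
Qed.

(** If every value is taken at least twice, there are at most [r] values. A list of [r] values and a
    map from the [2 r] positions to it determine the tuple. *)
Let degenerate_card :
  (#|[set f : {ffun T -> 'I_B} | ~~ [exists j, lone f j]]| <= r ^ K * B ^ r)%N.
Proof.
case: (posnP B) => [B0|B_gt0].
  rewrite (eq_card0 (A := [set f | _])) // => f; have j0 : T := (true, Ordinal r_gt0).
  by exfalso; have := ltn_ord (f j0); move: (nat_of_ord _) => x; rewrite B0.
pose D := ({ffun 'I_r -> 'I_B} * {ffun T -> 'I_r})%type.
pose comp (x : D) : {ffun T -> 'I_B} := [ffun j => x.1 (x.2 j)].
have -> : (r ^ K * B ^ r = #|{: D}|)%N.
  by rewrite card_prod !card_ffun !card_ord card_prod card_bool card_ord mul2n -addnn mulnC.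
rewrite -cardsT; apply: (@leq_trans #|comp @: [set: D]|); last exact: leq_imset_card.
apply: subset_leq_card; apply/subsetP => f; rewrite inE negb_exists => /forallP not_lone.
pose S := [set f j | j : T].
have card_S : (#|S| <= r)%N.
  have : (#|S| * 2 <= K)%N.
    have -> : K = (\sum_(y in S) #|[pred j | f j == y]|)%N.
      rewrite /K addnn -mul2n -[in LHS](card_ord r) -card_bool -card_prod -sum1_card.
      rewrite (partition_big f [in S]) => [|j _]; last by apply: imset_f.
      by apply: eq_bigr => y _; rewrite sum1_card; apply: eq_card => j; rewrite !inE.
    rewrite -sum_nat_const; apply: leq_sum => y /imsetP[j _ ->].
    have := not_lone j; rewrite negb_forall => /existsP[j'].
    rewrite negb_imply negbK => /andP[neq /eqP fj'].
    rewrite (cardD1 j) (cardD1 j') !inE eqxx neq fj' eqxx //.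
  by rewrite /K; lia.
have j0 : T := (true, Ordinal r_gt0).
have idx_lt j : (index (f j) (enum S) < r)%N.
  by apply: leq_trans card_S; rewrite cardE index_mem mem_enum imset_f.
apply/imsetP; exists ([ffun i : 'I_r => nth (f j0) (enum S) i], [ffun j => Ordinal (idx_lt j)]).
  by rewrite inE.
by apply/ffunP => j; rewrite !ffunE /= nth_index // mem_enum imset_f.
Qed.

(** Expanding gives complete sums. Degenerate tuples receive the trivial bound [q]; tuples with a
    lone entry receive square-root size, and averaging their gcds costs only divisor factors. *)
Lemma moment_bound :
  \sum_(x < q) `|\sum_(b < B) chi (x + b)%N| ^+ (r + r) <=
  (r ^ (r + r) * B ^ r * q)%N%:R +
  ((r + r) * (W * (B * M ^ (r + r).-1)))%N%:R * sqrtC q%:R.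
Proof.
have expand (x : nat) : `|\sum_(b < B) chi (x + b)%N| ^+ (r + r) =
    \sum_(f : {ffun T -> 'I_B}) (\prod_(b <- side true f) chi (x + b)%N) * (\prod_(b <- side false f) chi (x + b)%N)^*.
  pose F (j : T) (b : 'I_B) := if j.1 then chi (x + b)%N else (chi (x + b)%N)^*.
  transitivity (\prod_j \sum_b F j b).
    rewrite -(pair_bigA _ (fun c i => \sum_b F (c, i) b)) /= big_bool /F /=.
    rewrite !prodr_const card_ord addnn -muln2 mulnC exprM normCK exprMn rmorph_sum.
    by [].
  rewrite bigA_distr_bigA; apply: eq_bigr => f _.
  rewrite (eq_bigr (fun p : T => F (p.1, p.2) (f (p.1, p.2)))) => [|[] //].
  rewrite -(pair_bigA _ (fun c i => F (c, i) (f (c, i)))) /= big_bool /F /side /=.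
  have sideE c (G : nat -> algC) : \prod_(b <- side c f) G b = \prod_i G (f (c, i)).
    by rewrite /side big_map big_enum.
  rewrite -/(side true f) -/(side false f) !sideE rmorph_prod.
  by [].
under eq_bigr => x _ do rewrite expand.
rewrite exchange_big /=.
have sum_nonneg : 0 <= \sum_(f : {ffun T -> 'I_B}) `|complete_sum q chi (side true f) (side false f)|.
  by apply: sumr_ge0.
apply: (@le_trans _ _ (\sum_(f : {ffun T -> 'I_B}) `|complete_sum q chi (side true f) (side false f)|)).
  apply: le_trans (real_ler_norm _) _; last exact: ler_norm_sum.
  rewrite -(eq_bigr _ (fun f _ => erefl)) -exchange_big /=.
  rewrite -(eq_bigr _ (fun (x : 'I_q) _ => expand x)); apply: sum_real => x _.
  by rewrite realX // normr_real.
apply: (@le_trans _ _ (\sum_(f : {ffun T -> 'I_B})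
    ((~~ [exists j, lone f j] * q)%N%:R +
     \sum_j (lone f j * (W * \prod_(j' | j' != j) gcdn (ndist (f j') (f j)) q))%N%:R * sqrtC q%:R))).
  apply: ler_sum => f _; case: (boolP [exists j, lone f j]) => [/existsP[j lone_j]|_].
    rewrite add0r (bigD1 j) //= lone_j mul1n.
    apply: le_trans (lone_bound lone_j) _; rewrite lerDl sumr_ge0 // => j' _.
    by rewrite mulr_ge0 ?ler0n // sqrtC_ge0 ler0n.
  rewrite mul1n; apply: le_trans (complete_sum_trivial q_gt0 chi_char _ _) _.
  rewrite lerDl sumr_ge0 // => j _; by rewrite mulr_ge0 ?ler0n // sqrtC_ge0 ler0n.
rewrite big_split /=; apply: lerD.
  rewrite -natr_sum ler_nat -big_distrl /= leq_mul2r; apply/orP; right.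
  apply: leq_trans degenerate_card; rewrite -sum1_card big_mkcond [X in (_ <= X)%N]big_mkcond /=.
  by apply: leq_sum => f _; rewrite inE; case: [exists _, _].
under eq_bigr => f _ do rewrite -mulr_suml -natr_sum.
rewrite -mulr_suml -natr_sum ler_wpM2r ?sqrtC_ge0 ?ler0n // ler_nat.
rewrite exchange_big /=.
apply: (@leq_trans (\sum_(j : T) W * (B * M ^ K.-1))%N).
  apply: leq_sum => j _; apply: leq_trans (leq_mul (leqnn W) (sum_lone j)).
  by rewrite big_distrr /=; apply: leq_sum => f _; rewrite mulnCA.
by rewrite sum_nat_const card_prod card_bool card_ord mul2n -addnn.
Qed.

End Moment.

Lemma exprD_le2 (x y : algC) m : 0 <= x -> 0 <= y ->
  (x + y) ^+ m <= (2 ^ m)%N%:R * (x ^+ m + y ^+ m).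
Proof.
move=> x0 y0; rewrite natrX.
have aux (u v : algC) : 0 <= u -> u <= v -> (u + v) ^+ m <= 2%:R ^+ m * (u ^+ m + v ^+ m).
  move=> u0 uv; have v0 := le_trans u0 uv.
  apply: (@le_trans _ _ ((2%:R * v) ^+ m)).
    by rewrite lerXn2r ?nnegrE ?addr_ge0 ?mulr_ge0 ?ler0n // mulr_natl mulr2n lerD2r.
  by rewrite exprMn ler_wpM2l ?exprn_ge0 ?ler0n // lerDr exprn_ge0.
have /orP[xy|yx] := real_leVge (ger0_real x0) (ger0_real y0); first exact: aux.
by rewrite addrC [x ^+ m + _]addrC; apply: aux.
Qed.

Lemma coprime_mod_cancel a b m n : coprime a b -> b * m = b * n %[mod a] -> m = n %[mod a].
Proof.
move=> co_ab /eqP E; apply/eqP; move: E.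
wlog le_mn : m n / (m <= n)%N => [H|].
  by case/orP: (leq_total m n) => [/H //|/H {}H]; rewrite eq_sym => /H; rewrite eq_sym.
rewrite eq_sym [in X in _ -> X]eq_sym !eqn_mod_dvd ?leq_mul2l ?le_mn ?orbT // -mulnBr.
by rewrite Gauss_dvdr.
Qed.

Lemma add_lt_double (a b c d e : nat) : (a < e -> b < e -> c <= b -> d <= a -> d + c < 2 * e)%N.
Proof. lia. Qed.

(** * Multiplicative shifts of an interval and their collisions *)

Section Collisions.
Variables (q A0 A L M0 : nat) (As : seq nat).
Hypotheses (q_gt0 : (0 < q)%N) (A0_gt0 : (0 < A0)%N) (L_gt0 : (0 < L)%N) (uniq_As : uniq As).
Hypothesis As_prime : forall a, a \in As -> [/\ prime a, coprime a q, (A0 < a)%N & (a <= A)%N].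
Hypothesis AL : (2 * (A * L) <= q)%N.

Let n := size As.
Definition shift_prime (i : 'I_n) := nth 0%N As i.
Definition mod_inverse (a : nat) := (a ^ (totient q).-1)%N.
(* The class [x] with [a x = M0 + h], so that [chi (M0 + h + a b) = chi a * chi (x + b)]. *)
Definition quotient_class (p : 'I_n * 'I_L) : 'I_q :=
  Ordinal (ltn_pmod (mod_inverse (shift_prime p.1) * (M0 + p.2)) q_gt0).

Lemma shift_primeP i : [/\ prime (shift_prime i), coprime (shift_prime i) q,
  (A0 < shift_prime i)%N & (shift_prime i <= A)%N].
Proof. by apply: As_prime; rewrite mem_nth. Qed.

Lemma mod_inverseP a : coprime a q -> a * mod_inverse a = 1 %[mod q].
Proof.
move=> co_a; rewrite /mod_inverse -expnS prednK ?totient_gt0 //.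
exact: Euler_exp_totient.
Qed.

Lemma quotient_classP p : shift_prime p.1 * quotient_class p = M0 + p.2 %[mod q].
Proof.
have [_ co_a _ _] := shift_primeP p.1.
by rewrite /= modnMmr mulnA -modnMml mod_inverseP // modnMml mul1n.
Qed.

Let quotient_class_eq i h j h' : quotient_class (i, h) = quotient_class (j, h') ->
  shift_prime j * (M0 + h) = shift_prime i * (M0 + h') %[mod q].
Proof.
move=> E; have := quotient_classP (i, h); have := quotient_classP (j, h').
rewrite -E /= => E2 E1; rewrite -modnMmr -E1 modnMmr mulnCA -modnMmr E2 modnMmr //.
Qed.

(** For [i = j] one coordinate determines the other. For distinct primes [a] and [b], comparing two
    collisions gives a congruence between numbers below [2 A L <= q], hence an equality; it fixes
    [h] modulo [a], so [h] is determined by its quotient by [a]. *)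
Let pair_collisions i j :
  (#|[set hh : 'I_L * 'I_L | quotient_class (i, hh.1) == quotient_class (j, hh.2)]| <=
   (if i == j then L else (L %/ A0).+1))%N.
Proof.
have [a_pr co_a a_gt a_le] := shift_primeP i; have [b_pr co_b b_gt b_le] := shift_primeP j.
have a_gt0 := prime_gt0 a_pr.
have LA : (L <= A * L)%N by rewrite leq_pmull // (leq_trans a_gt0).
case: eqP => [<-|neq_ij].
  have inj : {in [set hh : 'I_L * 'I_L | quotient_class (i, hh.1) == quotient_class (i, hh.2)] &,
      injective (fun hh : 'I_L * 'I_L => hh.1)}.
    have eq_h (h h' : 'I_L) : quotient_class (i, h) = quotient_class (i, h') -> h = h'.
      move=> /quotient_class_eq; rewrite -(coprime_sym) in co_a.
      move/(coprime_mod_cancel co_a)/eqP; rewrite eqn_modDl => /eqP.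
      by rewrite !modn_small => [/val_inj||] //; apply: leq_trans (ltn_ord _) _; lia.
    move=> [h1 h1'] [h2 h2']; rewrite !inE /= => /eqP/eq_h <- /eqP/eq_h <- /= -> //.
  rewrite -[X in (_ <= X)%N]card_ord.
  by apply: (@leq_card_in _ _ (fun hh : 'I_L * 'I_L => hh.1)).
have co_ab : coprime (shift_prime i) (shift_prime j).
  rewrite prime_coprime // dvdn_prime2 //; apply/negP => /eqP E; apply: neq_ij.
  by apply: val_inj; move/eqP: E; rewrite /shift_prime nth_uniq // => /eqP.
have lt_div (h : 'I_L) : (h %/ shift_prime i < (L %/ A0).+1)%N.
  rewrite ltnS; apply: leq_trans (leq_div2r _ (ltnW (ltn_ord h))) _.
  by apply: leq_div2l => //; apply: ltnW.
rewrite -[X in (_ <= X)%N]card_ord.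
apply: (@leq_card_in _ _ (fun hh : 'I_L * 'I_L => Ordinal (lt_div hh.1))) => //.
move=> [h1 h1'] [h2 h2']; rewrite !inE /= => /eqP/quotient_class_eq E1 /eqP/quotient_class_eq E2.
move/(congr1 val) => /= Ediv.
have E : (shift_prime j * h1 + shift_prime i * h2' = shift_prime i * h1' + shift_prime j * h2)%N.
  have : shift_prime j * (M0 + h1) + shift_prime i * (M0 + h2') =
      shift_prime i * (M0 + h1') + shift_prime j * (M0 + h2) %[mod q].
    by rewrite -modnDm E1 -E2 modnDm.
  rewrite !mulnDr => /eqP.
  rewrite (_ : (_ + _ + (_ + _) = (shift_prime j * M0 + shift_prime i * M0) + (shift_prime j * h1 + shift_prime i * h2'))%N); last by lia.
  rewrite (_ : (shift_prime i * M0 + _ + (_ + _) = (shift_prime j * M0 + shift_prime i * M0) + (shift_prime i * h1' + shift_prime j * h2))%N); last by lia.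
  rewrite eqn_modDl => /eqP.
  have small (x y : nat) (h k : 'I_L) : (x <= A)%N -> (y <= A)%N -> (x * h + y * k < q)%N.
    move=> xA yA; apply: leq_trans AL; have := ltn_ord h; have := ltn_ord k => hk hh.
    have A_gt0 : (0 < A)%N by apply: leq_trans a_le.
    have : (x * h <= A * h)%N by rewrite leq_mul2r xA orbT.
    have : (y * k <= A * k)%N by rewrite leq_mul2r yA orbT.
    have : (A * h < A * L)%N by rewrite ltn_pmul2l.
    have : (A * k < A * L)%N by rewrite ltn_pmul2l.
    by move=> k1 k2 k3 k4; apply: add_lt_double k2 k1 k3 k4.
  by rewrite !modn_small // small.
have h12 : h1 = h2 %[mod shift_prime i].
  apply: (@coprime_mod_cancel _ (shift_prime j)) => //.
  have := congr1 (modn^~ (shift_prime i)) E => /=.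
  by rewrite [(shift_prime i * h1')%N]mulnC [(shift_prime i * h2')%N]mulnC modnMDl addnC modnMDl.
have Eh : h1 = h2.
  by apply: val_inj; rewrite /= (divn_eq h1 (shift_prime i)) Ediv h12 -divn_eq.
congr (_, _) => //; apply: val_inj => /=; move: E; rewrite Eh addnC => /addIn/eqP.
by rewrite eqn_pmul2l // => /eqP ->.
Qed.

Definition class_count (x : 'I_q) := #|[set p | quotient_class p == x]|.

Lemma sum_class_count : (\sum_x class_count x = n * L)%N.
Proof.
rewrite -[n]card_ord -[X in (_ = _ * X)%N]card_ord -card_prod -sum1_card.
rewrite (partition_big quotient_class xpredT) //=; apply: eq_bigr => x _.
by rewrite sum1_card; apply: eq_card => p; rewrite [LHS]inE.
Qed.

Lemma sum_class_count_sq :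
  (\sum_x class_count x ^ 2 <= n * L + n * n * (L %/ A0).+1)%N.
Proof.
have -> : (\sum_x class_count x ^ 2 = \sum_i \sum_j
  #|[set hh : 'I_L * 'I_L | quotient_class (i, hh.1) == quotient_class (j, hh.2)]|)%N.
  transitivity (\sum_x \sum_p \sum_p' (quotient_class p == x) * (quotient_class p' == x))%N.
    apply: eq_bigr => x _; rewrite expnS expn1 /class_count -sum1_card big_mkcond /=.
    rewrite big_distrl; apply: eq_bigr => p _ /=.
    rewrite big_distrr; apply: eq_bigr => p' _ /=.
    by rewrite !inE; case: eqP; case: eqP.
  rewrite exchange_big /=; under eq_bigr => p _ do rewrite exchange_big /=.
  transitivity (\sum_p \sum_p' (quotient_class p == quotient_class p'))%N.
    apply: eq_bigr => p _; apply: eq_bigr => p' _.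
    rewrite (bigD1 (quotient_class p)) //= eqxx mul1n big1 ?addn0 1?eq_sym // => x neq.
    by rewrite eq_sym (negPf neq).
  rewrite -(pair_bigA _ (fun i h => \sum_p' (quotient_class (i, h) == quotient_class p'))%N) /=.
  apply: eq_bigr => i _.
  under eq_bigr => h _ do rewrite -(pair_bigA _ (fun j h' => (quotient_class (i, h) == quotient_class (j, h')) : nat)).
  rewrite exchange_big /=; apply: eq_bigr => j _.
  rewrite -sum1_card [RHS]big_mkcond (pair_bigA _ (fun h h' => (quotient_class (i, h) == quotient_class (j, h')) : nat)) /=.
  by apply: eq_bigr => p _; rewrite inE; case: eqP.
apply: (@leq_trans (\sum_(i < n) \sum_(j < n) ((i == j) * L + (L %/ A0).+1))%N).
  apply: leq_sum => i _; apply: leq_sum => j _; apply: leq_trans (pair_collisions i j) _.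
  by case: eqP => _; rewrite ?mul1n ?leq_addr ?leq_addl.
apply: eq_leq; under eq_bigr => i _ do rewrite big_split /= sum_nat_const card_ord.
rewrite big_split /= sum_nat_const card_ord mulnA; congr (_ + _)%N.
rewrite (eq_bigr (fun=> L)) ?sum_nat_const ?card_ord // => i _.
rewrite (bigD1 i) //= eqxx mul1n big1 ?addn0 // => j neq.
by rewrite eq_sym (negPf neq).
Qed.

End Collisions.

(** * Burgess's bound for one interval and a primitive character *)

Section BurgessInterval.
Variables (q : nat) (chi : nat -> algC) (s t r B M0 : nat) (As : seq nat).
Hypotheses (q_gt0 : (0 < q)%N) (q_cf : forall p, prime p -> ~~ (p ^ 3 %| q)%N).
Hypotheses (chi_char : dchar q chi) (chi_prim : primitive q chi).
Hypotheses (rE : r = (2 ^ s)%N) (rt : r = (2 * t)%N) (t_ge : (8 <= t)%N).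
Hypotheses (B_ge2 : (2 <= B)%N) (B_big : (4 * 16 ^ r <= B ^ 3)%N).
Hypotheses (Bq : (B ^ (2 * r) <= q)%N) (qB : (q < B.+1 ^ (2 * r))%N).
Hypothesis theta : (r ^ (2 * r) + 2 * r * ((2 * r) ^ size (primes q) *
  (2 * size (divisors q)) ^ (2 * r).-1) <= B)%N.
Hypothesis uniq_As : uniq As.
Hypothesis As_prime : forall a, a \in As ->
  [/\ prime a, coprime a q, (B ^ (t + 2) < a)%N & (a <= B ^ (t + 3))%N].
Hypothesis size_As : (B ^ (t + 1) <= size As)%N.

(** As [q] lies between [B^(4 t)] and [(B + 1)^(4 t)], [L] is about [q^(1/4 + 5/(4 t))]. Primes up
    to [A] times [b < B] shift the interval by at most [A * B = L / B]. *)
Let L := (B ^ (t + 5))%N.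
Let A := (B ^ (t + 3))%N.
Let A0 := (B ^ (t + 2))%N.
Let n := size As.
Let S : algC := \sum_(h < L) chi (M0 + h)%N.
Let B_gt0 : (0 < B)%N. Proof. exact: ltnW. Qed.
Let L_gt0 : (0 < L)%N. Proof. by rewrite expn_gt0 B_gt0. Qed.
Let A0_gt0 : (0 < A0)%N. Proof. by rewrite expn_gt0 B_gt0. Qed.
Let r_gt0 : (0 < r)%N. Proof. by rewrite rE expn_gt0. Qed.

Let AL : (2 * (A * L) <= q)%N.
Proof.
apply: leq_trans Bq; rewrite /A /L -expnD rt; apply: leq_trans (leq_mul B_ge2 (leqnn _)) _.
by rewrite -expnS leq_pexp2l //; move: t_ge; lia.
Qed.

Let T (x : 'I_q) : algC := `|\sum_(b < B) chi (x + b)%N|.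
Let nu := @class_count q L M0 As q_gt0.

Let shift_le (d : nat) (f : nat -> algC) : (forall x, `|f x| <= 1) ->
  `|\sum_(h < L) f h - \sum_(h < L) f (h + d)%N| <= (2 * d)%N%:R.
Proof.
move=> f1.
have part (m k : nat) : `|\sum_(h < m) f (k + h)%N| <= m%:R.
  apply: le_trans (ler_norm_sum _ _ _) _; rewrite -[X in _ <= X%:R]card_ord -sumr_const.
  by apply: ler_sum => h _.
have split m k : \sum_(h < m + k) f h = \sum_(h < m) f h + \sum_(h < k) f (m + h)%N.
  by rewrite big_split_ord.
have E : \sum_(h < L) f h - \sum_(h < L) f (h + d)%N = \sum_(h < d) f (0 + h)%N - \sum_(h < d) f (L + h)%N.
  apply/eqP; rewrite subr_eq addrAC eq_sym subr_eq; apply/eqP.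
  rewrite -split addnC split; congr (_ + _).
  by apply: eq_bigr => h _; rewrite addnC.
rewrite E; apply: le_trans (ler_normB _ _) _; rewrite mul2n -addnn natrD lerD //.
Qed.

Let T_ge0 x : 0 <= T x. Proof. exact: normr_ge0. Qed.
Let nu_ge0 x : 0 <= (nu x)%:R :> algC. Proof. exact: ler0n. Qed.

(** Average over the [n * B] shifts [a b]. Taking out [chi a], of modulus 1, leaves a sum of
    [chi (x + b)] over [b], with [x] counted by [nu]; each shift of the interval costs at most
    [2 A B]. *)
Let weighted_sum : (n * B)%N%:R * `|S| <= \sum_x (nu x)%:R * T x + (n * (B * (2 * (A * B))))%N%:R.
Proof.
have chi1 := dchar_norm_le1 q_gt0 chi_char.
have each (i : 'I_n) : B%:R * `|S| <= \sum_(h < L) T (quotient_class M0 q_gt0 (i, h)) + (B * (2 * (A * B)))%N%:R.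
  have [a_pr co_a _ a_le] := shift_primeP As_prime i; set a := shift_prime i in a_pr co_a a_le.
  have chiaT (h : 'I_L) : `|\sum_(b < B) chi (M0 + (h + a * b))%N| = T (quotient_class M0 q_gt0 (i, h)).
    have [_ chiM chiP _] := chi_char.
    rewrite /T -[RHS]mul1r -(dchar_norm1 q_gt0 chi_char co_a) -normrM mulr_sumr; congr `|_|.
    apply: eq_bigr => b _; rewrite -chiM; apply: chiP.
    have qP : a * quotient_class M0 q_gt0 (i, h) = M0 + h %[mod q].
      exact: (quotient_classP M0 q_gt0 As_prime (i, h)).
    by rewrite mulnDr -[RHS]modnDml qP modnDml addnA.
  have -> : B%:R * `|S| = `|\sum_(b < B) S|.
    by rewrite sumr_const card_ord normrMn mulr_natl.
  have -> : \sum_(b < B) S = \sum_(h < L) \sum_(b < B) chi (M0 + (h + a * b))%N +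
      \sum_(b < B) (S - \sum_(h < L) chi (M0 + (h + a * b))%N).
    by rewrite [X in _ = X + _]exchange_big -big_split; apply: eq_bigr => b _; rewrite /= addrC subrK.
  apply: le_trans (ler_normD _ _) _; apply: lerD.
    by apply: le_trans (ler_norm_sum _ _ _) _; apply: ler_sum => h _; rewrite chiaT.
  apply: le_trans (ler_norm_sum _ _ _) _.
  rewrite natrM mulr_natl -[X in _ *+ X]card_ord -sumr_const; apply: ler_sum => b _.
  apply: le_trans (shift_le (a * b) (f := fun h => chi (M0 + h)%N) _) _ => //.
  by rewrite ler_nat leq_mul2l leq_mul //; apply: ltnW.
have -> : \sum_x (nu x)%:R * T x = \sum_(i < n) \sum_(h < L) T (quotient_class M0 q_gt0 (i, h)).
  rewrite (pair_bigA _ (fun i h => T (quotient_class M0 q_gt0 (i, h)))) /=.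
  rewrite [RHS](partition_big (@quotient_class q L M0 As q_gt0) xpredT) //=.
  apply: eq_bigr => x _; rewrite [RHS](eq_bigr (fun=> T x)) => [|[i h] /eqP <-] //.
  rewrite sumr_const mulr_natl; congr (_ *+ _).
  by apply: eq_card => p; rewrite [LHS]inE.
have -> : (n * B)%N%:R * `|S| = \sum_(i < n) B%:R * `|S|.
  by rewrite sumr_const card_ord natrM -mulrA -[RHS]mulr_natl.
have -> : (n * (B * (2 * (A * B))))%N%:R = \sum_(i < n) (B * (2 * (A * B)))%N%:R :> algC.
  by rewrite sumr_const card_ord natrM -[RHS]mulr_natl.
rewrite -big_split /=.
by apply: ler_sum => i _; apply: le_trans (each i) _.
Qed.

Let r2 : (r + r = 2 * r)%N. Proof. by rewrite mul2n addnn. Qed.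

Let size_As_le : (n <= A)%N.
Proof.
rewrite -[A](size_iota 1); apply: uniq_leq_size => // a /As_prime[_ _ a_gt a_le].
by rewrite mem_iota add1n ltnS a_le andbT (leq_trans _ a_gt).
Qed.

Let second_moment : (\sum_x nu x ^ 2 <= 3 * (B * (n * L)))%N.
Proof.
apply: leq_trans (sum_class_count_sq M0 q_gt0 A0_gt0 L_gt0 uniq_As As_prime AL) _.
rewrite -/n; have -> : (L %/ A0 = B ^ 3)%N.
  by rewrite /L /A0 -expnB ?B_gt0 //; [congr (_ ^ _)%N; lia|lia].
have h1 : (n * (B ^ 3).+1 <= 2 * (B * L))%N.
  apply: leq_trans (leq_mul size_As_le (leqnn _)) _.
  have -> : (B * L = A * B ^ 3)%N by rewrite /L /A -expnS -expnD; congr (_ ^ _)%N; lia.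
  rewrite mulnCA leq_mul2l; apply/orP; right.
  have : (0 < B ^ 3)%N by rewrite expn_gt0 B_gt0.
  by move: (B ^ 3)%N => X; lia.
have h2 : (n * L <= B * (n * L))%N by rewrite leq_pmull.
rewrite -mulnA; have : (n * (n * (B ^ 3).+1) <= n * (2 * (B * L)))%N by rewrite leq_mul2l h1 orbT.
have -> : (n * (2 * (B * L)) = 2 * (B * (n * L)))%N by rewrite !(mulnCA n).
by move: h2; move: (n * L)%N (B * (_ * _))%N (n * (n * _))%N => X Y Z; lia.
Qed.

Let T_moment : \sum_x T x ^+ (2 * r) <= (q * B ^ r.+1)%N%:R.
Proof.
have := moment_bound B q_gt0 q_cf chi_char chi_prim r_gt0; rewrite r2 => /le_trans; apply.
have := theta.
set W := ((2 * r) ^ _)%N; set tau := size (divisors q) => th.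
(* The size of [B] balances the moment: about [B^(2 r)] tuples cost [sqrt q] each, and about [B^r]
   degenerate ones cost [q] each. *)
have Bsqrt : (B ^ r)%N%:R <= sqrtC q%:R :> algC.
  rewrite -(@ler_pXn2r _ 2) ?nnegrE ?ler0n ?sqrtC_ge0 ?ler0n // sqrtCK -natrX ler_nat.
  by rewrite -expnM mulnC.
apply: (@le_trans _ _ (((r ^ (2 * r) + 2 * r * (W * (2 * tau) ^ (2 * r).-1)) * (B ^ r * q))%N%:R)); last first.
  rewrite ler_nat expnS; apply: leq_trans (leq_mul th (leqnn _)) _.
  by rewrite mulnA mulnC.
rewrite [X in _ <= X%:R]mulnDl [leRHS]natrD -[X in X%:R + _ <= _]mulnA lerD2l.
have -> : (2 * r * (W * (B * (2 * (tau * B)) ^ (2 * r).-1)) =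
    2 * r * (W * (2 * tau) ^ (2 * r).-1) * (B ^ r * B ^ r))%N.
  have -> : (B ^ r * B ^ r = B * B ^ (2 * r).-1)%N.
    by rewrite -expnD r2 -expnS prednK // muln_gt0 r_gt0.
  rewrite (mulnA 2 tau B) expnMn.
  by move: (_ ^ _)%N (_ ^ _)%N => U V; ring.
rewrite natrM [in leRHS]natrM -mulrA ler_wpM2l ?ler0n //.
rewrite natrM -mulrA [in leRHS]natrM ler_wpM2l ?ler0n //.
by rewrite -[q%:R in leRHS]sqrtCK expr2 ler_wpM2r // sqrtC_ge0 ler0n.
Qed.

Let main_sum : (\sum_x (nu x)%:R * T x) ^+ (2 * r) <=
  ((n * L) ^ (2 * r - 2) * (3 * (B * (n * L)) * (q * B ^ r.+1)))%N%:R.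
Proof.
have rs : (2 * r = 2 ^ s.+1)%N by rewrite rE expnS.
have := holder_pow2 s nu_ge0 T_ge0; rewrite -rs => /le_trans; apply.
rewrite -natr_sum (sum_class_count L M0 As q_gt0) -/n [leRHS]natrM [X in _ <= X * _]natrX ler_wpM2l ?exprn_ge0 ?ler0n //.
rewrite [leRHS]natrM; apply: ler_pM.
- by apply: sumr_ge0 => x _; rewrite exprn_ge0.
- by apply: sumr_ge0 => x _; rewrite exprn_ge0.
- under eq_bigr => x _ do rewrite -natrX.
  by rewrite -natr_sum ler_nat second_moment.
- exact: T_moment.
Qed.

(** After division by [(n L)^(2 r)] and up to constants, the moments contribute
    [q B^(r + 3) / (n L)] with [n L >= B^(r + 6)], and the shifts contribute [B]. Both fall short of
    [B^(2 r)] by a factor [B^3] at least, which by [B_big] absorbs [4 * 16^r]. *)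
Let nat_inequality : (2 ^ (2 * r) * ((n * L) ^ (2 * r - 2) * (3 * (B * (n * L)) * (q * B ^ r.+1)) +
   (n * (B * (2 * (A * B)))) ^ (2 * r)) * B <= (n * B) ^ (2 * r) * L ^ (2 * r))%N.
Proof.
have r16 : (16 <= r)%N by rewrite rt; lia.
set X := (n * L)%N.
have X_ge : (B ^ (r + 6) <= X)%N.
  apply: leq_trans (leq_mul size_As (leqnn L)); rewrite -expnD leq_pexp2l //; lia.
have X_gt0 : (0 < X)%N by apply: leq_trans X_ge; rewrite expn_gt0 B_gt0.
have -> : (n * (B * (2 * (A * B))) = 2 * X)%N.
  have -> : (X = n * (B * (A * B)))%N.
    by rewrite /X /L /A -expnSr -expnS; congr (_ * _ ^ _)%N; lia.
  lia.
have q_le : (q <= 2 ^ (2 * r) * B ^ (2 * r))%N.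
  apply: leq_trans (ltnW qB) _; rewrite -expnMn leq_exp2r; [lia|lia].
have four : (2 ^ (2 * r) = 4 ^ r)%N by rewrite expnM.
rewrite -expnMn (_ : (n * B * L = X * B)%N); last by rewrite /X mulnAC.
rewrite four (expnMn 2 X) (expnMn X B) four; clearbody X.
apply: (@leq_trans (4 ^ r * (X ^ (2 * r) * (3 * (4 ^ r * B ^ (2 * r - 4))) + 4 ^ r * X ^ (2 * r)) * B)%N).
  rewrite leq_mul2r; apply/orP; right; rewrite leq_mul2l; apply/orP; right; rewrite leq_add2r.
  have -> : (X ^ (2 * r) = X ^ (2 * r - 2) * (X * X))%N.
    by rewrite mulnn -expnD; congr (_ ^ _)%N; lia.
  rewrite -!mulnA leq_mul2l; apply/orP; right.
  have -> : (3 * (B * (X * (q * B ^ r.+1))) = 3 * X * (B * B ^ r.+1) * q)%N by ring.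
  have -> : (X * (X * (3 * (4 ^ r * B ^ (2 * r - 4)))) = 3 * X * (X * B ^ (2 * r - 4)) * 4 ^ r)%N.
    by move: (B ^ _)%N (4 ^ _)%N => U V; ring.
  apply: (@leq_trans (3 * X * (B * B ^ r.+1) * (4 ^ r * B ^ (2 * r)))%N).
    by rewrite leq_mul2l -four q_le orbT.
  have -> : (3 * X * (B * B ^ r.+1) * (4 ^ r * B ^ (2 * r)) =
             3 * X * (B * B ^ r.+1 * B ^ (2 * r)) * 4 ^ r)%N.
    by move: (B ^ r.+1)%N (B ^ _)%N (4 ^ _)%N => T' U V; ring.
  rewrite leq_mul2r; apply/orP; right; rewrite leq_mul2l; apply/orP; right.
  have -> : (B * B ^ r.+1 * B ^ (2 * r) = B ^ (r + 6) * B ^ (2 * r - 4))%N.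
    by rewrite -expnS -!expnD; congr (_ ^ _)%N; lia.
  by rewrite leq_mul2r X_ge orbT.
have -> : (4 ^ r * (X ^ (2 * r) * (3 * (4 ^ r * B ^ (2 * r - 4))) + 4 ^ r * X ^ (2 * r)) * B =
   X ^ (2 * r) * (4 ^ r * 4 ^ r * (3 * (B ^ (2 * r - 4) * B) + B)))%N.
  by move: (X ^ _)%N (B ^ _)%N (4 ^ _)%N => T' U V; ring.
rewrite leq_mul2l; apply/orP; right; rewrite -expnMn.
have -> : (B ^ (2 * r - 4) * B = B ^ (2 * r - 3))%N by rewrite -expnSr; congr (_ ^ _)%N; lia.
apply: (@leq_trans (16 ^ r * (4 * B ^ (2 * r - 3)))%N).
  rewrite leq_mul2l; apply/orP; right.
  have : (B ^ 1 <= B ^ (2 * r - 3))%N by rewrite leq_pexp2l //; lia.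
  by rewrite expn1; lia.
have -> : (B ^ (2 * r) = B ^ 3 * B ^ (2 * r - 3))%N by rewrite -expnD; congr (_ ^ _)%N; lia.
by rewrite mulnCA mulnA leq_mul2r B_big orbT.
Qed.

Theorem burgess_interval_aux : `|S| ^+ (2 * r) * B%:R <= (L ^ (2 * r))%N%:R.
Proof.
have nB_gt0 : (0 < n * B)%N.
  by rewrite muln_gt0 B_gt0 andbT (leq_trans _ size_As) // expn_gt0 B_gt0.
have pow_gt0 : 0 < ((n * B) ^ (2 * r))%N%:R :> algC by rewrite ltr0n expn_gt0 nB_gt0.
rewrite -(ler_pM2l pow_gt0) -natrM.
apply: le_trans (_ : (2 ^ (2 * r) * ((n * L) ^ (2 * r - 2) * (3 * (B * (n * L)) * (q * B ^ r.+1)) +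
   (n * (B * (2 * (A * B)))) ^ (2 * r)) * B)%N%:R <= _); last by rewrite ler_nat nat_inequality.
rewrite mulrA natrX -exprMn [leRHS]natrM ler_wpM2r ?ler0n //.
have nu_sum0 : 0 <= \sum_x (nu x)%:R * T x by apply: sumr_ge0 => x _; rewrite mulr_ge0.
apply: (@le_trans _ _ ((\sum_x (nu x)%:R * T x + (n * (B * (2 * (A * B))))%N%:R) ^+ (2 * r))).
  by rewrite lerXn2r ?nnegrE ?mulr_ge0 ?addr_ge0 ?ler0n ?normr_ge0.
apply: le_trans (exprD_le2 _ nu_sum0 _) _; first by rewrite ler0n.
rewrite [leRHS]natrM ler_wpM2l ?ler0n // [leRHS]natrD; apply: lerD; first exact: main_sum.
by rewrite -natrX.
Qed.

End BurgessInterval.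

(** * Primes between consecutive powers *)

Lemma pow_lt_exp2 m : exists B0, forall B, (B0 <= B)%N -> (B ^ m < 2 ^ B)%N.
Proof.
case: m => [|m]; first by exists 1%N => B B1; rewrite expn0 -[1%N](expn0 2) ltn_exp2l.
set C := (2 * m.+1)%N; have C0 : (0 < C)%N by rewrite muln_gt0.
exists (2 * C ^ m.+1)%N => B leB.
have B_lt : (B < C * 2 ^ (B %/ C))%N.
  have := ltn_expl (B %/ C) (ltnSn 1); rewrite -(leq_pmul2l C0); apply: leq_trans.
  by rewrite mulnC -ltn_divLR.
apply: (@leq_trans ((C * 2 ^ (B %/ C)) ^ m.+1)%N); first by rewrite ltn_exp2r.
rewrite expnMn -expnM; apply: (@leq_trans (2 ^ (C ^ m.+1) * 2 ^ (B %/ C * m.+1))%N).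
  by rewrite leq_mul2r ltnW ?orbT // ltn_expl.
rewrite -expnD leq_exp2l //.
have : (C * (B %/ C) <= B)%N by rewrite mulnC leq_divM.
move: leB; rewrite {2}/C; move: (C ^ _)%N (B %/ C)%N => X Y; nia.
Qed.

Lemma central_bin_ge n : (2 ^ n <= 'C(2 * n, n))%N.
Proof.
elim: n => // n IH; rewrite expnS; apply: leq_trans (leq_mul (leqnn 2) IH) _.
rewrite (_ : (2 * n.+1 = (2 * n).+2)%N); last by lia.
have E : 'C((2 * n).+1, n) = 'C((2 * n).+1, n.+1).
  by rewrite -bin_sub ?leqW ?leq_pmull //; congr 'C(_, _); lia.
by rewrite binS E binS; lia.
Qed.

(** Chebyshev's argument: each [p^k <= 2 n] adds at most 1 to the exponent of [p] and larger powers
    add nothing, so every prime contributes a factor of at most [2 n]. *)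
Lemma central_bin_le n : (0 < n)%N ->
  ('C(2 * n, n) <= (2 * n) ^ size [seq p <- index_iota 0 (2 * n).+1 | prime p])%N.
Proof.
move=> n0; set C := 'C(_, _); have C0 : (0 < C)%N by rewrite bin_gt0 leq_pmull.
have logC p : prime p -> (p ^ logn p C <= 2 * n)%N.
  move=> p_pr; have p1 := prime_gt1 p_pr.
  apply: leq_trans (trunc_logP p1 _); last by rewrite muln_gt0.
  rewrite leq_exp2l //.
  have := congr1 (logn p) (bin_fact (leq_pmull n (isT : 0 < 2)%N)).
  rewrite (_ : (2 * n - n = n)%N); last by lia.
  rewrite -/C !lognM ?muln_gt0 ?fact_gt0 // !logn_fact //.
  have -> : (\sum_(1 <= k < n.+1) n %/ p ^ k = \sum_(1 <= k < (2 * n).+1) n %/ p ^ k)%N.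
    rewrite [RHS](@big_cat_nat _ _ _ n.+1) //=; last by lia.
    rewrite [X in (_ = _ + X)%N]big_nat_cond [X in (_ = _ + X)%N]big1 ?addn0 // => k /andP[/andP[nk _] _].
    by apply: divn_small; apply: leq_trans (ltn_expl k p1); apply: ltnW.
  move=> E; set T := trunc_log p (2 * n).
  have : (\sum_(1 <= k < (2 * n).+1) 2 * n %/ p ^ k <=
      \sum_(1 <= k < (2 * n).+1) ((k <= T) + (n %/ p ^ k + n %/ p ^ k)))%N.
    apply: leq_sum => k _.
    have [kT|Tk] := leqP k T; last first.
      rewrite divn_small //; apply: leq_trans (trunc_log_ltn (2 * n) p1) _.
      by rewrite leq_exp2l.
    have pk0 : (0 < p ^ k)%N by rewrite expn_gt0 prime_gt0.
    rewrite -ltnS ltn_divLR //; have := ltn_ceil n pk0; rewrite /= -!/(_ %/ _)%N; set Q := (n %/ _)%N; nia.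
  rewrite -E !big_split /= leq_add2r => le1.
  have : (\sum_(1 <= k < (2 * n).+1) (k <= T) <= T)%N.
    rewrite -big_mkcond sum1_count -size_filter.
    rewrite -[X in (_ <= X)%N](size_iota 1); apply: uniq_leq_size; first by rewrite filter_uniq // iota_uniq.
    by move=> k; rewrite mem_filter !mem_iota; lia.
  exact: leq_trans le1.
rewrite {1}(prod_prime_decomp C0) prime_decompE big_map /=.
set ps := [seq p <- _ | _]; apply: (@leq_trans (\prod_(p <- primes C) (2 * n))%N).
  rewrite big_seq [X in (_ <= X)%N]big_seq; apply: leq_prod => p.
  by rewrite mem_primes => /andP[p_pr _]; apply: logC.
rewrite big_const_seq count_predT; have -> k : iter k (muln (2 * n)) 1%N = ((2 * n) ^ k)%N.
  by elim: k => //= k ->; rewrite expnS.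
rewrite leq_pexp2l ?muln_gt0 //; apply: uniq_leq_size; first exact: primes_uniq.
move=> p p_in; move: (p_in); rewrite mem_primes => /and3P[p_pr _ _].
rewrite mem_filter p_pr mem_iota prime_gt0 //= add1n ltnS; apply: leq_trans (logC p p_pr).
by rewrite -[X in (X <= _)%N]expn1 leq_exp2l ?prime_gt1 // logn_gt0.
Qed.

(** With fewer primes the central binomial coefficient would give
    [2^(B^k) <= B^((6 k + 1) B^(k-1))], that is [2^B <= B^(6 k + 1)]. The factor 3 leaves [B^(k-1)]
    primes after those up to [B^(k-1)] and those dividing [q] are removed. *)
Lemma many_primes k : (0 < k)%N -> exists B0, forall B, (B0 <= B)%N ->
  (3 * B ^ k.-1 <= size [seq p <- index_iota 0 (B ^ k).+1 | prime p])%N.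
Proof.
move=> k0; have [B0 HB] := pow_lt_exp2 (6 * k + 1); exists (maxn 2 B0) => B.
rewrite geq_max => /andP[B2 /HB {}HB]; rewrite leqNgt; apply/negP => few.
have Bk : (B ^ k = B * B ^ k.-1)%N by rewrite -expnS prednK.
set n := (B ^ k)./2.
have Bk2 : (2 <= B ^ k)%N by rewrite -[2%N]expn1; apply: (@leq_trans (B ^ 1)%N); [rewrite leq_exp2r|rewrite leq_pexp2l // ltnW].
have n0 : (0 < n)%N by rewrite half_gt0.
have n_le : (2 * n <= B ^ k)%N by rewrite mul2n -[X in (_ <= X)%N]odd_double_half leq_addl.
have n_ge : (B ^ k <= (2 * n).+1)%N.
  by rewrite mul2n -[X in (X <= _)%N]odd_double_half -add1n leq_add2r leq_b1.
have B_gt0 : (0 < B)%N by apply: ltnW.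
have le1 : (2 ^ n <= (B ^ k) ^ (3 * B ^ k.-1))%N.
  apply: leq_trans (central_bin_ge n) _; apply: leq_trans (central_bin_le n0) _.
  apply: (@leq_trans ((B ^ k) ^ size [seq p <- index_iota 0 (2 * n).+1 | prime p])%N).
    by rewrite leq_exp2r // -has_predT; apply/hasP; exists 2%N => //; rewrite mem_filter mem_iota /=; lia.
  rewrite leq_pexp2l ?expn_gt0 ?B_gt0 //; apply: leq_trans (ltnW few).
  apply: uniq_leq_size; first by rewrite filter_uniq // iota_uniq.
  by move=> p; rewrite !mem_filter !mem_index_iota => /andP[-> /=]; lia.
have : (2 ^ (B ^ k) <= (B ^ (6 * k + 1)) ^ (B ^ k.-1))%N.
  apply: (@leq_trans (2 ^ (2 * n).+1)%N); first by rewrite leq_exp2l.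
  rewrite expnS -expnM mulnDl mul1n expnD mulnC; apply: leq_mul; last first.
    by apply: leq_trans B2 _; rewrite -[X in (X <= _)%N]expn1 leq_pexp2l // expn_gt0 B_gt0.
  rewrite mulnC expnM; apply: (@leq_trans (((B ^ k) ^ (3 * B ^ k.-1)) ^ 2)%N); first by rewrite leq_exp2r.
  by rewrite -!expnM leq_pexp2l //; apply: eq_leq; ring.
rewrite Bk expnM leq_exp2r ?expn_gt0 ?B_gt0 // leqNgt => /negP; apply.
exact: HB.
Qed.

(* At most [m] primes above [B] divide a number below [B ^ m]. *)
Lemma coprime_prime_supply k m : (1 < k)%N -> exists B0, forall B q, (B0 <= B)%N -> (0 < q < B ^ m)%N ->
  (B ^ k.-1 <= size [seq p <- index_iota (B ^ k.-1).+1 (B ^ k).+1 | prime p && coprime p q])%N.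
Proof.
move=> k1; have [B0 HB] := many_primes (ltnW k1); exists (maxn m (maxn 2 B0)) => B q.
rewrite !geq_max => /and3P[mB B2 /HB {}HB] /andP[q0 q_lt].
have B_gt0 : (0 < B)%N by apply: ltnW.
have Bk : (B ^ k.-1 <= B ^ k)%N by rewrite leq_pexp2l // leq_pred.
set P := [seq p <- _ | prime p && _]; set Pq := [seq p <- index_iota (B ^ k.-1).+1 (B ^ k).+1 | prime p && (p %| q)%N].
have Pq_le : (size Pq <= B ^ k.-1)%N.
  have Pq_dvd : (\prod_(p <- Pq) p %| q)%N.
    apply: prod_primes_dvd; first by rewrite filter_uniq // iota_uniq.
    by move=> p; rewrite mem_filter => /andP[/andP[]].
  have BPq : (B ^ size Pq <= \prod_(p <- Pq) p)%N.
    have : all (fun p => B <= p)%N Pq.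
      apply/allP => p; rewrite mem_filter mem_index_iota => /andP[_ /andP[p_gt _]].
      apply: leq_trans (ltnW p_gt); rewrite -[X in (X <= _)%N]expn1 leq_pexp2l //; lia.
    elim: (Pq) => [|p s IH] /=; first by rewrite big_nil.
    by case/andP=> Bp /IH {}IH; rewrite big_cons expnS leq_mul.
  apply: leq_trans (_ : (m <= _)%N); last by apply: leq_trans mB _; rewrite -[X in (X <= _)%N]expn1 leq_pexp2l //; lia.
  apply: ltnW; rewrite -(ltn_exp2l _ _ B2); apply: leq_ltn_trans q_lt; apply: leq_trans BPq _.
  exact: dvdn_leq.
have : (size [seq p <- index_iota 0 (B ^ k).+1 | prime p] <= B ^ k.-1 + size Pq + size P)%N.
  rewrite -[X in (X + _ + _)%N](size_iota 1) -!size_cat; apply: uniq_leq_size; first by rewrite filter_uniq // iota_uniq.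
  move=> p; rewrite !mem_cat !mem_filter !mem_index_iota mem_iota => /andP[p_pr /andP[_ p_le]].
  rewrite add1n p_pr p_le (prime_gt0 p_pr) !andTb !andbT prime_coprime // ltnS.
  by case: leqP => //= _; case: (p %| q)%N.
move: (size _) (size _) (size P) HB Pq_le; move: (B ^ _)%N; lia.
Qed.

(** * Partial sums of nonprincipal characters *)

(** As the number of divisors is at most [3^w], with [w] the number of primes of [q], all losses are
    at most a constant times [c^w]. The exponent [4 r] in [omega_bound] against [q < (2 B)^(2 r)]
    makes [c^w] of order [sqrt B], which leaves room for the constant. *)
Lemma divisor_losses_small r : (0 < r)%N -> exists B0, forall B q, (B0 <= B)%N -> (0 < q < B.+1 ^ (2 * r))%N ->
  (forall p, prime p -> ~~ (p ^ 3 %| q)%N) ->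
  (r ^ (2 * r) + 2 * r * ((2 * r) ^ size (primes q) * (2 * size (divisors q)) ^ (2 * r).-1) <= B)%N.
Proof.
move=> r0; set c := (2 * r * 3 ^ (2 * r))%N.
have c0 : (0 < c)%N by rewrite /c !muln_gt0 r0 expn_gt0.
set K := (r ^ (2 * r) + 2 * r * 2 ^ (2 * r))%N.
have [C C0 HC] := omega_bound (4 * r) c0.
exists (maxn 1 (K ^ (4 * r) * (C * 2 ^ (2 * r)))) => B q; rewrite geq_max => /andP[B1 HB] /andP[q0 q_lt] q_cf.
set w := size (primes q).
have cw0 : (0 < c ^ w)%N by rewrite expn_gt0 c0.
apply: (@leq_trans (K * c ^ w)).
  rewrite /K mulnDl; apply: leq_add; first by rewrite leq_pmulr.
  rewrite -!mulnA leq_mul2l; apply/orP; right; rewrite leq_mul2l; apply/orP; right.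
  apply: (@leq_trans ((2 * r) ^ w * (2 * 3 ^ w) ^ (2 * r))%N).
    rewrite leq_mul2l; apply/orP; right.
    apply: (@leq_trans ((2 * 3 ^ w) ^ (2 * r).-1)%N).
      have [/eqP|nz] := boolP ((2 * r).-1 == 0)%N; first by move=> ->; rewrite !expn0.
      by rewrite leq_exp2r ?lt0n // leq_mul2l; apply/orP; right; apply: size_divisors_cube_free.
    by rewrite leq_pexp2l ?leq_pred // muln_gt0 expn_gt0.
  by rewrite /c !expnMn -!expnM (mulnC w (2 * r)) mulnCA.
rewrite -(@leq_exp2r _ _ (4 * r)) ?muln_gt0 // expnMn.
apply: (@leq_trans (K ^ (4 * r) * (C * ((2 * B) ^ (2 * r))))%N).
  rewrite leq_mul2l; apply/orP; right; apply: leq_trans (HC q q0) _.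
  rewrite leq_mul2l; apply/orP; right; apply: leq_trans (ltnW q_lt) _; rewrite leq_exp2r ?muln_gt0 //.
  by move: B1; lia.
have -> : (B ^ (4 * r) = B ^ (2 * r) * B ^ (2 * r))%N by rewrite -expnD; congr (_ ^ _)%N; lia.
rewrite expnMn !mulnA leq_mul2r; apply/orP; right; rewrite -mulnA; apply: leq_trans HB _.
by rewrite -[X in (X <= _)%N]expn1 leq_pexp2l ?muln_gt0.
Qed.

Lemma burgess_interval s : (4 <= s)%N -> exists B0, forall B q chi M0, (B0 <= B)%N ->
  (forall p, prime p -> ~~ (p ^ 3 %| q)%N) -> dchar q chi -> primitive q chi ->
  (B ^ (2 * 2 ^ s) <= q < B.+1 ^ (2 * 2 ^ s))%N ->
  `|\sum_(h < B ^ (2 ^ s.-1 + 5)) chi (M0 + h)%N| ^+ (2 * 2 ^ s) * B%:R <=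
    ((B ^ (2 ^ s.-1 + 5)) ^ (2 * 2 ^ s))%N%:R.
Proof.
move=> s4; set r := (2 ^ s)%N; set t := (2 ^ s.-1)%N.
have r0 : (0 < r)%N by rewrite expn_gt0.
have rt : r = (2 * t)%N by rewrite /t -expnS prednK //; lia.
have t8 : (8 <= t)%N by apply: (@leq_trans (2 ^ 3)%N) => //; rewrite leq_exp2l //; lia.
have [B1 HB1] := divisor_losses_small r0.
have [B2 HB2] := @coprime_prime_supply (t + 3) (4 * r) (ltn_addl t (isT : 1 < 3)%N).
exists (maxn (4 * 16 ^ r) (maxn B1 B2)) => B q chi M0; rewrite !geq_max => /and3P[B16 /HB1 {}HB1 /HB2 {}HB2].
have B_ge4 : (4 <= B)%N by apply: leq_trans B16; rewrite leq_pmulr // expn_gt0.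
have B_gt0 : (0 < B)%N by apply: leq_trans B_ge4.
move=> q_cf chi_char chi_prim /andP[Bq qB].
have q0 : (0 < q)%N by apply: leq_trans Bq; rewrite expn_gt0 B_gt0.
pose As := [seq p <- index_iota (B ^ (t + 3).-1).+1 (B ^ (t + 3)).+1 | prime p && coprime p q].
apply: (@burgess_interval_aux q chi s t r B M0 As) => //.
- by apply: leq_trans B_ge4.
- by apply: leq_trans B16 _; rewrite -[X in (X <= _)%N]expn1 leq_pexp2l.
- by apply: HB1 => //; rewrite q0.
- by rewrite filter_uniq // iota_uniq.
- move=> a; rewrite mem_filter mem_index_iota => /andP[/andP[a_pr co_a]].
  by rewrite ltnS (_ : (t + 3).-1 = t + 2)%N => [/andP[]|]; last lia.
apply: leq_trans (HB2 q _); first by rewrite leq_pexp2l //; lia.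
rewrite q0 /=; apply: leq_trans qB _; have -> : (4 * r = 2 * (2 * r))%N by rewrite mulnA.
rewrite [X in (_ <= X)%N]expnM leq_exp2r ?muln_gt0 // -mulnn; move: B_ge4; clear; nia.
Qed.

(** Descent: if primitivity fails at [p], then [chi] depends only on the class modulo [q / p]. When
    [p] still divides [q / p], [chi] itself is a character of that modulus; otherwise its Chinese
    remainder component is taken. *)
Lemma conductor q chi : (0 < q)%N -> dchar q chi -> (exists2 n, coprime n q & chi n != 1) ->
  exists q1 chi1, [/\ (1 < q1)%N, (q1 %| q)%N, dchar q1 chi1, primitive q1 chi1 &
    forall n, coprime n q -> chi n = chi1 n].
Proof.
have [k] := ubnP q; elim: k q chi => // k IH q chi; rewrite ltnS => qk q0 chi_char nonprin.
have [chi1 chiM chiP chi0] := chi_char.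
have q1 : (1 < q)%N.
  case: (ltngtP 1 q) => //; first by rewrite ltnNge q0.
  move=> E; case: nonprin => n _; rewrite (chiP n 1%N) ?chi1 ?eqxx // -E !modn1 //.
have [prim|nprim] := boolp.EM (primitive q chi).
  by exists q, chi; split.
have [p [p_pr pq triv]] : exists p, [/\ prime p, (p %| q)%N &
    forall n, n = 1 %[mod q %/ p] -> coprime n q -> chi n = 1].
  apply: boolp.contrapT => H; apply: nprim => p p_pr pq; apply: boolp.contrapT => H'.
  apply: H; exists p; split => // n n1 co_n; apply/eqP; apply: contraT => chin.
  by case: H'; exists n.
set q' := (q %/ p)%N; have qE : q = (q' * p)%N by rewrite divnK.
have q'0 : (0 < q')%N by rewrite divn_gt0 ?prime_gt0 // dvdn_leq.
have q'q : (q' < q)%N by rewrite ltn_Pdiv // prime_gt1.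
have eq_mod m n : coprime m q -> coprime n q -> m = n %[mod q'] -> chi m = chi n.
  move=> co_m co_n E; set y := (n ^ (totient q).-1)%N.
  have ny : (n * y = 1 %[mod q])%N by rewrite /y -expnS prednK ?totient_gt0 // Euler_exp_totient.
  have co_y : coprime y q by rewrite coprimeXl.
  have chi_ny : chi n * chi y = 1 by rewrite -chiM (chiP _ _ ny) chi1.
  have chi_my : chi m * chi y = 1.
    rewrite -chiM; apply: triv; last by rewrite coprimeMl co_m.
    have q'q_dvd : (q' %| q)%N by rewrite qE dvdn_mulr.
    by rewrite -modnMml E modnMml -(modn_dvdm _ q'q_dvd) ny modn_dvdm.
  by apply: (@mulIf _ (chi y)); rewrite ?chi_my ?chi_ny // chi0 co_y.
have [chi' chi'_char chi'E] : exists2 chi', dchar q' chi' & forall n, coprime n q -> chi n = chi' n.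
  have [pq'|npq'] := boolP (p %| q')%N.
    have co_eq n : coprime n q = coprime n q'.
      rewrite qE coprimeMr andbC andb_idl // => co_n; exact: coprime_dvdr co_n.
    exists chi => //; split => // [m n E|n]; last by rewrite chi0 co_eq.
    have [co_m|nco_m] := boolP (coprime m q).
      apply: eq_mod => //; rewrite co_eq -coprime_modl -E coprime_modl -co_eq //.
    have nco_n : ~~ coprime n q by rewrite co_eq -coprime_modl -E coprime_modl -co_eq.
    by move: nco_m nco_n; rewrite -!chi0 => /eqP -> /eqP ->.
  have co_q'p : coprime q' p by rewrite coprime_sym prime_coprime.
  have chi_char' : dchar (q' * p) chi by rewrite -qE.
  exists (char_left q' p chi); first by apply: char_left_dchar.
  move=> n co_n; apply: eq_mod => //; last by rewrite chinese_modl.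
  rewrite qE coprimeMr -[coprime _ q']coprime_modl chinese_modl // coprime_modl.
  rewrite -[coprime _ p]coprime_modl chinese_modr // coprime_modl coprime1n andbT.
  by apply: coprime_dvdr co_n; rewrite qE dvdn_mulr.
have [|q1' [chi1' [q1_gt1 q1q' char1 prim1 E1]]] := IH q' chi' (leq_trans q'q qk) q'0 chi'_char.
  by case: nonprin => n co_n chin; exists n; rewrite -?chi'E //; apply: coprime_dvdr co_n; rewrite qE dvdn_mulr.
exists q1', chi1'; split=> //; first by apply: dvdn_trans q1q' _; rewrite qE dvdn_mulr.
by move=> n co_n; rewrite chi'E // E1 //; apply: coprime_dvdr co_n; rewrite qE dvdn_mulr.
Qed.

Definition psum (chi : nat -> algC) M := \sum_(1 <= n < M.+1) chi n.

Lemma psumE chi M : psum chi M = \sum_(h < M) chi (1 + h)%N.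
Proof. by rewrite /psum -[X in index_iota X](add0n 1%N) big_addn subn1 big_mkord; apply: eq_bigr => h _; rewrite addnC. Qed.

Lemma sum_multiples (V : nmodType) (F : nat -> V) p M : (0 < p)%N ->
  \sum_(1 <= n < M.+1 | (p %| n)%N) F n = \sum_(1 <= m < (M %/ p).+1) F (p * m)%N.
Proof.
move=> p0; rewrite -big_filter -(big_map (muln p) xpredT F); apply: perm_big; apply: uniq_perm.
- by rewrite filter_uniq // iota_uniq.
- rewrite map_inj_uniq ?iota_uniq // => m n /eqP; rewrite eqn_pmul2l // => /eqP //.
move=> n; rewrite mem_filter mem_index_iota; apply/idP/mapP => [/and3P[/dvdnP[m ->] m0 mM]|[m]].
  exists m; last exact: mulnC.
  by rewrite mem_index_iota ltnS leq_divRL // andbC; move: m0 mM; rewrite muln_gt0 ltnS => /andP[-> _] ->.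
by rewrite mem_index_iota ltnS leq_divRL // => /andP[m0 mM] ->; rewrite dvdn_mulr //= muln_gt0 p0 m0 mulnC ltnS.
Qed.

(** Sieving by one more prime [p] subtracts [chi p] times the same sieved sum up to [M / p], so each
    prime at most doubles the bound. *)
Lemma sieved_sum_le (chi : nat -> algC) N x ps : {morph chi : m n / (m * n)%N >-> m * n} ->
  (forall n, `|chi n| <= 1) -> (forall M, (M <= N)%N -> `|psum chi M| <= x) ->
  uniq ps -> all prime ps -> forall M, (M <= N)%N ->
  `|\sum_(1 <= n < M.+1 | all (fun p => ~~ (p %| n)%N) ps) chi n| <= (2 ^ size ps)%N%:R * x.
Proof.
move=> chiM chi1 H; elim: ps => [|p ps IH] /= => [_ _ M MN|].
  by rewrite expn0 mul1r; apply: H.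
case/andP=> p_notin uniq_ps /andP[p_pr pr_ps] M MN.
have p0 := prime_gt0 p_pr.
have -> : \sum_(1 <= n < M.+1 | ~~ (p %| n)%N && all (fun p => ~~ (p %| n)%N) ps) chi n =
   \sum_(1 <= n < M.+1 | all (fun p => ~~ (p %| n)%N) ps) chi n -
   chi p * \sum_(1 <= n < (M %/ p).+1 | all (fun p => ~~ (p %| n)%N) ps) chi n.
  apply/eqP; rewrite eq_sym subr_eq; apply/eqP.
  rewrite (bigID (fun n => p %| n)%N) /= addrC; congr (_ + _).
    by apply: eq_bigl => n; rewrite andbC.
  rewrite big_mkcondl (sum_multiples _ _ p0) mulr_sumr [RHS]big_mkcond; apply: eq_bigr => m _.
  rewrite (eq_in_all (a2 := fun p => ~~ (p %| m)%N)) ?chiM // => r r_ps.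
  have r_pr := allP pr_ps _ r_ps; rewrite Euclid_dvdM // dvdn_prime2 //.
  by case: eqP r_ps p_notin => // -> ->.
apply: le_trans (ler_normB _ _) _; rewrite expnS mul2n -addnn natrD mulrDl; apply: lerD; first exact: IH.
rewrite normrM; apply: le_trans (_ : 1 * _ <= _); first by apply: ler_wpM2r; rewrite ?normr_ge0.
by rewrite mul1r IH // (leq_trans _ MN) // leq_div.
Qed.

Lemma block_sum (f : nat -> algC) L y M M0 : (0 < L)%N -> (forall n, `|f n| <= 1) ->
  (forall M0, `|\sum_(h < L) f (M0 + h)%N| <= y) ->
  `|\sum_(h < M) f (M0 + h)%N| <= (M %/ L)%:R * y + L%:R.
Proof.
move=> L0 f1 fy; have aux k e M1 : (e <= L)%N ->
    `|\sum_(h < k * L + e) f (M1 + h)%N| <= k%:R * y + L%:R.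
  move=> eL; elim: k M1 => [|k IH] M1.
    rewrite mul0n add0n mul0r add0r; apply: le_trans (ler_norm_sum _ _ _) _.
    apply: (@le_trans _ _ (\sum_(h < e) 1)); first by apply: ler_sum.
    by rewrite sumr_const card_ord ler_nat.
  rewrite mulSn -addnA big_split_ord /= mulrS mulrDl mul1r -addrA.
  apply: le_trans (ler_normD _ _) _; apply: lerD => //.
  by under eq_bigr => h _ do rewrite addnA; apply: IH.
by have := aux (M %/ L)%N _ M0 (ltnW (ltn_pmod M L0)); rewrite -divn_eq.
Qed.

Lemma full_period_sum q chi M0 : (0 < q)%N -> dchar q chi -> (exists2 n, coprime n q & chi n != 1) ->
  \sum_(h < q) chi (M0 + h)%N = 0.
Proof.
move=> q0 chi_char [n co_n chin]; have [_ chiM chiP _] := chi_char.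
pose sh (h : 'I_q) : 'I_q := Ordinal (ltn_pmod (M0 + h) q0).
have sh_inj : injective sh.
  move=> h h' /(congr1 val)/= /eqP; rewrite eqn_modDl !modn_small // => /eqP; exact: val_inj.
have -> : \sum_(h < q) chi (M0 + h)%N = \sum_(h < q) chi h.
  by rewrite [RHS](reindex_inj sh_inj); apply: eq_bigr => h _; apply: chiP; rewrite /= modn_mod.
pose mu (h : 'I_q) : 'I_q := Ordinal (ltn_pmod (n * h) q0).
have mu_inj : injective mu.
  move=> h h' /(congr1 val)/= E; apply: val_inj; rewrite -[LHS](modn_small (ltn_ord h)) -[RHS](modn_small (ltn_ord h')).
  by apply: coprime_mod_cancel E; rewrite coprime_sym.
have E : \sum_(h < q) chi h = chi n * \sum_(h < q) chi h.
  rewrite {1}(reindex_inj mu_inj) mulr_sumr; apply: eq_bigr => h _; rewrite -chiM; apply: chiP.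
  by rewrite /= modn_mod.
have /eqP : (1 - chi n) * (\sum_(h < q) chi h) = 0 by rewrite mulrBl mul1r -E subrr.
by rewrite mulf_eq0 subr_eq0 eq_sym (negPf chin) => /eqP.
Qed.

Lemma nat_root m q : (0 < m)%N -> exists B, (B ^ m <= q < B.+1 ^ m)%N.
Proof.
move=> m0; have ex : exists B, (B ^ m <= q)%N by exists 0%N; rewrite exp0n.
have ub B : (B ^ m <= q)%N -> (B <= q)%N.
  move=> Bq; apply: leq_trans Bq; case: B => // B.
  by rewrite -[X in (X <= _)%N]expn1 leq_pexp2l.
case: (ex_maxnP ex ub) => B Bq maxB; exists B; rewrite Bq /= ltnNge; apply/negP => /maxB.
by rewrite ltnn.
Qed.

(** If [q1^8 <= q], periodicity bounds the sum by [q1], far below [N >= q^(1/4)]. Otherwise the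
    interval bound modulo [q1] saves about [B] in the [2 r]-th power, and [(2 B)^(16 r) >= q]; the
    exponent [E] converts this saving into [q]. *)
Lemma conductor_sum_bound s : (4 <= s)%N -> let r := (2 ^ s)%N in let E := (16 * r * (2 * r))%N in
  exists c q0 : nat, forall q q1 N chi M, (q0 <= q)%N -> (1 < q1)%N -> (q1 %| q)%N ->
  (forall p, prime p -> ~~ (p ^ 3 %| q)%N) -> dchar q1 chi -> primitive q1 chi ->
  (q ^ (2 ^ s.-1 + 10) <= N ^ (2 * r))%N -> (M <= N)%N ->
  `|psum chi M| ^+ E * q%:R <= (c * N ^ E)%N%:R.
Proof.
move=> s4 r E; have [B0 HB] := burgess_interval s4; set t := (2 ^ s.-1)%N in HB *.
have r0 : (0 < r)%N by rewrite expn_gt0.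
have rt : r = (2 * t)%N by rewrite /r /t -expnS prednK //; lia.
have t8 : (8 <= t)%N by apply: (@leq_trans (2 ^ 3)%N) => //; rewrite leq_exp2l //; lia.
exists (2 ^ ((2 * r).+1 * (16 * r) + 16 * r))%N, ((maxn 1 B0) ^ (16 * r))%N.
move=> q q1 N chi M q_ge q1_gt1 q1q q_cf chi_char chi_prim qN MN.
have q0 : (0 < q)%N by apply: leq_trans q_ge; rewrite expn_gt0 leq_max.
have q1_gt0 := ltnW q1_gt1; have q1_le : (q1 <= q)%N := dvdn_leq q0 q1q.
have N4 : (q <= N ^ 4)%N.
  rewrite -(@leq_exp2r _ _ t) ?(leq_trans _ t8) // -expnM; apply: leq_trans (_ : (q ^ (t + 10) <= _)%N).
    by rewrite leq_pexp2l // leq_addr.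
  by apply: leq_trans qN _; rewrite rt mulnA.
have N0 : (0 < N)%N by move: N4; case: (N) => //; rewrite leqNgt q0.
have chi1 := dchar_norm_le1 q1_gt0 chi_char.
set x := `|psum chi M|; have x0 : 0 <= x by apply: normr_ge0.
have [small|large] := leqP (q1 ^ 8) q.
  have nonprin : exists2 n, coprime n q1 & chi n != 1.
    have [n [_ co_n chin]] := chi_prim _ (pdiv_prime q1_gt1) (pdiv_dvd q1).
    by exists n.
  have x_le : x <= q1%:R.
    have := @block_sum chi q1 0 M 1 q1_gt0 chi1; rewrite -psumE mulr0 add0r; apply=> M0.
    by rewrite full_period_sum ?normr0.
  have x8 : x ^+ 8 * q%:R <= (N ^ 8)%N%:R.
    apply: (@le_trans _ _ ((q * q)%N%:R)).
      rewrite natrM ler_wpM2r ?ler0n //; apply: le_trans (_ : q1%:R ^+ 8 <= _).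
        by rewrite lerXn2r ?nnegrE ?ler0n.
      by rewrite -natrX ler_nat.
    rewrite ler_nat; apply: leq_trans (leq_mul N4 N4) _; by rewrite -expnD.
  have E8 : E = (8 * (4 * r * r))%N by rewrite /E; ring.
  apply: (@le_trans _ _ ((x ^+ 8 * q%:R) ^+ (4 * r * r))).
    rewrite exprMn -exprM -E8 ler_wpM2l ?exprn_ge0 // -natrX ler_nat.
    by rewrite -[X in (X <= _)%N]expn1 leq_pexp2l // !muln_gt0 r0.
  apply: (@le_trans _ _ ((N ^ 8)%N%:R ^+ (4 * r * r))).
    by rewrite lerXn2r ?nnegrE ?ler0n // mulr_ge0 ?exprn_ge0 ?ler0n.
  by rewrite -natrX -expnM -E8 ler_nat leq_pmull // expn_gt0.
have [B /andP[Bq1 q1B]] : exists B, (B ^ (2 * r) <= q1 < B.+1 ^ (2 * r))%N.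
  by apply: nat_root; rewrite muln_gt0.
have qB : (q < B.+1 ^ (16 * r))%N.
  apply: ltn_trans large _; rewrite (_ : (16 * r = 2 * r * 8)%N); last by ring.
  by rewrite expnM ltn_exp2r.
have B_ge : (maxn 1 B0 <= B)%N.
  by rewrite -ltnS -(@ltn_exp2r _ _ (16 * r)) ?muln_gt0 //; apply: leq_ltn_trans qB.
move: B_ge; rewrite geq_max => /andP[B_gt0 B_ge].
have q1_cf p : prime p -> ~~ (p ^ 3 %| q1)%N.
  by move=> /q_cf; apply: contra => /dvdn_trans; apply.
set L := (B ^ (t + 5))%N; have L0 : (0 < L)%N by rewrite expn_gt0 B_gt0.
have B0C : 0 < B%:R :> algC by rewrite ltr0n.
have r20 : (0 < 2 * r)%N by rewrite muln_gt0.
pose y : algC := (2 * r).-root ((L ^ (2 * r))%N%:R / B%:R).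
have y0 : 0 <= y by rewrite rootC_ge0 // divr_ge0 ?ler0n.
have yE : y ^+ (2 * r) * B%:R = (L ^ (2 * r))%N%:R.
  by rewrite rootCK // divfK // gt_eqF.
have x_le : x <= (M %/ L)%:R * y + L%:R.
  rewrite /x psumE; apply: block_sum => // M0.
  rewrite -(ler_pXn2r r20) ?nnegrE ?normr_ge0 // -(ler_pM2r B0C) yE.
  by have := HB B q1 chi M0 B_ge q1_cf chi_char chi_prim; apply; apply/andP.
have x2r : x ^+ (2 * r) * B%:R <= ((2 ^ (2 * r)) * (2 * N ^ (2 * r)))%N%:R.
  apply: (@le_trans _ _ ((2 ^ (2 * r))%N%:R * (((M %/ L)%:R * y) ^+ (2 * r) + L%:R ^+ (2 * r)) * B%:R)).
    rewrite ler_wpM2r ?ler0n //; apply: le_trans (exprD_le2 _ _ _); rewrite ?mulr_ge0 ?ler0n //.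
    by rewrite lerXn2r ?nnegrE ?addr_ge0 ?mulr_ge0 ?ler0n.
  rewrite -mulrA [leRHS]natrM ler_wpM2l ?ler0n // mulrDl (mul2n (N ^ _)) -addnn natrD; apply: lerD.
    rewrite exprMn -mulrA yE -natrX -natrM ler_nat -expnMn leq_exp2r //.
    exact: leq_trans (leq_divM _ _) MN.
  rewrite -natrX -natrM ler_nat -expnM -expnSr; apply: leq_trans qN.
  apply: (@leq_trans ((B ^ (2 * r)) ^ (t + 10))%N).
    rewrite -expnM leq_pexp2l //.
    rewrite (_ : (2 * r * (t + 10) = (t + 5) * (2 * r) + 10 * r)%N); last by ring.
    by rewrite -addn1 leq_add2l muln_gt0.
  apply: (@leq_trans (q1 ^ (t + 10))%N); first by rewrite leq_exp2r // addn_gt0 orbT.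
  by rewrite leq_exp2r // addn_gt0 orbT.
have q_le : (q <= (2 * B) ^ (16 * r))%N.
  apply: leq_trans (ltnW qB) _; rewrite leq_exp2r ?muln_gt0 //; move: B_gt0; clear; lia.
apply: (@le_trans _ _ (x ^+ E * ((2 * B) ^ (16 * r))%N%:R)).
  by rewrite ler_wpM2l ?exprn_ge0 // ler_nat.
have -> : x ^+ E * ((2 * B) ^ (16 * r))%N%:R = (2 ^ (16 * r))%N%:R * (x ^+ (2 * r) * B%:R) ^+ (16 * r).
  by rewrite expnMn natrM mulrCA exprMn natrX -exprM [(B ^ _)%N%:R]natrX [(2 * r * _)%N]mulnC.
apply: (@le_trans _ _ ((2 ^ (16 * r))%N%:R * (2 ^ (2 * r) * (2 * N ^ (2 * r)))%N%:R ^+ (16 * r))).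
  by rewrite ler_wpM2l ?ler0n // lerXn2r ?nnegrE ?ler0n // mulr_ge0 ?exprn_ge0 ?ler0n.
rewrite -natrX -natrM ler_nat mulnA -expnSr expnMn -!expnM mulnA; apply: eq_leq.
by rewrite -expnD addnC [(2 * r * (16 * r))%N]mulnC.
Qed.

(** Passing to the inducing primitive character means sieving by the primes of [q], at a cost of 2
    for each. The doubled exponent [D = 2 E] saves [q^2], and one factor [q] is spent on this cost
    and on the constant. *)
Theorem burgess_cube_free s : (4 <= s)%N -> exists D q0 : nat, (0 < D)%N /\
  forall q N chi M, (q0 <= q)%N -> (forall p, prime p -> ~~ (p ^ 3 %| q)%N) -> dchar q chi ->
  (exists2 n, coprime n q & chi n != 1) ->
  (q ^ (2 ^ s.-1 + 10) <= N ^ (2 * 2 ^ s))%N -> (M <= N)%N ->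
  `|psum chi M| ^+ D * q%:R <= (N ^ D)%N%:R.
Proof.
move=> s4; have [c [q0 H]] := conductor_sum_bound s4; move: H.
set r := (2 ^ s)%N; set E := (16 * r * (2 * r))%N => H.
have E0 : (0 < E)%N by rewrite !muln_gt0 /= !expn_gt0.
have [C C0 HC] := omega_bound (4 * E) (isT : 0 < 2)%N.
exists (2 * E)%N, (maxn 1 (maxn q0 (c ^ 4 * C))); split; first by rewrite muln_gt0.
move=> q N chi M; rewrite !geq_max => /and3P[q_gt0 q_ge cq] q_cf chi_char nonprin qN MN.
have [q1 [chi1 [q1_gt1 q1q char1 prim1 chiE]]] := conductor q_gt0 chi_char nonprin.
have q1_gt0 := ltnW q1_gt1.
set w := size (primes q).
have Eq0 : (0 < q)%N := q_gt0.
have q0C : 0 < q%:R :> algC by rewrite ltr0n.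
pose y : algC := E.-root ((c * N ^ E)%N%:R / q%:R).
have y0 : 0 <= y by rewrite rootC_ge0 // divr_ge0 ?ler0n.
have yE : y ^+ E * q%:R = (c * N ^ E)%N%:R by rewrite rootCK // divfK // gt_eqF.
have psum1 M1 : (M1 <= N)%N -> `|psum chi1 M1| <= y.
  move=> M1N; rewrite -(ler_pXn2r E0) ?nnegrE ?normr_ge0 // -(ler_pM2r q0C) yE.
  exact: (H q q1).
have psumE1 : psum chi M = \sum_(1 <= n < M.+1 | all (fun p => ~~ (p %| n)%N) (primes q)) chi1 n.
  rewrite /psum [RHS]big_mkcond; apply: eq_big_nat => n /andP[n0 _].
  have -> : all (fun p => ~~ (p %| n)%N) (primes q) = coprime n q.
    rewrite coprime_has_primes // -all_predC; apply: eq_in_all => p.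
    by rewrite mem_primes => /and3P[p_pr _ _]; rewrite /= mem_primes p_pr n0.
  case: ifP => [/chiE //|/negbT]; have [_ _ _ <-] := chi_char; by move=> /eqP.
have [_ chiM1 _ _] := char1.
have pr_primes : all prime (primes q) by apply/allP => p; rewrite mem_primes => /andP[].
have := sieved_sum_le chiM1 (dchar_norm_le1 q1_gt0 char1) psum1 (primes_uniq q) pr_primes MN.
rewrite -psumE1 -/w => S_le.
have S_E : `|psum chi M| ^+ E * q%:R <= ((2 ^ w) ^ E * (c * N ^ E))%N%:R.
  apply: (@le_trans _ _ (((2 ^ w)%N%:R * y) ^+ E * q%:R)).
    by rewrite ler_wpM2r ?ler0n // lerXn2r ?nnegrE ?normr_ge0 // mulr_ge0 ?ler0n.
  by rewrite exprMn -mulrA yE -natrX -natrM.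
rewrite -(ler_pM2r q0C); apply: (@le_trans _ _ (((2 ^ w) ^ E * (c * N ^ E))%N%:R ^+ 2)).
  rewrite -mulrA -expr2 (mulnC 2 E) exprM -exprMn.
  by rewrite lerXn2r ?nnegrE ?ler0n // mulr_ge0 ?exprn_ge0 ?normr_ge0 ?ler0n.
rewrite -natrX -natrM ler_nat.
rewrite (_ : ((2 ^ w) ^ E * (c * N ^ E)) ^ 2 = (((2 ^ w) ^ E) ^ 2 * c ^ 2) * N ^ (2 * E))%N; last first.
  by rewrite (mulnC 2 E) expnM; move: ((2 ^ w) ^ E)%N (N ^ E)%N => U V; ring.
rewrite mulnC leq_mul2l; apply/orP; right; rewrite -leq_sqr expnMn -!expnM.
have := HC q Eq0; rewrite -/w -expnM => HCq.
apply: (@leq_trans (C * q * c ^ 4)%N).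
  by rewrite leq_mul2r; apply/orP; right; apply: leq_trans HCq; rewrite leq_exp2l //; apply: eq_leq; ring.
rewrite (_ : C * q * c ^ 4 = q * (c ^ 4 * C))%N; last by ring.
by rewrite -mulnn leq_mul2l cq orbT.
Qed.

(** * Counting solutions of congruences with characters *)

(** The irreducible characters of the abelian group of units, extended by zero; the last clause is
    the second orthogonality relation. *)
Lemma character_family q : (1 < q)%N -> exists k (X : 'I_k.+1 -> nat -> algC),
  [/\ forall i, dchar q (X i), forall n, coprime n q -> X ord0 n = 1,
   forall i, i != ord0 -> exists2 n, coprime n q & X i n != 1 &
   forall m n, coprime m q -> coprime n q ->
     \sum_i X i m * (X i n)^* = (totient q)%:R *+ (m == n %[mod q])].
Proof.
move=> q1; have q0 := ltnW q1; pose G := units_Zp q.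
have abG : abelian G := units_Zp_abelian q.
have lin i : 'chi[G]_i \is a linear_char by apply/char_abelianP.
pose toU (n : nat) : option {unit 'Z_q} := insub (n%:R : 'Z_q).
pose X (i : 'I_(pred_Nirr G).+1) n := if toU n is Some u then 'chi[G]_i u else 0.
have inG (u : {unit 'Z_q}) : u \in G by rewrite inE.
have toUP n : coprime n q -> exists2 u, toU n = Some u & val u = n%:R.
  move=> co_n; have Un : (n%:R : 'Z_q) \is a GRing.unit by rewrite unitZpE // coprime_sym.
  by exists (FinRing.Unit Un); rewrite // /toU insubT.
have toU0 n : ~~ coprime n q -> toU n = None.
  by move=> co_n; rewrite /toU insubF // unitZpE // coprime_sym; apply/negbTE.
have eq_nat m n : (m == n %[mod q]) = (m%:R == n%:R :> 'Z_q).
  by rewrite -val_eqE /= !val_Zp_nat.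
exists (pred_Nirr G), X; split.
- move=> i; split.
  + by rewrite /X; have [u -> u1] := toUP 1%N (coprime1n q); rewrite (_ : u = 1%g) ?(lin_char1 (lin i)) //; apply: val_inj.
  + move=> m n; rewrite /X.
    have [co_m|/toU0 Em] := boolP (coprime m q); last first.
      rewrite Em mul0r; have [co_mn|/toU0 -> //] := boolP (coprime (m * n) q).
      by move: Em; move: co_mn; rewrite coprimeMl => /andP[/toUP[u -> _] _].
    have [co_n|/toU0 En] := boolP (coprime n q); last first.
      rewrite En mulr0; have [co_mn|/toU0 -> //] := boolP (coprime (m * n) q).
      by move: En; move: co_mn; rewrite coprimeMl => /andP[_ /toUP[u -> _]].
    have [u -> uE] := toUP m co_m; have [v -> vE] := toUP n co_n.
    have [w -> wE] : exists2 w, toU (m * n)%N = Some w & val w = (m * n)%:R.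
      by apply: toUP; rewrite coprimeMl co_m.
    rewrite (_ : w = (u * v)%g) ?(lin_charM (lin i)) //.
    by apply: val_inj; rewrite FinRing.val_unitM uE vE wE natrM.
  + by move=> m n /eqP; rewrite eq_nat /X /toU => /eqP ->.
  + move=> n; have [co_n|nco_n] := boolP (coprime n q); last by rewrite /X toU0 ?eqxx.
    by rewrite /X; have [u -> _] := toUP n co_n; apply/negbTE/(lin_char_neq0 (lin i)).
- move=> n co_n; rewrite /X; have [u -> _] := toUP n co_n.
  by rewrite (irr0 G) cfun1E inG.
- move=> i i0; apply: boolp.contrapT => H; case/negP: i0; apply/eqP; apply: irr_inj.
  apply/cfunP => u; rewrite (irr0 G) cfun1E inG.
  have co_u : coprime (val u : 'Z_q) q.
    by rewrite coprime_sym -unitZpE // natr_Zp; apply: (valP u).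
  have [v Ev vE] := toUP _ co_u; have Euv : v = u by apply: val_inj; rewrite vE natr_Zp.
  apply/eqP; apply: contraT => Hu; case: H; exists (val u : 'Z_q) => //.
  by rewrite /X Ev Euv.
move=> m n co_m co_n; rewrite /X; have [u -> uE] := toUP m co_m; have [v -> vE] := toUP n co_n.
rewrite second_orthogonality_relation // -card_units_Zp // eq_nat -uE -vE.
have -> : 'C_G[u]%g = G.
  by apply/setIidPl/subsetP => x _; apply/cent1P; apply: (centsP abG); rewrite inG.
congr (_ *+ _); congr nat_of_bool; rewrite val_eqE.
apply/imsetP/eqP => [[x _ ->]|->]; last by exists 1%g; rewrite ?conjg1.
by rewrite /conjg (centsP abG v _ x) ?mulKg // ?inG.
Qed.

Section Family.
Variables (q k : nat) (X : 'I_k.+1 -> nat -> algC).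
Hypothesis X_orth : forall m n, coprime m q -> coprime n q ->
  \sum_i X i m * (X i n)^* = (totient q)%:R *+ (m == n %[mod q]).

Lemma orthogonality_count (T : eqType) (s : seq T) (f : T -> algC) (h : T -> nat) a :
  {in s, forall t, coprime (h t) q} -> coprime a q ->
  \sum_i (\sum_(t <- s) f t * X i (h t)) * (X i a)^* =
  (totient q)%:R * \sum_(t <- s | h t == a %[mod q]) f t.
Proof.
move=> co_h co_a; under eq_bigr do rewrite mulr_suml.
rewrite exchange_big mulr_sumr [RHS]big_mkcond /=; apply: eq_big_seq => t t_in.
under eq_bigr do rewrite -mulrA.
by rewrite -mulr_sumr X_orth ?co_h //; case: eqP => _; rewrite ?mulr1n ?mulr0n ?mulr0 // mulrC.
Qed.

(** Expanding the square, orthogonality keeps only the congruent pairs, and each element of [s] has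
    at most [B] partners. *)
Lemma second_moment_bound (T : eqType) (s : seq T) (f : T -> algC) (h : T -> nat) B :
  (forall t, `|f t| <= 1) -> {in s, forall t, coprime (h t) q} ->
  {in s, forall t, (count (fun t' => h t' == h t %[mod q]) s <= B)%N} ->
  \sum_i `|\sum_(t <- s) f t * X i (h t)| ^+ 2 <= (totient q * (size s * B))%N%:R.
Proof.
move=> f1 co_h cnt.
have E : \sum_i `|\sum_(t <- s) f t * X i (h t)| ^+ 2 =
    (totient q)%:R * \sum_(t <- s) (f t)^* * \sum_(t' <- s | h t' == h t %[mod q]) f t'.
  under eq_bigr do rewrite normCK rmorph_sum mulr_sumr.
  rewrite exchange_big mulr_sumr /=; apply: eq_big_seq => t t_in.
  rewrite mulrCA -orthogonality_count ?co_h // mulr_sumr; apply: eq_bigr => i _.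
  by rewrite rmorphM mulrCA.
rewrite -[leLHS]ger0_norm; last by apply: sumr_ge0 => i _; rewrite exprn_ge0 ?normr_ge0.
rewrite E normrM normr_nat natrM ler_wpM2l ?ler0n //.
apply: le_trans (ler_norm_sum _ _ _) _.
apply: (@le_trans _ _ (\sum_(t <- s) B%:R)); last first.
  by rewrite big_const_seq count_predT iter_addr_0 -[_ *+ _]mulr_natl -natrM.
rewrite big_seq [leRHS]big_seq; apply: ler_sum => t t_in.
rewrite normrM norm_conjC; apply: le_trans (_ : 1 * _ <= _); first by apply: ler_wpM2r; rewrite ?normr_ge0.
rewrite mul1r; apply: le_trans (ler_norm_sum _ _ _) _.
apply: (@le_trans _ _ (\sum_(t' <- s | h t' == h t %[mod q]) 1)); first by apply: ler_sum.
rewrite -big_filter big_const_seq count_predT iter_addr_0 size_filter ler_nat; exact: cnt.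
Qed.
End Family.

Lemma class_count_le (T : eqType) (s : seq T) (h : T -> nat) q M C r : (0 < q)%N ->
  {in s, forall t, (h t <= M)%N} -> (forall v, (count (fun t => h t == v) s <= C)%N) ->
  (count (fun t => h t == r %[mod q]) s <= (M %/ q).+1 * C)%N.
Proof.
move=> q0 hM cnt; have lt_r := ltn_pmod r q0.
apply: (@leq_trans (\sum_(j < (M %/ q).+1) count (fun t => h t == j * q + r %% q)%N s)); last first.
  by rewrite -[X in (_ <= X * _)%N]card_ord -sum_nat_const; apply: leq_sum.
elim: s hM {cnt} => [|t s IH] //= hM.
rewrite big_split /=; apply: leq_add; last by apply: IH => t' t'_s; apply: hM; rewrite in_cons t'_s orbT.
case: eqP => // E; have lt_j : (h t %/ q < (M %/ q).+1)%N.
  by rewrite ltnS leq_div2r // hM ?mem_head.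
by rewrite (bigD1 (Ordinal lt_j)) //= -E -divn_eq eqxx.
Qed.

(** A list with repetitions, not a set, so that a multiplicative function sums over it to an exact
    [K]-th power. *)
Definition product_list (zs : seq nat) K :=
  iter K (fun ws => [seq (z * w)%N | z <- zs, w <- ws]) [:: 1%N].

Section ProductList.
Variables (zs : seq nat) (Z : nat).
Hypothesis zs_le : {in zs, forall z, (0 < z <= Z)%N}.

Lemma size_product_list K : size (product_list zs K) = (size zs ^ K)%N.
Proof. by elim: K => //= K IH; rewrite size_allpairs IH expnS. Qed.

Lemma product_list_le K : {in product_list zs K, forall w, (0 < w <= Z ^ K)%N}.
Proof.
elim: K => [|K IH] w /=; first by rewrite inE => /eqP ->.
move=> /allpairsP[[z w'] /= [/zs_le/andP[z0 zZ] /IH/andP[w0 wZ] ->]].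
by rewrite muln_gt0 z0 w0 expnS leq_mul.
Qed.

Lemma product_list_coprime q K : {in zs, forall z, coprime z q} ->
  {in product_list zs K, forall w, coprime w q}.
Proof.
move=> co_z; elim: K => [|K IH] w /=; first by rewrite inE => /eqP ->; apply: coprime1n.
by move=> /allpairsP[[z w'] /= [/co_z co1 /IH co2 ->]]; rewrite coprimeMl co1.
Qed.

Lemma product_listP K w : w \in product_list zs K ->
  exists ss : seq nat, [/\ size ss = K, all (mem zs) ss & w = (\prod_(z <- ss) z)%N].
Proof.
elim: K w => [|K IH] w /=; first by rewrite inE => /eqP ->; exists [::]; rewrite big_nil.
move=> /allpairsP[[z w'] /= [z_in /IH[ss [sz ss_in ->]] ->]].
by exists (z :: ss); rewrite /= sz z_in ss_in big_cons.
Qed.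

Lemma sum_product_list (chi : nat -> algC) K : chi 1%N = 1 -> {morph chi : m n / (m * n)%N >-> m * n} ->
  \sum_(w <- product_list zs K) chi w = (\sum_(z <- zs) chi z) ^+ K.
Proof.
move=> chi1 chiM; elim: K => [|K IH] /=; first by rewrite big_seq1 chi1.
rewrite big_allpairs_dep exprS mulr_suml; apply: eq_bigr => z _.
by rewrite -IH mulr_sumr; apply: eq_bigr => w _; rewrite chiM.
Qed.

(* Representations of [v]: each of the [K] primes is one of at most [c0] prime divisors of [v]. *)
Lemma product_list_count (I : seq nat) (h : nat -> nat) c0 C0 M K :
  (forall v, (0 < v <= M)%N -> (count (fun z => z %| v)%N zs <= c0)%N) ->
  {in I, forall n, (0 < h n)%N /\ (h n * Z ^ K <= M)%N} ->
  (forall v, (count (fun n => h n == v) I <= C0)%N) ->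
  forall v, (count (fun t => h t.1 * t.2 == v)%N [seq (n, w) | n <- I, w <- product_list zs K] <= c0 ^ K * C0)%N.
Proof.
move=> zdiv hM cnt0.
have E j v : count (fun t => h t.1 * t.2 == v)%N [seq (n, w) | n <- I, w <- product_list zs j] =
   (\sum_(w <- product_list zs j) count (fun n => h n * w == v)%N I)%N.
  rewrite -sum1_count big_mkcond big_allpairs_dep exchange_big /=; apply: eq_bigr => w _.
  by rewrite -sum1_count [RHS]big_mkcond.
move=> v; rewrite E; move: (leqnn K); move: {1 3 4}K => j; elim: j v => [|j IH] v jK.
  rewrite expn0 mul1n /product_list /= big_seq1; under eq_count => n do rewrite muln1.
  exact: cnt0.
rewrite /= big_allpairs_dep /=.
have [/andP[v0 vM]|nv] := boolP (0 < v <= M)%N; last first.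
  rewrite big1_seq // => z /andP[_ z_in]; rewrite big1_seq // => w /andP[_ w_in].
  apply/eqP; rewrite eqn0Ngt -has_count; apply/hasPn => n n_in; apply: contra nv => /eqP <-.
  have [h0 hZ] := hM n n_in; have /andP[z0 zZ] := zs_le z_in.
  have /andP[w0 wZ] := product_list_le w_in.
  rewrite !muln_gt0 h0 z0 w0 /=; apply: leq_trans hZ; rewrite leq_mul2l; apply/orP; right.
  apply: leq_trans (leq_mul zZ wZ) _; rewrite -expnS leq_pexp2l //; exact: leq_trans zZ.
apply: (@leq_trans (\sum_(z <- zs | (z %| v)%N) (c0 ^ j * C0))%N).
  rewrite [X in (_ <= X)%N]big_mkcond big_seq [X in (_ <= X)%N]big_seq /=; apply: leq_sum => z z_in.
  have /andP[z0 _] := zs_le z_in.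
  case: ifP => zv; last first.
    rewrite big1_seq // => w _; apply/eqP; rewrite eqn0Ngt -has_count; apply/hasPn => n _.
    by apply/negP => /eqP E'; move: zv; rewrite -E' mulnCA dvdn_mulr.
  apply: leq_trans (IH (v %/ z)%N (ltnW jK)); apply: leq_sum => w _; apply: sub_count => n /= /eqP <-.
  by rewrite mulnCA mulKn.
rewrite -big_filter big_const_seq count_predT size_filter iter_addn_0 mulnC expnS -mulnA leq_mul2r.
by rewrite zdiv ?v0 ?orbT.
Qed.
End ProductList.

(** * Parts of integers prime to the modulus, smooth splitting *)

(* Working with [cpart q n] instead of restricting to [n] coprime to [q] avoids a sieve. *)
Definition qpart q n := (n`_(\pi(q)))%N.
Definition cpart q n := (n`_(\pi(q)^'))%N.
Definition small_qpart q U N := [seq n <- index_iota 1 N.+1 | (qpart q n <= U)%N].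

Lemma cpart_coprime q n : (0 < q)%N -> coprime (cpart q n) q.
Proof. by move=> q0; rewrite coprime_sym coprime_pi' ?part_gt0 // part_pnat. Qed.

Lemma cpart_le q n : (0 < n)%N -> (cpart q n <= n)%N.
Proof. by move=> n0; apply: dvdn_leq => //; apply: dvdn_part. Qed.

Lemma count_dvdn d N : (0 < d)%N -> count (fun n => d %| n)%N (index_iota 1 N.+1) = (N %/ d)%N.
Proof. by move=> d0; rewrite -sum1_count sum_multiples // sum_nat_const_nat muln1 subn1. Qed.

(** Once [cpart q n] is fixed, [n] is determined by [qpart q n], which takes at most [U] values. *)
Lemma small_qpart_count q U N v : (0 < q)%N ->
  (count (fun n => cpart q n == v) (small_qpart q U N) <= U)%N.
Proof.
move=> q0; rewrite -size_filter -[X in (_ <= X)%N](size_iota 1) -(size_map (qpart q)).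
apply: uniq_leq_size => [|y /mapP[n]].
  rewrite map_inj_in_uniq ?filter_uniq ?iota_uniq // => m n.
  rewrite !mem_filter !mem_index_iota => /and4P[/eqP Em _ m0 _] /and4P[/eqP En _ n0 _] E.
  by rewrite -(partnC \pi(q) m0) -(partnC \pi(q) n0) -/(cpart q m) -/(cpart q n) Em En -/(qpart q m) E.
rewrite !mem_filter => /and3P[_ nU _] ->; rewrite mem_iota add1n ltnS nU andbT.
exact: part_gt0.
Qed.

(** Group by [d = qpart q n] and write [n = d m]. What remains is an unrestricted partial sum of
    [chi] up to [N / d], because [chi m] vanishes unless [m] is prime to [q]. *)
Lemma sum_small_qpart q U N chi (x : algC) : (0 < q)%N -> dchar q chi ->
  (forall M, (M <= N)%N -> `|psum chi M| <= x) ->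
  `|\sum_(n <- small_qpart q U N) chi (cpart q n)| <= U%:R * x.
Proof.
move=> q0 chi_char H; have [chi1 chiM chiP chi0] := chi_char.
have -> : \sum_(n <- small_qpart q U N) chi (cpart q n) =
    \sum_(1 <= d < U.+1) \sum_(1 <= n < N.+1 | qpart q n == d) chi (cpart q n).
  rewrite big_filter (exchange_big_dep xpredT) //= [LHS]big_mkcond; apply: eq_bigr => n _.
  rewrite -big_filter -[in LHS]ltnS.
  have -> : [seq d <- index_iota 1 U.+1 | qpart q n == d] = if (qpart q n < U.+1)%N then [:: qpart q n] else [::].
    rewrite (eq_filter (a2 := pred1 (qpart q n))); last by move=> d; rewrite /= eq_sym.
    case: ifP => nU; last first.
      by apply/eqP; rewrite -(negbK (_ == _)) -has_filter -all_predC; apply/allP => d;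
         rewrite mem_index_iota /= => /andP[_ dU]; apply: contraFN nU => /eqP <-.
    apply: filter_pred1_uniq; first exact: iota_uniq.
    by rewrite mem_index_iota nU andbT; apply: part_gt0.
  by case: ifP; rewrite ?big_seq1 ?big_nil.
apply: le_trans (ler_norm_sum _ _ _) _.
apply: (@le_trans _ _ (\sum_(1 <= d < U.+1) x)); last first.
  by rewrite big_const_nat subn1 /= iter_addr_0 mulr_natl.
rewrite big_nat [leRHS]big_nat; apply: ler_sum => d /andP[d0 _].
have x0 : 0 <= x by apply: le_trans (H 0%N (leq0n _)); apply: normr_ge0.
have [pid|npid] := boolP (\pi(q).-nat d); last first.
  rewrite big1 ?normr0 // => n /eqP E; case/negP: npid; rewrite -E; exact: part_pnat.
have -> : \sum_(1 <= n < N.+1 | qpart q n == d) chi (cpart q n) = psum chi (N %/ d); last first.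
  by apply: H; apply: leq_div.
rewrite (eq_bigl (fun n => (d %| n)%N && (qpart q n == d))); last first.
  by move=> n; case: eqP => [<-|]; rewrite ?andbF // andbT dvdn_part.
rewrite big_mkcondr sum_multiples // /psum; apply: eq_big_nat => m /andP[m0 _].
rewrite /qpart /cpart !partnM // (part_pnat_id pid).
have -> : (d`_(\pi(q)^') = 1)%N by apply: part_p'nat; rewrite /pnat d0; apply/allP => p pd; rewrite !inE negbK; case/andP: pid => _ /allP; apply.
rewrite mul1n -[X in _ == X]muln1 eqn_pmul2l //; case: eqP => [m1|m1].
  by rewrite -[in RHS](partnC \pi(q) m0) m1 mul1n.
apply/esym/eqP; rewrite chi0; apply/negP => co_m; apply: m1; apply: part_p'nat.
by rewrite -coprime_pi' // coprime_sym.
Qed.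

Lemma count_dvd_le (ds s : seq nat) (P : pred nat) :
  {in s, forall n, P n -> has (fun d => d %| n)%N ds} ->
  (count P s <= \sum_(d <- ds) count (fun n => d %| n)%N s)%N.
Proof.
elim: s => [|n s IH] /= H; first by [].
rewrite big_split /=; apply: leq_add; last by apply: IH => m m_s; apply: H; rewrite in_cons m_s orbT.
case Pn: (P n) => //; have /hasP[d d_in dn] := H n (mem_head _ _) Pn.
by rewrite (big_rem d) //= dn.
Qed.

Lemma sum_inv_sq_le V N : (0 < V)%N -> (V * \sum_(V.+1 <= k < N.+1) N %/ k ^ 2 <= N)%N.
Proof.
move=> V0; have V0Q : 0 < V%:R :> rat by rewrite ltr0n.
rewrite -(ler_nat rat) natrM natr_sum.
have aux M : (V <= M)%N -> \sum_(V.+1 <= k < M.+1) (k ^ 2)%N%:R^-1 <= V%:R^-1 - M%:R^-1 :> rat.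
  move=> VM; rewrite -(subnKC VM); elim: (M - V)%N => [|d IH].
    by rewrite addn0 big_geq // subrr.
  rewrite addnS big_nat_recr ?ltnS ?leq_addr //=; apply: le_trans (lerD IH (lexx _)) _.
  set n := (V + d)%N; have n0 : 0 < n%:R :> rat by rewrite ltr0n /n addn_gt0 V0.
  rewrite natrX -(natr1 n); move: n%:R n0 => x x0; rewrite -subr_ge0.
  have -> : V%:R^-1 - (x + 1)^-1 - (V%:R^-1 - x^-1 + ((x + 1) ^+ 2)^-1) = (x * (x + 1) ^+ 2)^-1.
    by field; rewrite !gt_eqF //; lra.
  by rewrite invr_ge0 mulr_ge0 ?exprn_ge0 //; lra.
have [VN|NV] := leqP V N; last by rewrite big_geq ?mulr0 ?ler0n // ltnS ltnW.
apply: (@le_trans _ _ (V%:R * (N%:R * \sum_(V.+1 <= k < N.+1) (k ^ 2)%N%:R^-1))).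
  rewrite ler_wpM2l ?ler0n // mulr_sumr big_nat [leRHS]big_nat; apply: ler_sum => k /andP[Vk _].
  rewrite ler_pdivlMr ?ltr0n ?expn_gt0 ?(leq_trans _ Vk) // -natrM ler_nat; exact: leq_divM.
apply: (@le_trans _ _ (V%:R * (N%:R * V%:R^-1))); last by rewrite mulrCA divff ?mulr1 // gt_eqF.
rewrite ler_wpM2l ?ler0n // ler_wpM2l ?ler0n //; apply: le_trans (aux N VN) _.
by rewrite gerBl invr_ge0 ler0n.
Qed.

(** Write the part of [n] at the primes of [q] as [m k^2] with [k] maximal. Then [m] is squarefree
    with all its primes dividing [q], so [m] divides [q]; and [k <= V] forces [m > V^2]. *)
Lemma large_qpart_divisor q V n : (0 < q)%N -> (0 < V)%N -> (0 < n)%N -> (V ^ 4 < qpart q n)%N ->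
  (exists2 k, (V < k)%N & (k ^ 2 %| n)%N) \/ (exists m, [/\ (V ^ 2 < m)%N, (m %| q)%N & (m %| n)%N]).
Proof.
move=> q0 V0 n0 gV; set g := qpart q n in gV; have g0 : (0 < g)%N by apply: part_gt0.
have ex : exists k, (k ^ 2 %| g)%N by exists 1%N; rewrite exp1n dvd1n.
have ub k : (k ^ 2 %| g)%N -> (k <= g)%N.
  by move=> /(dvdn_leq g0); apply: leq_trans; rewrite -mulnn; case: k => // k; rewrite leq_pmulr.
case: (ex_maxnP ex ub) => k kg maxk.
have gn : (g %| n)%N by apply: dvdn_part.
have [Vk|kV] := ltnP V k; first by left; exists k => //; apply: dvdn_trans kg gn.
have k0 : (0 < k)%N by apply: maxk; rewrite exp1n dvd1n.
right; set m := (g %/ k ^ 2)%N; have gE : g = (m * k ^ 2)%N by rewrite divnK.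
have m0 : (0 < m)%N by move: g0; rewrite gE muln_gt0 => /andP[].
exists m; split; last by apply: dvdn_trans gn; rewrite gE dvdn_mulr.
  rewrite ltnNge; apply/negP => mV; move: gV; rewrite ltnNge gE => /negP; apply.
  by rewrite (_ : 4 = 2 + 2)%N // expnD; apply: leq_mul => //; rewrite leq_exp2r.
have -> : m = (\prod_(p <- primes m) p)%N.
  rewrite {1}(prod_prime_decomp m0) prime_decompE big_map /=; apply: eq_big_seq => p.
  rewrite mem_primes => /and3P[p_pr _ pm]; rewrite (_ : logn p m = 1%N) ?expn1 //.
  apply/eqP; rewrite eqn_leq logn_gt0 mem_primes p_pr m0 pm /= andbT leqNgt -pfactor_dvdn //; apply/negP => p2m.
  have : (k * p <= k)%N by apply: maxk; rewrite gE expnMn [X in (X %| _)%N]mulnC dvdn_mul.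
  by rewrite -[X in (_ <= X)%N]muln1 leq_pmul2l // leqNgt prime_gt1.
apply: prod_primes_dvd; first exact: primes_uniq.
move=> p; rewrite mem_primes => /and3P[p_pr _ pm]; split=> //.
have : p \in \pi(g) by rewrite mem_primes p_pr g0 gE dvdn_mulr.
by have /andP[_ /allP H] := part_pnat \pi(q) n => /H; rewrite mem_primes => /and3P[].
Qed.

(** The discarded [n] are multiples of some [k^2] with [k > V], at most [N / V] in number, or of one
    of at most [V] divisors of [q] above [V^2], again at most [N / V]. *)
Lemma size_small_qpart q V N : (0 < q)%N -> (0 < V)%N -> (size (divisors q) <= V)%N ->
  (N * V <= size (small_qpart q (V ^ 4) N) * V + 2 * N)%N.
Proof.
move=> q0 V0 tauV; set I := small_qpart q (V ^ 4) N; set J := index_iota 1 N.+1.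
have sz : (N = size I + count (fun n => V ^ 4 < qpart q n)%N J)%N.
  have := count_predC (fun n => qpart q n <= V ^ 4)%N J.
  rewrite [size J]size_iota subn1 /= => <-; rewrite /I /small_qpart size_filter; congr addn.
  by apply: eq_count => n /=; rewrite -ltnNge.
set ds := [seq k ^ 2 | k <- index_iota V.+1 N.+1]%N ++ [seq m <- divisors q | V ^ 2 < m]%N.
have cnt : (count (fun n => V ^ 4 < qpart q n)%N J <= \sum_(d <- ds) N %/ d)%N.
  apply: leq_trans (@count_dvd_le ds J _ _) _ => [n n_in big_n|].
    have /andP[n0 nN] : (0 < n < N.+1)%N by move: n_in; rewrite mem_index_iota.
    apply/hasP; have [[k Vk kn]|[m [Vm mq mn]]] := large_qpart_divisor q0 V0 n0 big_n.
      exists (k ^ 2)%N => //; rewrite mem_cat; apply/orP; left; apply/mapP; exists k => //.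
      rewrite mem_index_iota Vk ltnS /=; apply: leq_ltn_trans nN; apply: leq_trans (dvdn_leq n0 kn).
      by rewrite -mulnn leq_pmulr // (leq_trans _ Vk).
    by exists m => //; rewrite mem_cat mem_filter Vm -dvdn_divisors // mq orbT.
  rewrite big_seq [X in (_ <= X)%N]big_seq; apply: leq_sum => d d_in.
  rewrite count_dvdn //; move: d_in; rewrite mem_cat => /orP[/mapP[k]|].
    by rewrite mem_index_iota => /andP[Vk _] ->; rewrite expn_gt0 (leq_trans _ Vk).
  by rewrite mem_filter => /andP[Vd _]; apply: leq_trans Vd.
have sq : (V * \sum_(k <- [seq k ^ 2 | k <- index_iota V.+1 N.+1]%N) N %/ k <= N)%N.
  by rewrite big_map sum_inv_sq_le.
have dv : (V * \sum_(m <- [seq m <- divisors q | V ^ 2 < m]%N) N %/ m <= N)%N.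
  rewrite -(leq_pmul2l V0) mulnA big_distrr /=.
  apply: leq_trans (_ : (size (divisors q) * N <= _)%N); last by rewrite leq_mul2r tauV orbT.
  apply: leq_trans (_ : (size [seq m <- divisors q | V ^ 2 < m]%N * N <= _)%N).
    apply: (@leq_trans (\sum_(m <- [seq m <- divisors q | V ^ 2 < m]%N) N)%N); last first.
      by rewrite big_const_seq count_predT iter_addn_0 mulnC.
    rewrite big_seq [X in (_ <= X)%N]big_seq; apply: leq_sum => m.
    rewrite mem_filter mulnn => /andP[Vm _]; apply: leq_trans (leq_mul (ltnW Vm) (leqnn _)) _.
    by rewrite mulnC leq_divM.
  rewrite leq_mul2r size_filter count_size orbT //.
rewrite {1}sz mulnDl leq_add2l [X in (X <= _)%N]mulnC; apply: leq_trans (leq_mul (leqnn V) cnt) _.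
by rewrite big_cat mulnDr mul2n -addnn leq_add.
Qed.

(** Take the largest divisor [d <= Y] of [n], then the largest divisor [e <= Y] of [n / d]. If the
    cofactor exceeded [Y], then [n <= Y^2] would force [d * e <= Y]; as [e > 1] by smoothness, this
    contradicts the choice of [d]. *)
Lemma smooth_split Y n : (0 < n)%N -> (n <= Y ^ 2)%N ->
  (forall p, prime p -> (p %| n)%N -> (p <= Y)%N) ->
  exists b1 b2 b3, [/\ (0 < b1 <= Y)%N, (0 < b2 <= Y)%N, (0 < b3 <= Y)%N & (b1 * (b2 * b3) = n)%N].
Proof.
move=> n0 nY smooth.
have Y0 : (0 < Y)%N by move: nY; case: Y {smooth} => //; rewrite leqNgt n0.
have max_div m : (0 < m)%N -> exists d, [/\ (d %| m)%N, (0 < d <= Y)%N &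
    forall d', (d' %| m)%N -> (d' <= Y)%N -> (d' <= d)%N].
  move=> m0; have ex : exists d, (d %| m)%N && (d <= Y)%N by exists 1%N; rewrite dvd1n.
  have ub d : (d %| m)%N && (d <= Y)%N -> (d <= Y)%N by case/andP.
  case: (ex_maxnP ex ub) => d /andP[dm dY] maxd; exists d; split => //; first by rewrite dY (dvdn_gt0 m0).
  by move=> d' d'm d'Y; apply: maxd; rewrite d'm.
have [d [dn /andP[d0 dY] maxd]] := max_div n n0.
set m := (n %/ d)%N; have nE : n = (d * m)%N by rewrite mulnC divnK.
have m0 : (0 < m)%N by move: n0; rewrite nE muln_gt0 => /andP[].
have [mY|Ym] := leqP m Y; first by exists d, m, 1%N; rewrite d0 dY m0 mY Y0 muln1.
have [e [em /andP[e0 eY] maxe]] := max_div m m0.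
set m' := (m %/ e)%N; have mE : m = (e * m')%N by rewrite mulnC divnK.
have m'0 : (0 < m')%N by move: m0; rewrite mE muln_gt0 => /andP[].
have [m'Y|Ym'] := leqP m' Y; first by exists d, e, m'; rewrite d0 dY e0 eY m'0 m'Y -mE nE.
have e2 : (1 < e)%N.
  have m1 : (1 < m)%N by apply: leq_ltn_trans Ym.
  apply: leq_trans (prime_gt1 (pdiv_prime m1)) _; apply: maxe; first exact: pdiv_dvd.
  by apply: smooth; [exact: pdiv_prime|rewrite nE dvdn_mull ?pdiv_dvd].
have deY : (d * e <= Y)%N.
  rewrite leqNgt; apply/negP => Yde; move: nY; rewrite leqNgt => /negP; apply.
  by rewrite nE mE mulnA -mulnn ltn_mul.
have : (d * e <= d)%N by apply: maxd => //; rewrite nE mE mulnA dvdn_mulr.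
by rewrite -[X in (_ <= X)%N]muln1 leq_pmul2l // leqNgt e2.
Qed.

(** If no bin could take [z], every [b * z] would exceed [Y], and the product of the bins times
    [Zm ^ size bs] would exceed [Y ^ size bs]. The slack [Zm ^ size bs] excludes this, and putting
    [z] into a bin preserves the hypothesis. *)
Lemma greedy_bins Y Zm zs : (0 < Y)%N -> all (fun z => 0 < z <= Zm)%N zs -> forall bs : seq nat,
  all (fun b => 0 < b <= Y)%N bs -> (0 < size bs)%N ->
  ((\prod_(b <- bs) b) * (\prod_(z <- zs) z) * Zm ^ size bs <= Y ^ size bs)%N ->
  exists bs', [/\ size bs' = size bs, all (fun b => 0 < b <= Y)%N bs' &
    (\prod_(b <- bs') b = (\prod_(b <- bs) b) * (\prod_(z <- zs) z))%N].
Proof.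
move=> Y0; elim: zs => [|z zs IH] /= => [_ bs bsY sz _|/andP[/andP[z0 zZ] zsZ] bs bsY sz H].
  by exists bs; rewrite big_nil muln1.
have P0 : (0 < \prod_(z <- zs) z)%N.
  by rewrite big_seq prodn_cond_gt0 // => x /(allP zsZ)/andP[].
have hasfit : has (fun b => b * z <= Y)%N bs.
  apply: contraT; rewrite -all_predC => /allP nofit.
  have {}nofit x : x \in bs -> (Y < x * z)%N by move=> /nofit; rewrite /= -ltnNge.
  have lt : (Y ^ size bs < (\prod_(b <- bs) b) * z ^ size bs)%N.
    elim: (bs) sz nofit => // b s IHs _ Hb; have hb := Hb b (mem_head _ _).
    case: s IHs Hb => [|b' s'] IHs Hb; first by rewrite big_seq1 !expn1.
    rewrite big_cons (_ : size (b :: _) = (size (b' :: s')).+1) // (expnS Y (size (b' :: s'))) (expnS z (size (b' :: s'))) mulnACA.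
    by rewrite ltn_mul // IHs // => x xs; apply: Hb; rewrite in_cons xs orbT.
  have : (\prod_(b <- bs) b * z ^ size bs <= Y ^ size bs)%N.
    apply: leq_trans H; rewrite big_cons; apply: leq_mul; last by rewrite leq_exp2r.
    by rewrite leq_pmulr // muln_gt0 z0.
  by rewrite leqNgt lt.
have /hasP[b b_in bz] := hasfit.
have [|||bs' [sz' bsY' E']] := IH zsZ ((b * z)%N :: rem b bs).
- rewrite /= bz andbT muln_gt0 z0 andbT; have /andP[-> _] /= := allP bsY _ b_in.
  by apply/allP => x /mem_rem; apply: (allP bsY).
- by [].
- rewrite /= size_rem // prednK // big_cons; apply: leq_trans H.
  by rewrite [in leqRHS](big_rem b b_in) /= big_cons; apply: eq_leq; ring.
exists bs'; split=> //; first by rewrite sz' /= size_rem // prednK.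
by rewrite E' [in RHS](big_rem b b_in) !big_cons /=; ring.
Qed.

(** * The main counting argument *)

(* Either [z i] is at most [zeta / A], which gains a factor [A] over the second moments, or it is
   larger, which by the last moment is rare enough for the bound on [S] alone to suffice. *)
Lemma large_small_split (J : finType) (P : pred J) (F S z : J -> algC) (nI N zeta A W : algC) K H :
  (forall i, 0 <= F i) -> (forall i, 0 <= S i) -> (forall i, 0 <= z i) ->
  0 <= nI -> 0 <= N -> 0 <= zeta -> 0 <= A -> 0 <= W ->
  (forall i, F i <= nI) -> (forall i, P i -> S i * W <= N) -> (forall i, z i <= zeta) ->
  (\sum_(i | P i) F i * S i * z i ^+ (2 * K).+1) * (A * zeta ^+ (2 * H).+1 * W) <=
  (\sum_i (F i ^+ 2 + S i ^+ 2) * z i ^+ (2 * K)) * (zeta ^+ (2 * H).+2 * W) +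
  nI * N * (\sum_i z i ^+ (2 * (K + H).+1)) * A ^+ (2 * (K + H).+1).+1.
Proof.
move=> F0 S0 z0 nI0 N0 zeta0 A0 W0 FnI SW zzeta.
have term1_ge0 i : 0 <= (F i ^+ 2 + S i ^+ 2) * z i ^+ (2 * K) * (zeta ^+ (2 * H).+2 * W).
  by rewrite mulr_ge0 // mulr_ge0 ?addr_ge0 ?exprn_ge0.
have term2_ge0 i : 0 <= nI * N * z i ^+ (2 * (K + H).+1) * A ^+ (2 * (K + H).+1).+1.
  by rewrite mulr_ge0 ?exprn_ge0 // mulr_ge0 ?exprn_ge0 // mulr_ge0.
rewrite !mulr_suml mulr_sumr mulr_suml -big_split [leRHS](bigID P) /=.
apply: ler_wpDr; first by apply: sumr_ge0 => i _; rewrite addr_ge0.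
apply: ler_sum => i Pi.
have FS : F i * S i <= F i ^+ 2 + S i ^+ 2.
  have /orP[le|le] := real_leVge (ger0_real (F0 i)) (ger0_real (S0 i)).
    by apply: ler_wpDl; rewrite ?exprn_ge0 // expr2 ler_wpM2r.
  by apply: ler_wpDr; rewrite ?exprn_ge0 // expr2 ler_wpM2l.
have /orP[small|large] := real_leVge (ger0_real (mulr_ge0 (z0 i) A0)) (ger0_real zeta0).
  apply: ler_wpDr => //.
  have -> : F i * S i * z i ^+ (2 * K).+1 * (A * zeta ^+ (2 * H).+1 * W) =
      (F i * S i) * (z i ^+ (2 * K) * ((z i * A) * (zeta ^+ (2 * H).+1 * W))).
    by rewrite exprSr; ring.
  rewrite (exprS zeta (2 * H).+1) -[leRHS]mulrA -[zeta * _ * W]mulrA.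
  have pos : 0 <= zeta ^+ (2 * H).+1 * W by rewrite mulr_ge0 ?exprn_ge0.
  by apply: ler_pM; rewrite ?mulr_ge0 ?exprn_ge0 // ler_wpM2l ?exprn_ge0 // ler_wpM2r.
apply: ler_wpDl => //.
apply: (@le_trans _ _ (nI * (S i * W) * A * zeta ^+ (2 * (K + H).+1))).
  have -> : (2 * (K + H).+1 = (2 * K).+1 + (2 * H).+1)%N by lia.
  rewrite exprD.
  have -> : F i * S i * z i ^+ (2 * K).+1 * (A * zeta ^+ (2 * H).+1 * W) =
     F i * (S i * W * A * zeta ^+ (2 * H).+1) * z i ^+ (2 * K).+1 by ring.
  have -> : nI * (S i * W) * A * (zeta ^+ (2 * K).+1 * zeta ^+ (2 * H).+1) =
     nI * (S i * W * A * zeta ^+ (2 * H).+1) * zeta ^+ (2 * K).+1 by ring.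
  have pos : 0 <= S i * W * A * zeta ^+ (2 * H).+1 by rewrite !mulr_ge0 ?exprn_ge0.
  apply: ler_pM; rewrite ?mulr_ge0 ?exprn_ge0 //; first by rewrite ler_wpM2r.
  by rewrite lerXn2r ?nnegrE.
set m := (2 * (K + H).+1)%N.
have -> : nI * N * z i ^+ m * A ^+ m.+1 = nI * (N * A * (z i * A) ^+ m).
  by rewrite exprMn exprS; ring.
have -> : nI * (S i * W) * A * zeta ^+ m = nI * (S i * W * A * zeta ^+ m) by ring.
rewrite ler_wpM2l //.
apply: ler_pM; rewrite ?mulr_ge0 ?exprn_ge0 //; first by rewrite ler_wpM2r // SW.
by rewrite lerXn2r ?nnegrE ?mulr_ge0.
Qed.

Section WeightedMoment.
Variables (q k : nat) (X : 'I_k.+1 -> nat -> algC) (zs : seq nat) (Z : nat).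
Hypotheses (q_gt0 : (0 < q)%N) (X_char : forall i, dchar q (X i)).
Hypothesis X_orth : forall m n, coprime m q -> coprime n q ->
  \sum_i X i m * (X i n)^* = (totient q)%:R *+ (m == n %[mod q]).
Hypothesis zs_le : {in zs, forall z, (0 < z <= Z)%N}.
Hypothesis zs_coprime : {in zs, forall z, coprime z q}.

Lemma sum_pairs_factor (I : seq nat) (f : nat -> algC) (h : nat -> nat) K i :
  \sum_(t <- [seq (n, w) | n <- I, w <- product_list zs K]) f t.1 * X i (h t.1 * t.2)%N =
  (\sum_(n <- I) f n * X i (h n)) * (\sum_(z <- zs) X i z) ^+ K.
Proof.
have [X1 XM _ _] := X_char i; rewrite big_allpairs_dep /= -(sum_product_list _ _ X1 XM) mulr_suml.
apply: eq_bigr => n _; rewrite mulr_sumr; apply: eq_bigr => w _.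
by rewrite XM mulrA.
Qed.

Lemma weighted_moment (I : seq nat) (f : nat -> algC) (h : nat -> nat) c0 C0 M K :
  (forall n, `|f n| <= 1) -> {in I, forall n, coprime (h n) q} ->
  (forall v, (0 < v <= M)%N -> (count (fun z => z %| v)%N zs <= c0)%N) ->
  {in I, forall n, (0 < h n)%N /\ (h n * Z ^ K <= M)%N} ->
  (forall v, (count (fun n => h n == v) I <= C0)%N) ->
  \sum_i `|\sum_(n <- I) f n * X i (h n)| ^+ 2 * `|\sum_(z <- zs) X i z| ^+ (2 * K) <=
  (totient q * (size I * size zs ^ K * ((M %/ q).+1 * (c0 ^ K * C0))))%N%:R.
Proof.
move=> f1 co_h zdiv hM cnt.
under eq_bigr => i _ do rewrite [(2 * K)%N]mulnC exprM -exprMn -normrX -normrM -sum_pairs_factor.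
rewrite -(size_product_list zs K) -(size_allpairs pair).
apply: (second_moment_bound X_orth (f := fun t => f t.1)
   (h := fun t => (h t.1 * t.2)%N)) => [t|t|t t_in] //.
  move=> /allpairsP[[n w] /= [n_in w_in ->]].
  by rewrite coprimeMl co_h // (product_list_coprime zs_coprime w_in).
apply: class_count_le => // [t' /allpairsP[[n w] /= [n_in w_in ->]]|]; last first.
  exact: (product_list_count zs_le zdiv hM cnt).
have [_ leM] := hM n n_in; apply: leq_trans leM; rewrite leq_mul2l; apply/orP; right.
by have /andP[] := product_list_le zs_le w_in.
Qed.
End WeightedMoment.

Section Core.
Variables (q a N Y V u c c0 K H M : nat) (zs : seq nat).
Let Z := (V ^ u)%N.
Let K2 := (K + H).+1.
(** The exponents are matched to [large_small_split] with [A = V^th] and [W = V^rho]. There the left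
    side carries [V^(th + rho)]; the second moments lose [V^(K + 4)] and the last moment [V^K2],
    which puts [V^(th + rho - 1)] into both terms on the right. The spare [V] beats the constants by
    [V_big]. *)
Let th := (K + 5)%N.
Let rho := (1 + K2 + 2 * (K2 * th))%N.
Hypotheses (q_gt1 : (1 < q)%N) (co_a : coprime a q) (c_gt0 : (0 < c)%N) (c0_gt0 : (0 < c0)%N).
Hypotheses (N_gt0 : (0 < N)%N) (V_gt0 : (0 < V)%N) (u_gt0 : (0 < u)%N).
Hypothesis burgess : forall chi, dchar q chi -> (exists2 n, coprime n q & chi n != 1) ->
  forall m, (m <= N)%N -> `|psum chi m| * (V ^ (rho + 4))%N%:R <= N%:R.
Hypotheses (qV : (V ^ (K2 * u) <= q)%N) (Vq : (q <= (2 * V) ^ (K2 * u))%N).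
Hypotheses (NV_M : (N * V ^ (K * u) <= M)%N) (V_M : (V ^ (K2 * u) <= M)%N).
Hypotheses (M_lt : (M < (V ^ u.-1) ^ c0)%N) (q_NV : (q <= N * V ^ (K * u))%N).
Hypothesis V_big : (c * (4 * c0 ^ K + 2 * (c0 ^ K2 * 2 ^ (K2 * u))) < V)%N.
Hypothesis tau : (size (divisors q) <= V)%N.
Hypotheses (uniq_zs : uniq zs) (size_zs : (V ^ u.-1 <= size zs)%N).
Hypothesis zsP : {in zs, forall z, [/\ prime z, coprime z q, (V ^ u.-1 < z)%N & (z <= Z)%N]}.
Hypothesis bad_sum : (c * (2 * \sum_(Y.+1 <= p < N.+1 | prime p) N %/ p) + 3 * N <= c * N)%N.
Hypothesis V_Y : (V ^ 4 <= Y)%N.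
Hypothesis N_Y : (N <= Y ^ 2)%N.
Hypothesis bins : (N ^ 2 * Z ^ (2 * K).+1 * Z ^ 14 <= Y ^ 14)%N.

Let q_gt0 := ltnW q_gt1.
Let I := small_qpart q (V ^ 4) N.
Let bad n := has (fun p => p %| n)%N [seq p <- index_iota Y.+1 N.+1 | prime p].
Let zeta := size zs.
Let Y_gt0 : (0 < Y)%N. Proof. by apply: leq_trans V_Y; rewrite expn_gt0 V_gt0. Qed.
Let zs_le : {in zs, forall z, (0 < z <= Z)%N}.
Proof. by move=> z /zsP[z_pr _ _ ->]; rewrite prime_gt0. Qed.
Let zs_co : {in zs, forall z, coprime z q}.
Proof. by move=> z /zsP[]. Qed.
Let inI n : n \in I -> [/\ (0 < n)%N, (n <= N)%N & (qpart q n <= V ^ 4)%N].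
Proof. by rewrite mem_filter mem_index_iota => /and3P[-> ->]. Qed.

Lemma good_solution n1 n2 w : n1 \in I -> n2 \in I -> ~~ bad n1 -> ~~ bad n2 ->
  w \in product_list zs (2 * K).+1 ->
  exists bs, [/\ size bs = 14, all (fun b => 0 < b <= Y)%N bs &
    (\prod_(b <- bs) b = cpart q n1 * (cpart q n2 * w))%N].
Proof.
have split3 n : n \in I -> ~~ bad n -> exists b1 b2 b3, [/\ (0 < b1 <= Y)%N, (0 < b2 <= Y)%N,
    (0 < b3 <= Y)%N & (b1 * (b2 * b3) = cpart q n)%N].
  move=> /inI[n0 nN _] good; have c_le := cpart_le q n0; apply: smooth_split; first exact: part_gt0.
    by apply: leq_trans c_le (leq_trans nN N_Y).
  move=> p p_pr pn; rewrite leqNgt; apply/negP => Yp; case/negP: good; apply/hasP; exists p; last first.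
    by apply: dvdn_trans pn _; apply: dvdn_part.
  rewrite mem_filter p_pr mem_index_iota Yp ltnS; apply: leq_trans (leq_trans c_le nN).
  by apply: dvdn_leq pn; apply: part_gt0.
move=> n1I n2I good1 good2 /product_listP[ss [sz ss_in ->]].
have [b1 [b2 [b3 [h1 h2 h3 E1]]]] := split3 n1 n1I good1.
have [b4 [b5 [b6 [h4 h5 h6 E2]]]] := split3 n2 n2I good2.
(* Three factors from each of [n1] and [n2], and eight bins that start at 1; the small primes are
   then distributed over all fourteen. *)
pose bs := [:: b1; b2; b3; b4; b5; b6] ++ nseq 8 1%N.
have sz_bs : size bs = 14 by [].
have bsE : (\prod_(b <- bs) b = cpart q n1 * cpart q n2)%N.
  by rewrite /bs !big_cons big_nil -E1 -E2; ring.
have ss_le : all (fun z => 0 < z <= Z)%N ss by apply/allP => z z_in; apply: zs_le; apply: (allP ss_in).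
have ss_prod : (\prod_(z <- ss) z <= Z ^ (2 * K).+1)%N.
  rewrite -sz; elim: (ss) ss_le => [|z s IH] /=; first by rewrite big_nil.
  by case/andP=> /andP[_ zZ] /IH {}IH; rewrite big_cons expnS leq_mul.
have [|||bs' [sz' bs'Y E']] := @greedy_bins Y Z ss Y_gt0 ss_le bs.
- by rewrite all_cat all_nseq /= h1 h2 h3 h4 h5 h6 Y_gt0.
- by [].
- rewrite sz_bs; apply: leq_trans bins; rewrite leq_mul2r; apply/orP; right; apply: leq_mul => //.
  have [n10 n1N _] := inI n1I; have [n20 n2N _] := inI n2I.
  by rewrite bsE -mulnn leq_mul // (leq_trans (cpart_le _ _)).
by exists bs'; split; rewrite // E' bsE mulnA.
Qed.

Let zdiv v : (0 < v <= M)%N -> (count (fun z => z %| v)%N zs <= c0)%N.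
Proof.
move=> /andP[v0 vM]; rewrite -size_filter; set s := [seq z <- zs | _].
have s_dvd : (\prod_(z <- s) z %| v)%N.
  apply: prod_primes_dvd; first exact: filter_uniq.
  by move=> z; rewrite mem_filter => /andP[zv /zsP[]].
have V1 : (1 < V ^ u.-1)%N.
  rewrite ltnNge; apply/negP => le1; move: M_lt; rewrite ltnNge => /negP; apply.
  apply: (@leq_trans 1%N); first by rewrite -(exp1n c0) leq_exp2r.
  by apply: leq_trans vM.
rewrite -ltnS -(ltn_exp2l _ _ V1); apply: leq_ltn_trans (_ : (v < _)%N); last first.
  by apply: leq_ltn_trans vM (leq_trans M_lt _); rewrite leq_exp2l.
apply: leq_trans (dvdn_leq v0 s_dvd).
have : all (fun z => V ^ u.-1 <= z)%N s by apply/allP => z; rewrite mem_filter => /andP[_ /zsP[_ _ /ltnW]].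
elim: (s) => [|z s' IH] /=; first by rewrite big_nil.
by case/andP=> Vz /IH {}IH; rewrite big_cons expnS leq_mul.
Qed.

(* The weight [f n1 + f n2] is positive only if neither [n1] nor [n2] is bad, and every product of
   character sums that it produces contains a complete sum over [I], where Burgess applies. *)
Let f n : algC := if bad n then -1 else 1.
Let f1 n : `|f n| <= 1. Proof. by rewrite /f; case: ifP; rewrite ?normrN normr1. Qed.

(** The sum is the size of [I] minus twice the number of bad members. Of the [3 * N] in [bad_sum],
    two parts pay for the integers missing from [I], as [c <= V], and one remains. *)
Let sum_f_ge : (N%:R : algC) <= c%:R * \sum_(n <- I) f n.
Proof.
have -> : \sum_(n <- I) f n = (size I)%:R - (2 * count bad I)%N%:R.
  elim: (I) => [|n s IH]; first by rewrite big_nil subrr.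
  rewrite big_cons IH /f /= mulnDr natrD; case: (bad n) => /=; rewrite -[(size s).+1]add1n natrD.
    by rewrite (_ : (2 * 1)%N%:R = 2%:R :> algC) //; ring.
  by rewrite muln0 add0r addrA.
have cnt_bad : (count bad I <= \sum_(Y.+1 <= p < N.+1 | prime p) N %/ p)%N.
  apply: leq_trans (count_dvd_le (ds := [seq p <- index_iota Y.+1 N.+1 | prime p]) (P := bad) _) _; first by [].
  rewrite big_filter big_mkcond [X in (_ <= X)%N]big_mkcond; apply: leq_sum => p _.
  case: ifP => // p_pr; rewrite -count_dvdn ?prime_gt0 //.
  by rewrite /I /small_qpart count_filter; apply: sub_count => n /= /andP[].
have szI := size_small_qpart N q_gt0 V_gt0 tau; rewrite -/I in szI.
have cV : (c <= V)%N.
  apply: leq_trans (ltnW V_big); rewrite leq_pmulr // addn_gt0 muln_gt0 expn_gt0 c0_gt0 //.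
rewrite mulrBr -!natrM lerBrDr -natrD ler_nat.
have : (c * N <= c * size I + 2 * N)%N.
  rewrite -(leq_pmul2l V_gt0); apply: (@leq_trans (c * (N * V))%N); first by apply: eq_leq; ring.
  apply: leq_trans (leq_mul (leqnn c) szI) _.
  apply: (@leq_trans (c * (size I * V) + 2 * (N * V))%N); last by apply: eq_leq; ring.
  rewrite mulnDr leq_add2l (mulnCA c 2) leq_mul2l mulnC leq_mul2l; apply/orP; right; exact/orP/or_intror.
have : (c * (2 * count bad I) <= c * (2 * \sum_(Y.+1 <= p < N.+1 | prime p) N %/ p))%N.
  by rewrite leq_mul2l leq_mul2l cnt_bad !orbT.
move: bad_sum; set b := (\sum_(_ <= _ < _ | _) _)%N.
have arith (w x y z n : nat) : (x <= w -> z <= y + 2 * n -> w + 3 * n <= z -> n + x <= y)%N by clear; lia.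
by move=> h1 h2 h3; apply: arith h2 h3 h1.
Qed.

Let zeta_gt0 : (0 < zeta)%N.
Proof. by apply: leq_trans size_zs; rewrite expn_gt0 V_gt0. Qed.

(** At least [V^(u - 1)] primes are available up to [V^u], so replacing [V^u] by [zeta] loses one
    factor [V] for each prime. *)
Let powers_le j : (V ^ (j * u) <= V ^ j * zeta ^ j)%N.
Proof.
case: j => [|j]; first by rewrite !expn0.
rewrite mulnC expnM -expnMn leq_exp2r //.
by rewrite -[X in (V ^ X)%N](prednK u_gt0) expnS leq_mul2l size_zs orbT.
Qed.

Let totient_le_q : (totient q <= q)%N.
Proof.
rewrite totient_count_coprime -[X in (_ <= X)%N]card_ord -sum1_card big_mkord.
by apply: leq_sum => i _; case: coprime.
Qed.

Let totient_mul_le m : (totient q * (m %/ q).+1 <= m + q)%N.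
Proof.
apply: leq_trans (leq_mul totient_le_q (leqnn _)) _.
by rewrite mulnS addnC leq_add2r mulnC leq_divM.
Qed.

Let first_moment_nat nI :
  (totient q * (nI * zeta ^ K * ((N * V ^ (K * u) %/ q).+1 * (c0 ^ K * V ^ 4))) <=
   2 * c0 ^ K * (nI * N * zeta ^ (2 * K)) * V ^ (K + 4))%N.
Proof.
apply: (@leq_trans (2 * (N * (V ^ K * zeta ^ K)) * (nI * zeta ^ K * (c0 ^ K * V ^ 4)))%N); last first.
  rewrite expnD (_ : (2 * K = K + K)%N); last by rewrite mul2n addnn.
  rewrite expnD; apply: eq_leq; move: (zeta ^ K)%N (V ^ K)%N (c0 ^ K)%N (V ^ 4)%N => x y z t; ring.
have -> : (totient q * (nI * zeta ^ K * ((N * V ^ (K * u) %/ q).+1 * (c0 ^ K * V ^ 4))) =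
   (totient q * (N * V ^ (K * u) %/ q).+1) * (nI * zeta ^ K * (c0 ^ K * V ^ 4)))%N.
  by move: (_ %/ _)%N.+1 (zeta ^ K)%N (c0 ^ K)%N (V ^ 4)%N (totient q) => x y z t w; ring.
rewrite leq_mul2r; apply/orP; right; apply: leq_trans (totient_mul_le _) _.
apply: (@leq_trans (2 * (N * V ^ (K * u)))%N).
  by rewrite [X in (_ <= X)%N]mul2n -addnn leq_add2l.
by rewrite !leq_mul2l powers_le !orbT.
Qed.

Let last_moment_nat :
  (totient q * (1 * zeta ^ K2 * ((V ^ (K2 * u) %/ q).+1 * (c0 ^ K2 * 1))) <=
   2 * (c0 ^ K2 * 2 ^ (K2 * u)) * zeta ^ (2 * K2) * V ^ K2)%N.
Proof.
apply: (@leq_trans (2 * (2 ^ (K2 * u) * (V ^ K2 * zeta ^ K2)) * (zeta ^ K2 * c0 ^ K2))%N); last first.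
  rewrite (_ : (2 * K2 = K2 + K2)%N); last by rewrite mul2n addnn.
  rewrite expnD; apply: eq_leq; move: (zeta ^ K2)%N (V ^ K2)%N (c0 ^ K2)%N (2 ^ _)%N => x y z t; ring.
have -> : (totient q * (1 * zeta ^ K2 * ((V ^ (K2 * u) %/ q).+1 * (c0 ^ K2 * 1))) =
   (totient q * (V ^ (K2 * u) %/ q).+1) * (zeta ^ K2 * c0 ^ K2))%N.
  by move: (_ %/ _)%N.+1 (zeta ^ K2)%N (c0 ^ K2)%N (totient q) => x y z w; ring.
rewrite leq_mul2r; apply/orP; right; apply: leq_trans (totient_mul_le _) _.
apply: (@leq_trans (2 * q)%N); first by rewrite [X in (_ <= X)%N]mul2n -addnn leq_add2r.
rewrite leq_mul2l; apply/orP; right; apply: leq_trans Vq _.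
by rewrite expnMn leq_mul2l powers_le orbT.
Qed.

Let final_contradiction nI : (0 < nI)%N ->
  ((N * nI * zeta ^ (2 * K).+1) * (V ^ th * zeta ^ (2 * H).+1 * V ^ rho) <=
   c * (2 * (2 * c0 ^ K * (nI * N * zeta ^ (2 * K)) * V ^ (K + 4)) * (zeta ^ (2 * H).+2 * V ^ rho) +
     nI * N * (2 * (c0 ^ K2 * 2 ^ (K2 * u)) * zeta ^ (2 * K2) * V ^ K2) * (V ^ th) ^ (2 * K2).+1))%N -> False.
Proof.
move=> nI0; apply/negP; rewrite -ltnNge.
set x := (nI * N * zeta ^ (2 * K2))%N; have x0 : (0 < x)%N by rewrite !muln_gt0 nI0 N_gt0 expn_gt0 zeta_gt0.
set P := (V ^ (th + rho).-1)%N; have P0 : (0 < P)%N by rewrite expn_gt0 V_gt0.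
have zz : (zeta ^ (2 * K2) = zeta ^ (2 * K) * zeta ^ (2 * H).+2)%N.
  by rewrite -expnD /K2; congr (_ ^ _)%N; clear; lia.
have zz' : (zeta ^ (2 * K2) = zeta ^ (2 * K).+1 * zeta ^ (2 * H).+1)%N.
  by rewrite -expnD /K2; congr (_ ^ _)%N; clear; lia.
have E1 : (N * nI * zeta ^ (2 * K).+1 * (V ^ th * zeta ^ (2 * H).+1 * V ^ rho) = V * P * x)%N.
  have -> : (V * P = V ^ th * V ^ rho)%N by rewrite /P -expnS -expnD prednK // /th !addnS.
  rewrite /x zz'; move: (zeta ^ _)%N (zeta ^ _)%N (V ^ th)%N (V ^ rho)%N => e g h l; ring.
have E2 : (V ^ (K + 4) * V ^ rho = P)%N.
  by rewrite -expnD /P /th (addnS K 4) addSn.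
have E3 : (V ^ K2 * (V ^ th) ^ (2 * K2).+1 = P)%N.
  have arith (m n : nat) : (n + m * (2 * n).+1 = (m + (1 + n + 2 * (n * m))).-1)%N.
    by clear; rewrite mulnS mulnCA [(m * n)%N]mulnC; lia.
  by rewrite -expnM -expnD /P /rho arith.
have -> : (c * (2 * (2 * c0 ^ K * (nI * N * zeta ^ (2 * K)) * V ^ (K + 4)) * (zeta ^ (2 * H).+2 * V ^ rho) +
     nI * N * (2 * (c0 ^ K2 * 2 ^ (K2 * u)) * zeta ^ (2 * K2) * V ^ K2) * (V ^ th) ^ (2 * K2).+1) =
   c * (4 * c0 ^ K + 2 * (c0 ^ K2 * 2 ^ (K2 * u))) * P * x)%N.
  rewrite [in RHS]mulnDr 2![in RHS]mulnDl [in LHS]mulnDr; congr addn.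
    rewrite -E2 /x zz.
    by move: (c0 ^ K)%N (zeta ^ _)%N (zeta ^ _)%N (V ^ _)%N (V ^ _)%N => e g h l m; ring.
  rewrite -E3 /x.
  by move: (c0 ^ K2)%N (2 ^ _)%N (zeta ^ _)%N (V ^ K2)%N (_ ^ _)%N => e g h l m; ring.
by rewrite E1 ltn_pmul2r // ltn_pmul2r.
Qed.

Theorem core_solution : exists bs, [/\ size bs = 14, all (fun b => 0 < b <= Y)%N bs &
  \prod_(b <- bs) b = a %[mod q]].
Proof.
have [k [X [Xc X0 Xn Xo]]] := character_family q_gt1.
pose S (g : nat -> algC) i := \sum_(n <- I) g n * X i (cpart q n).
pose zz i := \sum_(z <- zs) X i z.
pose e (t : nat * (nat * nat)) := (cpart q t.1 * (cpart q t.2.1 * t.2.2))%N.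
pose tr := [seq (n, t) | n <- I, t <- [seq (n', w) | n' <- I, w <- product_list zs (2 * K).+1]].
have factor g1 g2 i : \sum_(t <- tr) (g1 t.1 * g2 t.2.1) * X i (e t) = S g1 i * (S g2 i * zz i ^+ (2 * K).+1).
  have [_ XM _ _] := Xc i.
  rewrite /tr big_allpairs_dep /= mulr_suml; apply: eq_bigr => n _.
  rewrite -(sum_pairs_factor _ Xc) mulr_sumr; apply: eq_bigr => t _.
  by rewrite /e XM; ring.
have co_tr : {in tr, forall t, coprime (e t) q}.
  move=> _ /allpairsP[[n [n' w]] /= [n_in /allpairsP[[n1 w1] /= [n1_in w1_in [-> ->]]] ->]].
  by rewrite /e /= !coprimeMl !cpart_coprime // (product_list_coprime (K := (2 * K).+1) zs_co w1_in).
apply: boolp.contrapT => no_sol.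
pose one (n : nat) : algC := 1.
pose g (t : nat * (nat * nat)) : algC := f t.1 * one t.2.1 + one t.1 * f t.2.1.
(* Without a solution, every term whose product is congruent to [a] has a bad [n1] or [n2], hence
   weight at most 0. The two halves of the weight yield equal character sums, so one of them
   suffices. *)
have nonpos : \sum_i S f i * (S one i * zz i ^+ (2 * K).+1) * (X i a)^* <= 0.
  have count_nonpos : \sum_i (\sum_(t <- tr) g t * X i (e t)) * (X i a)^* <= 0.
    rewrite (orthogonality_count Xo) // mulr_ge0_le0 ?ler0n //.
    rewrite big_seq_cond; apply: sumr_le0 => t /andP[t_in /eqP Ea].
    move: t_in Ea => /allpairsP[[n [n' w]] /= [n_in /allpairsP[[n1 w1] /= [n1_in w1_in [-> ->]]] ->]].
    rewrite /g /one /f /= mulr1 mul1r => Ea.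
    case bn: (bad n); case bn1: (bad n1); rewrite ?subrr ?addNr ?addrN //.
      by rewrite -opprD oppr_le0 addr_ge0.
    have [bs [sz bsY bsE]] := good_solution n_in n1_in (negbT bn) (negbT bn1) w1_in.
    by case: no_sol; exists bs; split; rewrite // bsE.
  have E i : \sum_(t <- tr) g t * X i (e t) = (S f i * (S one i * zz i ^+ (2 * K).+1)) *+ 2.
    rewrite mulr2n -{1}factor [X in _ + X]mulrCA -factor -big_split; apply: eq_bigr => t _ /=.
    by rewrite -mulrDl.
  move: count_nonpos; under eq_bigr do rewrite E mulrnAl.
  by rewrite sumrMnl pmulrn_lle0.
set nI := size I.
have S_one0 : S one ord0 = nI%:R.
  rewrite /S (eq_bigr (fun=> 1)) => [|n _]; last by rewrite X0 ?mulr1 // cpart_coprime.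
  by rewrite big_const_seq count_predT iter_addr_0.
have zz0 : zz ord0 = zeta%:R.
  rewrite /zz (eq_big_seq (fun=> 1)) => [|z z_in]; last by rewrite X0 ?zs_co.
  by rewrite big_const_seq count_predT iter_addr_0.
have S_f0 : S f ord0 = \sum_(n <- I) f n.
  by apply: eq_bigr => n _; rewrite X0 ?mulr1 // cpart_coprime.
have norm_sum_le (h : nat -> algC) i : (forall n, `|h n| <= 1) -> `|S h i| <= nI%:R.
  move=> h1; apply: le_trans (ler_norm_sum _ _ _) _.
  apply: (@le_trans _ _ (\sum_(n <- I) 1)).
    apply: ler_sum => n _; rewrite normrM -[leRHS]mulr1.
    by apply: ler_pM; rewrite ?normr_ge0 // (dchar_norm_le1 q_gt0 (Xc i)).
  by rewrite big_const_seq count_predT iter_addr_0.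
have one1 n : `|one n| <= 1 by rewrite normr1.
have z_le i : `|zz i| <= zeta%:R.
  apply: le_trans (ler_norm_sum _ _ _) _; apply: (@le_trans _ _ (\sum_(z <- zs) 1)).
    by apply: ler_sum => z _; apply: (dchar_norm_le1 q_gt0 (Xc i)).
  by rewrite big_const_seq count_predT iter_addr_0.
have sum_f0 : 0 <= \sum_(n <- I) f n.
  have c0R : 0 < c%:R :> algC by rewrite ltr0n.
  by rewrite -(pmulr_rge0 _ c0R); apply: le_trans sum_f_ge; rewrite ler0n.
have nI0 : (0 < nI)%N.
  rewrite lt0n; apply/negP => /eqP /size0nil I0; move: sum_f_ge.
  by rewrite I0 big_nil mulr0 -[0]/(0%:R) ler_nat leqNgt N_gt0.
pose Err := \sum_(i | i != ord0) `|S f i| * `|S one i| * `|zz i| ^+ (2 * K).+1.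
have main_le : (\sum_(n <- I) f n) * (nI%:R * zeta%:R ^+ (2 * K).+1) <= Err.
  set main := (X in X <= _); have main0 : 0 <= main.
    by rewrite !mulr_ge0 ?exprn_ge0 ?ler0n.
  move: nonpos; rewrite (bigD1 ord0) //= S_f0 S_one0 zz0 X0 // rmorph1 mulr1 -/main.
  set rest := (X in main + X); rewrite addrC -lerBrDr sub0r => rest_le.
  have : main <= `|rest|.
    have rest0 : rest <= 0 by apply: le_trans rest_le _; rewrite oppr_le0.
    by rewrite (ler0_norm rest0) lerNr.
  move/le_trans; apply; apply: le_trans (ler_norm_sum _ _ _) _; apply: ler_sum => i _.
  rewrite !normrM norm_conjC normrX mulrA; apply: ler_piMr.
    by rewrite !mulr_ge0 ?exprn_ge0.
  exact: (dchar_norm_le1 q_gt0 (Xc i)).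
have SW i : i != ord0 -> `|S one i| * (V ^ rho)%N%:R <= N%:R.
  move=> i0; have nonprin := Xn i i0.
  have V4 : 0 < (V ^ (rho + 4))%N%:R :> algC by rewrite ltr0n expn_gt0 V_gt0.
  have : `|S one i| <= (V ^ 4)%N%:R * (N%:R / (V ^ (rho + 4))%N%:R).
    rewrite /S; under eq_bigr do rewrite mul1r.
    apply: sum_small_qpart => // m mN; rewrite ler_pdivlMr //.
    exact: burgess (Xc i) nonprin _ mN.
  rewrite mulrA ler_pdivlMr // (mulrC (V ^ 4)%N%:R) expnD natrM mulrA ler_pM2r //.
  by rewrite ltr0n expn_gt0 V_gt0.
have split := @large_small_split _ (fun i => i != ord0) (fun i => `|S f i|) (fun i => `|S one i|)
  (fun i => `|zz i|) nI%:R N%:R zeta%:R (V ^ th)%N%:R (V ^ rho)%N%:R K H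
  (fun i => normr_ge0 _) (fun i => normr_ge0 _) (fun i => normr_ge0 _)
  (ler0n _ _) (ler0n _ _) (ler0n _ _) (ler0n _ _) (ler0n _ _)
  (fun i => norm_sum_le f i f1) SW z_le.
have mom h : (forall n, `|h n| <= 1) -> \sum_i `|S h i| ^+ 2 * `|zz i| ^+ (2 * K) <=
    (2 * c0 ^ K * (nI * N * zeta ^ (2 * K)) * V ^ (K + 4))%N%:R.
  move=> h1; apply: le_trans (_ : _ <= (totient q * (nI * zeta ^ K * ((N * V ^ (K * u) %/ q).+1 * (c0 ^ K * V ^ 4))))%N%:R) _;
    last by rewrite ler_nat first_moment_nat.
  apply: (weighted_moment q_gt0 Xc Xo zs_le zs_co) => // [n _|v /andP[v0 vM]|n /inI[n0 nN _]|v].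
  - exact: cpart_coprime.
  - by apply: zdiv; rewrite v0 (leq_trans vM).
  - split; first exact: part_gt0.
    by rewrite /Z -expnM [(u * K)%N]mulnC leq_mul // (leq_trans (cpart_le _ _)).
  - exact: small_qpart_count.
have last_mom : \sum_i `|zz i| ^+ (2 * K2) <= (2 * (c0 ^ K2 * 2 ^ (K2 * u)) * zeta ^ (2 * K2) * V ^ K2)%N%:R.
  apply: le_trans (_ : _ <= (totient q * (1 * zeta ^ K2 * ((V ^ (K2 * u) %/ q).+1 * (c0 ^ K2 * 1))))%N%:R) _;
    last by rewrite ler_nat last_moment_nat.
  (* With the single integer 1 in place of [n], this is the pure moment of order [2 * K2] of the sum
     over primes. *)
  have := @weighted_moment q k X zs Z q_gt0 Xc Xo zs_le zs_co [:: 1%N] one id c0 1 (V ^ (K2 * u)) K2.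
  under eq_bigr => i _.
    have [Xi1 _ _ _] := Xc i.
    rewrite big_seq1 Xi1 mulr1 normr1 expr1n mul1r; over.
  apply=> //.
  - by move=> n; rewrite inE => /eqP ->; apply: coprime1n.
  - by move=> v /andP[v0 vM]; apply: zdiv; rewrite v0 (leq_trans vM).
  - by move=> n; rewrite inE => /eqP ->; split=> //; rewrite mul1n /Z -expnM mulnC.
  - by move=> v /=; case: eqP.
apply: (final_contradiction nI0); rewrite -(ler_nat algC).
have AW0 : 0 <= (V ^ th * zeta ^ (2 * H).+1 * V ^ rho)%N%:R :> algC by rewrite ler0n.
rewrite natrM; apply: (@le_trans _ _ (c%:R * Err * (V ^ th * zeta ^ (2 * H).+1 * V ^ rho)%N%:R)).
  apply: ler_wpM2r => //; apply: (@le_trans _ _ (c%:R * ((\sum_(n <- I) f n) * (nI%:R * zeta%:R ^+ (2 * K).+1)))).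
    rewrite -mulnA natrM [(nI * _)%N%:R]natrM natrX [leRHS]mulrA ler_wpM2r ?sum_f_ge //.
    by rewrite mulr_ge0 ?exprn_ge0 ?ler0n.
  by rewrite ler_wpM2l ?ler0n.
rewrite [leRHS]natrM -mulrA ler_wpM2l ?ler0n //.
rewrite [X in _ * X <= _]natrM [X in _ * (X * _) <= _]natrM [X in _ * (_ * X * _) <= _]natrX.
apply: le_trans split _; rewrite [leRHS]natrD; apply: lerD.
  rewrite -[zeta%:R ^+ _]natrX -natrM [leRHS]natrM; apply: ler_wpM2r; first exact: ler0n.
  under eq_bigr do rewrite mulrDl.
  rewrite big_split /= [leRHS](_ : _ = (2 * c0 ^ K * (nI * N * zeta ^ (2 * K)) * V ^ (K + 4))%N%:R *+ 2).
    by rewrite mulr2n lerD // mom.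
  by rewrite natrM mulr_natl.
rewrite -[(V ^ th)%N%:R ^+ _]natrX [leRHS]natrM; apply: ler_wpM2r; first exact: ler0n.
rewrite [leRHS]natrM [X in _ <= X * _]natrM; apply: ler_wpM2l => //.
by rewrite mulr_ge0 ?ler0n.
Qed.
End Core.

(* The exponents come from [V^(4 h u) <= q]: there are two factors up to [N] and [6 h + 1] primes up
   to [V^u], and the greedy packing into 14 factors needs a margin of [V^(14 u)]. *)
Lemma smooth_products h s c : (0 < h)%N -> (4 <= s)%N -> (0 < c)%N ->
  exists q1, forall q a N Y, (q1 <= q)%N -> (forall p, prime p -> ~~ (p ^ 3 %| q)%N) -> coprime a q ->
  (q ^ (2 ^ s.-1 + 10) <= N ^ (2 * 2 ^ s))%N -> (N <= q)%N -> (N <= Y ^ 2)%N ->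
  (N ^ (8 * h) * q ^ (6 * h + 15) <= Y ^ (56 * h))%N ->
  (c * (2 * \sum_(Y.+1 <= p < N.+1 | prime p) N %/ p) + 3 * N <= c * N)%N ->
  exists bs, [/\ size bs = 14, all (fun b => 0 < b <= Y)%N bs & \prod_(b <- bs) b = a %[mod q]].
Proof.
move=> h0 s4 c_gt0; have [D [qB [D0 HB]]] := burgess_cube_free s4.
set t := (2 ^ s.-1)%N in HB *.
have rt : (2 * 2 ^ s = 4 * t)%N by rewrite /t -[in LHS](prednK (leq_trans (isT : 0 < 4)%N s4)) expnS mulnA.
pose K := (3 * h)%N; pose H := h.-1; pose K2 := (4 * h)%N.
have K2E : (K + H).+1 = K2 by rewrite /K /K2 /H -addnS prednK // -mulSnr.
pose rho := (1 + K2 + 2 * (K2 * (K + 5)))%N.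
(* Burgess saves [q] in the [D]-th power, and [q >= V^(K2 * u)], so the saving [V^(rho + 4)] needs
   [K2 * u >= D * (rho + 4)]. The summand 4 makes [V^4 <= V^u <= Y]. *)
pose u := (D * (rho + 4) + 4)%N.
have u4 : (4 <= u)%N by rewrite leq_addl.
have u0 : (0 < u)%N by apply: leq_trans u4.
have u1 : (1 < u)%N by apply: leq_trans u4.
have K20 : (0 < K2)%N by rewrite muln_gt0.
have K2u0 : (0 < K2 * u)%N by rewrite muln_gt0 K20.
(* The products in play stay within [V^((2 * K2 + K + 1) * u)], and [u - 1 >= u / 2], so none of
   them has more than [c0] prime factors above [V^(u - 1)]. *)
pose c0 := (2 * (2 * K2 + K + 1)).+1.
have [V1 HV1] := @coprime_prime_supply u (2 * (K2 * u)) u1.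
have [C C0 HC] := omega_bound (2 * (K2 * u)) (isT : 0 < 3)%N.
pose V0 := (maxn 2 (maxn V1 (maxn (C * 2 ^ (K2 * u)) (c * (4 * c0 ^ K + 2 * (c0 ^ K2 * 2 ^ (K2 * u)))).+1)))%N.
exists (maxn 2 (maxn qB (maxn (V0 ^ (K2 * u)) (2 ^ (K2 * u * K * t))))) => q a N Y.
rewrite !geq_max => /and4P[q2 qqB qV0 q2t] q_cf co_a Nburgess Nq NY bins bad.
have q0 : (0 < q)%N by apply: ltnW.
have [V /andP[Vq qV]] := nat_root q K2u0.
have : (V0 <= V)%N by rewrite -ltnS -(ltn_exp2r _ _ K2u0); apply: leq_ltn_trans qV.
rewrite /V0 !geq_max => /and4P[V2 /HV1 {}HV1 VC Vbig].
have V_gt0 : (0 < V)%N by apply: ltnW.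
have qV2 : (q <= (2 * V) ^ (K2 * u))%N.
  apply: leq_trans (ltnW qV) _; rewrite leq_exp2r //; move: V_gt0; clear; lia.
have qV3 : (q < V ^ (2 * (K2 * u)))%N.
  apply: leq_trans qV _; rewrite [X in (_ <= X)%N]expnM leq_exp2r //; move: V2; rewrite -mulnn; clear; nia.
have t0 : (0 < t)%N by rewrite expn_gt0.
have N0 : (0 < N)%N.
  have : (0 < N ^ (2 * 2 ^ s))%N by apply: leq_trans Nburgess; rewrite expn_gt0 q0.
  by rewrite expn_gt0 => /orP[//|]; rewrite muln_eq0 expn_eq0.
have tau : (size (divisors q) <= V)%N.
  apply: leq_trans (size_divisors_cube_free q0 q_cf) _.
  have T0 : (0 < 2 * (K2 * u))%N by rewrite muln_gt0.
  rewrite -(leq_exp2r _ _ T0); apply: leq_trans (HC q q0) _.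
  apply: (@leq_trans (C * (2 * V) ^ (K2 * u))%N); first by rewrite leq_mul2l qV2 orbT.
  rewrite expnMn mulnA mul2n -addnn expnD leq_mul2r; apply/orP; right; apply: leq_trans VC _.
  by rewrite -[X in (X <= _)%N]expn1 leq_pexp2l.
pose zs := [seq p <- index_iota (V ^ u.-1).+1 (V ^ u).+1 | prime p && coprime p q].
have size_zs : (V ^ u.-1 <= size zs)%N by apply: HV1; rewrite q0 qV3.
have YV : (V ^ u <= Y)%N.
  rewrite -(@leq_exp2r _ _ (56 * h)) ?muln_gt0 //; apply: leq_trans bins.
  apply: (@leq_trans (q ^ (6 * h + 15))%N); last by rewrite leq_pmull // expn_gt0 N0.
  apply: (@leq_trans (q ^ 14)%N); last by rewrite leq_pexp2l // (leq_trans _ (leq_addl _ _)).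
  rewrite -expnM (_ : (u * (56 * h) = K2 * u * 14)%N); last by rewrite /K2; ring.
  by rewrite expnM leq_exp2r.
(* Here [N^(4 t) >= q^(t + 10)], and [V^(K * u)] is [q^(3/4)] up to a power of 2. The surplus 10 in
   the exponent provides a spare factor [q], which pays for that power of 2. *)
have VK : (q <= N * V ^ (K * u))%N.
  have K2t0 : (0 < K2 * t)%N by rewrite muln_gt0 K20.
  rewrite -(leq_exp2r _ _ K2t0).
  rewrite -(@leq_pmul2l (2 ^ (K2 * u * K * t))%N) ?expn_gt0 //.
  rewrite [in leqRHS]expnMn.
  have -> : ((V ^ (K * u)) ^ (K2 * t) = (V ^ (K2 * u)) ^ (K * t))%N.
    by rewrite -!expnM; congr (_ ^ _)%N; ring.
  have -> : (2 ^ (K2 * u * K * t) = (2 ^ (K2 * u)) ^ (K * t))%N.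
    by rewrite -!expnM; congr (_ ^ _)%N; ring.
  rewrite mulnCA -expnMn -expnMn.
  have -> : (N ^ (K2 * t) = (N ^ (2 * 2 ^ s)) ^ h)%N by rewrite rt -expnM; congr (_ ^ _)%N; rewrite /K2; ring.
  apply: (@leq_trans ((q ^ (t + 10)) ^ h * q ^ (K * t))%N); last first.
    by apply: leq_mul; rewrite leq_exp2r ?muln_gt0 ?h0.
  rewrite expnM in q2t.
  apply: (@leq_trans (q * q ^ (K2 * t))%N).
    by rewrite leq_mul2r; apply/orP; right; apply: leq_trans q2t; rewrite -!expnM leq_exp2l // !mulnA.
  rewrite -expnM -expnS -expnD leq_pexp2l // /K2 /K.
  rewrite (_ : ((t + 10) * h + 3 * h * t = 10 * h + 4 * h * t)%N); last by ring.
  by rewrite -add1n leq_add2r muln_gt0.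
have V1u : (1 < V ^ u.-1)%N by rewrite -[1%N](expn0 V) ltn_exp2l //; move: u1; clear; lia.
apply: (@core_solution q a N Y V u c c0 K H (N * V ^ (K * u) + V ^ (K2 * u)) zs) => //; rewrite ?K2E //.
- move=> chi chi_char nonprin m mN; rewrite -/rho.
  have := HB q N chi m qqB q_cf chi_char nonprin Nburgess mN => S_le.
  rewrite -(ler_pXn2r D0) ?nnegrE ?mulr_ge0 ?ler0n ?normr_ge0 // exprMn -!natrX.
  apply: le_trans S_le; rewrite ler_wpM2l ?exprn_ge0 ?normr_ge0 // ler_nat.
  apply: leq_trans Vq; rewrite -expnM leq_pexp2l // mulnC.
  by apply: (@leq_trans u); [rewrite leq_addr|rewrite leq_pmull].
- by rewrite leq_addr.
- by rewrite leq_addl.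
- apply: (@leq_ltn_trans (V ^ ((2 * K2 + K + 1) * u))).
    apply: (@leq_trans (2 * V ^ ((2 * K2 + K) * u))%N); last first.
      rewrite [X in (_ <= _ ^ X)%N]mulnDl mul1n [X in (_ <= X)%N]expnD mulnC leq_mul2l; apply/orP; right.
      by apply: leq_trans V2 _; rewrite -[X in (X <= _)%N]expn1 leq_pexp2l.
    rewrite mul2n -addnn; apply: leq_add; last by rewrite leq_pexp2l // leq_mul2r; apply/orP; right; clear; lia.
    rewrite [X in (_ <= V ^ X)%N]mulnDl expnD -mulnA leq_mul //; apply: leq_trans Nq _; rewrite mulnA -mulnA; exact: ltnW.
  rewrite -expnM ltn_exp2l // /c0; move: (2 * K2 + K + 1)%N => e.
  have arith (m n : nat) : (1 < m)%N -> (n * m < m.-1 * (2 * n).+1)%N.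
    by clear; case: m => [|[|m]] // _; nia.
  exact: arith.
- by rewrite filter_uniq // iota_uniq.
- by move=> z; rewrite mem_filter mem_index_iota ltnS => /andP[/andP[-> ->] /andP[-> ->]].
- by apply: leq_trans YV; rewrite leq_pexp2l.
rewrite -(leq_exp2r _ _ K20) -[((Y ^ 14) ^ _)%N]expnM.
have -> : (Y ^ (14 * K2) = Y ^ (56 * h))%N by rewrite /K2 mulnA.
apply: leq_trans bins; rewrite -mulnA -expnD -expnM expnMn -!expnM.
have -> : (2 * K2 = 8 * h)%N by rewrite /K2 mulnA.
rewrite leq_mul2l; apply/orP; right.
have -> : (u * ((2 * K).+1 + 14) * K2 = K2 * u * (6 * h + 15))%N by rewrite /K; ring.
by rewrite expnM leq_exp2r // addn_gt0 orbT.
Qed.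

(** * Mertens' theorem *)

(** The classical induction: an even [n > 2] adds nothing, and for [n = 2 m + 1] the primes above
    [m + 1] divide the binomial coefficient of [n] over [m], which is at most [4^m]. *)
Lemma primorial_le n : (\prod_(0 <= p < n.+1 | prime p) p <= 4 ^ n)%N.
Proof.
have [k] := ubnP n; elim: k n => // k IH n; rewrite ltnS => nk.
have [n2|n3] := leqP n 2.
  by move: n n2 {nk} => [|[|[|]]] // _; rewrite unlock.
have [odd_n|even_n] := boolP (odd n); last first.
  case: n n3 even_n nk => // n n3 even_n nk; rewrite big_mkcond big_nat_recr //= -big_mkcond.
  have -> : prime n.+1 = false.
    by apply/negP => /even_prime[E|]; [rewrite E in n3|exact/negP].
  by rewrite muln1; apply: leq_trans (IH n nk) _; rewrite leq_exp2l.
set m := n./2; have nE : n = (m.*2.+1)%N by rewrite /m -[LHS]odd_double_half odd_n.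
have m0 : (0 < m)%N by rewrite half_gt0 ltnW.
rewrite (@big_cat_nat _ _ _ m.+2) //; last by rewrite nE -addnn; lia.
have first : (\prod_(0 <= p < m.+2 | prime p) p <= 4 ^ m.+1)%N.
  by apply: IH; rewrite nE -addnn in nk; lia.
have second : (\prod_(m.+2 <= p < n.+1 | prime p) p <= 4 ^ m)%N.
  have le_bin : ('C(n, m) <= 4 ^ m)%N.
    have E : 'C(n, m.+1) = 'C(n, m).
      by rewrite -bin_sub; [congr 'C(_, _)|]; rewrite nE -addnn; lia.
    rewrite -(leq_pmul2l (isT : 0 < 2)%N) -[X in (_ <= _ * X)%N](_ : (2 ^ m.*2)%N = _); last by rewrite -mul2n expnM.
    have -> : (2 * 2 ^ m.*2 = \sum_(i < n.+1) 'C(n, i))%N.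
      rewrite -expnS -nE -[2%N]/(1 + 1)%N Pascal.
      by apply: eq_bigr => i _; rewrite !exp1n !muln1.
    have lt1 : (m < n.+1)%N by rewrite nE -addnn; lia.
    have lt2 : (m.+1 < n.+1)%N by rewrite nE -addnn; lia.
    rewrite (bigD1 (Ordinal lt1)) //= (bigD1 (Ordinal lt2)) /=; last by rewrite -val_eqE /= gtn_eqF.
    by rewrite E addnA mul2n -addnn leq_addr.
  apply: leq_trans le_bin; apply: dvdn_leq; first by rewrite bin_gt0 nE -addnn; lia.
  rewrite -big_filter; apply: prod_primes_dvd; first by rewrite filter_uniq // iota_uniq.
  move=> p; rewrite mem_filter mem_index_iota => /and3P[p_pr mp pn]; split=> //.
  have := dvdn_fact (m := p) (n := n); rewrite prime_gt0 // -ltnS pn => /(_ isT).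
  rewrite -(@bin_fact n m); last by rewrite nE -addnn; lia.
  have pf j : (j < p)%N -> (p %| j`!)%N = false.
    elim: j => [|j IHj] jp; first by rewrite fact0 dvdn1 gtn_eqF ?prime_gt1.
    by rewrite factS Euclid_dvdM // IHj ?(ltnW jp) // gtnNdvd.
  by rewrite !Euclid_dvdM // !pf ?orbF //; [apply: leq_trans mp; rewrite nE -addnn|]; lia.
apply: leq_trans (leq_mul first second) _; rewrite -expnD leq_exp2l // nE -addnn; lia.
Qed.

Section Mertens.
Variable R : realType.
Local Notation lg n := (ln (n%:R : R)).

Lemma lg_ge0 n : 0 <= lg n.
Proof. by case: n => [|n]; [rewrite ln0|rewrite ln_ge0 // ler1n]. Qed.

Lemma lgM m n : (0 < m)%N -> (0 < n)%N -> lg (m * n)%N = lg m + lg n.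
Proof. by move=> m0 n0; rewrite natrM lnM ?posrE ?ltr0n. Qed.

Lemma lgX m n : (0 < m)%N -> lg (m ^ n)%N = n%:R * lg m.
Proof. by move=> m0; rewrite natrX lnXn ?ltr0n // mulr_natl. Qed.

Lemma ler_lg m n : (0 < m)%N -> (m <= n)%N -> lg m <= lg n.
Proof. by move=> m0 mn; rewrite ler_ln ?posrE ?ltr0n ?ler_nat // (leq_trans m0). Qed.

Lemma lg_prod (s : seq nat) (P : pred nat) (F : nat -> nat) : (forall p, P p -> (0 < F p)%N) ->
  lg (\prod_(p <- s | P p) F p)%N = \sum_(p <- s | P p) lg (F p).
Proof.
move=> F0; suff [] : (0 < \prod_(p <- s | P p) F p)%N /\
  lg (\prod_(p <- s | P p) F p)%N = \sum_(p <- s | P p) lg (F p) by [].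
elim: s => [|p s [pos IH]]; first by rewrite !big_nil ln1.
rewrite !big_cons; case: ifP => // /F0 Fp.
by rewrite muln_gt0 Fp pos lgM // IH.
Qed.

Lemma ln4_le3 : lg 4 <= 3.
Proof. by have := @le_ln1Dx R 3; rewrite (_ : 1 + 3 = 4 :> R); [apply; lra|ring]. Qed.

Lemma theta_le n : \sum_(1 <= p < n.+1 | prime p) lg p <= n%:R * 3.
Proof.
have -> : \sum_(1 <= p < n.+1 | prime p) lg p = lg (\prod_(0 <= p < n.+1 | prime p) p)%N.
  rewrite lg_prod => [|p /prime_gt0 //].
  by rewrite [RHS]big_mkcond big_ltn //= add0r -big_mkcond.
have pos : (0 < \prod_(0 <= p < n.+1 | prime p) p)%N by rewrite prodn_cond_gt0 // => p /prime_gt0.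
apply: le_trans (ler_lg pos (primorial_le n)) _.
by rewrite lgX // ler_wpM2l ?ler0n // ln4_le3.
Qed.

Lemma lg_fact n : lg (n`!) = \sum_(1 <= p < n.+1 | prime p) (logn p n`!)%:R * lg p.
Proof.
rewrite {1}(prod_prime_decomp (fact_gt0 n)) prime_decompE big_map /=.
rewrite lg_prod => [|p _]; last by rewrite pfactor_gt0.
rewrite (eq_big_seq (fun p => (logn p n`!)%:R * lg p)) => [|p]; last first.
  by rewrite mem_primes => /and3P[p_pr _ _]; rewrite lgX ?prime_gt0.
rewrite -[RHS]big_filter; apply: perm_big; apply: uniq_perm.
- exact: primes_uniq.
- by rewrite filter_uniq // iota_uniq.
move=> p; rewrite mem_primes mem_filter mem_index_iota fact_gt0 /=.
case: (boolP (prime p)) => //= p_pr; rewrite prime_gt0 // ltnS /=.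
apply/idP/idP => [|pn]; last by rewrite dvdn_fact ?prime_gt0.
elim: n => [|n IH]; first by rewrite fact0 dvdn1 gtn_eqF ?prime_gt1.
by rewrite factS Euclid_dvdM // => /orP[/dvdn_leq -> //|/IH /leqW].
Qed.

Lemma lg_diff n : (0 < n)%N -> n%:R * (lg n.+1 - lg n) <= 1.
Proof.
move=> n0; have nR : 0 < n%:R :> R by rewrite ltr0n.
rewrite -ln_div ?posrE ?ltr0n // mulrC -ler_pdivlMr // mul1r.
have -> : n.+1%:R / n%:R = 1 + n%:R^-1 :> R by rewrite -addn1 natrD mulrDl divff ?gt_eqF // mul1r.
by apply: le_ln1Dx; apply: lt_le_trans (ltrN10 R) _; rewrite invr_ge0 ler0n.
Qed.

Lemma lg_fact_ge n : n%:R * lg n - n%:R <= lg n`!.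
Proof.
elim: n => [|[|n] IH]; first by rewrite fact0 ln1 mul0r subr0.
  by rewrite ln1 mulr0 sub0r lerN10.
rewrite factS lgM ?fact_gt0 //; have := lg_diff (ltn0Sn n).
set a := ln n.+1%:R in IH *; set b := ln n.+2%:R; rewrite -(natr1 n.+1).
move: IH; clearbody a b; move: n.+1%:R (ln _) => N c; nra.
Qed.

Lemma lg_fact_le n : lg n`! <= n%:R * lg n.
Proof.
case: n => [|n]; first by rewrite fact0 ln1 mul0r.
rewrite -lgX // ler_lg ?fact_gt0 //.
have aux k : (k <= n.+1)%N -> (k`! <= n.+1 ^ k)%N.
  by elim: k => // k IH kn; rewrite factS expnS leq_mul // IH // ltnW.
exact: aux.
Qed.

Definition mertens_sum n : R := \sum_(1 <= p < n.+1 | prime p) lg p / p%:R.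

(** Legendre's formula for the factorial: replacing [n / p] by its integer part costs at most
    [ln p], and by [theta_le] these costs add up to at most [3 n]. *)
Lemma mertens_sum_le n : (0 < n)%N -> mertens_sum n <= lg n + 3.
Proof.
move=> n0; have nR : 0 < n%:R :> R by rewrite ltr0n.
rewrite -(ler_pM2l nR) mulrDr.
apply: le_trans (_ : lg n`! + \sum_(1 <= p < n.+1 | prime p) lg p <= _); last first.
  by apply: lerD; [apply: lg_fact_le|apply: theta_le].
rewrite lg_fact -big_split mulr_sumr; apply: ler_sum => p p_pr /=.
have p0 := prime_gt0 p_pr; rewrite -[X in _ <= _ + X]mul1r -mulrDl mulrCA mulrC.
apply: ler_wpM2r; first exact: lg_ge0.
rewrite ler_pdivrMr ?ltr0n // natr1 -natrM ler_nat; apply: leq_trans (ltnW (ltn_ceil n p0)) _.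
rewrite leq_mul2r; apply/orP; right; rewrite ltnS logn_fact // (@big_ltn _ _ _ 1) // expn1 leq_addr //.
Qed.

(* The terms are dominated by the differences of [(ln k + 2) / k]. *)
Lemma sum_lg_tail n : \sum_(2 <= k < n.+1) lg k / (k%:R * k.-1%:R) <= 2.
Proof.
case: n => [|n]; first by rewrite big_geq.
suff : \sum_(2 <= k < n.+2) lg k / (k%:R * k.-1%:R) <= 2 - (lg n.+1 + 2) / n.+1%:R.
  move=> /le_trans; apply; rewrite gerBl divr_ge0 ?addr_ge0 ?lg_ge0 //.
elim: n => [|n IH]; first by rewrite big_geq // ln1 add0r divr1 subrr.
rewrite big_nat_recr //=; apply: le_trans (lerD IH (lexx _)) _.
have := lg_diff (ltn0Sn n).
have N0 : 0 < n.+1%:R :> R by rewrite ltr0n.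
have N1 : 1 <= n.+1%:R :> R by rewrite ler1n.
set a := ln n.+1%:R; set b := ln n.+2%:R; rewrite -(natr1 n.+1).
clearbody a b; move: n.+1%:R N0 N1 => N N0 N1 H.
rewrite -subr_ge0.
have -> : 2 - (b + 2) / (N + 1) - (2 - (a + 2) / N + b / ((N + 1) * N)) =
   (2 - (N + 1) * (b - a)) / ((N + 1) * N) by field; rewrite !gt_eqF //; lra.
apply: divr_ge0; last by rewrite mulr_ge0; lra.
have d1 : b - a <= 1 by nra.
by lra.
Qed.

Lemma geometric_le (x : R) n : 0 <= x -> x < 1 -> \sum_(1 <= k < n.+1) x ^+ k <= x / (1 - x).
Proof.
move=> x0 x1; rewrite ler_pdivlMr ?subr_gt0 //.
have -> : (\sum_(1 <= k < n.+1) x ^+ k) * (1 - x) = x - x ^+ n.+1.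
  elim: n => [|n IH]; first by rewrite big_geq // mul0r expr1 subrr.
  rewrite big_nat_recr //= mulrDl IH (exprS x n.+1); ring.
by rewrite gerBl exprn_ge0.
Qed.

(** Conversely, [p] contributes at most [n ln p / (p - 1)] to the logarithm of the factorial. The
    excess over [n ln p / p] sums to at most [2 n] by [sum_lg_tail], and the last [n] is the loss in
    [lg_fact_ge]. *)
Lemma mertens_sum_ge n : (0 < n)%N -> lg n - 3 <= mertens_sum n.
Proof.
move=> n0; have nR : 0 < n%:R :> R by rewrite ltr0n.
rewrite -(ler_pM2l nR) mulrBr.
suff H : lg n`! <= n%:R * mertens_sum n + n%:R * 2.
  by have := le_trans (lg_fact_ge n) H; lra.
apply: (@le_trans _ _ (n%:R * mertens_sum n +
  n%:R * \sum_(1 <= p < n.+1 | prime p) lg p / (p%:R * p.-1%:R))); last first.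
  rewrite lerD2l ler_wpM2l ?ler0n //; apply: le_trans (sum_lg_tail n).
  case: n n0 {nR} => // n _; rewrite big_mkcond big_ltn //= add0r; apply: ler_sum => k _.
  by case: ifP => // _; rewrite divr_ge0 ?mulr_ge0 ?lg_ge0 ?ler0n.
rewrite lg_fact -mulrDr -big_split mulr_sumr /=; apply: ler_sum => p p_pr.
have p0 : 0 < p%:R :> R by rewrite ltr0n prime_gt0.
have p1 : 0 < p.-1%:R :> R by rewrite ltr0n -subn1 subn_gt0 prime_gt1.
have pE : p%:R = p.-1%:R + 1 :> R by rewrite natr1 prednK ?prime_gt0.
have -> : n%:R * (lg p / p%:R + lg p / (p%:R * p.-1%:R)) = n%:R / p.-1%:R * lg p.
  by rewrite pE; field; rewrite -pE !gt_eqF.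
apply: ler_wpM2r; first exact: lg_ge0.
rewrite logn_fact // natr_sum.
apply: (@le_trans _ _ (\sum_(1 <= k < n.+1) n%:R * (p%:R^-1) ^+ k)).
  apply: ler_sum => k _; rewrite exprVn ler_pdivlMr ?exprn_gt0 // -natrX -natrM ler_nat.
  exact: leq_divM.
rewrite -mulr_sumr ler_wpM2l ?ler0n //.
have pV1 : p%:R^-1 < 1 :> R by rewrite invf_lt1 // ltr1n prime_gt1.
apply: le_trans (geometric_le n _ pV1) _; first by rewrite invr_ge0 ltW.
rewrite le_eqVlt; apply/orP; left; apply/eqP.
by rewrite pE; field; rewrite -pE !gt_eqF //= pE; lra.
Qed.

(* Partial summation, done as an induction that carries the error term of [mertens_sum N]. *)
Lemma mertens Y N : (1 < Y)%N -> (Y <= N)%N ->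
  \sum_(Y.+1 <= p < N.+1 | prime p) p%:R^-1 <= ln (lg N / lg Y) + 6 / lg Y.
Proof.
move=> Y1 YN; have lgpos n : (Y <= n)%N -> 0 < lg n.
  by move=> Yn; rewrite ln_gt0 // ltr1n (leq_trans Y1).
have lgY := lgpos Y (leqnn Y).
suff H : \sum_(Y.+1 <= p < N.+1 | prime p) p%:R^-1 <=
   ln (lg N / lg Y) + (mertens_sum N - lg N - 3) / lg N + 6 / lg Y.
  apply: le_trans H _; rewrite lerD2r gerDl ler_pdivrMr ?lgpos // mul0r.
  have := mertens_sum_le (leq_trans (ltnW Y1) YN); lra.
rewrite -(subnKC YN); elim: (N - Y)%N => [|d IH].
  rewrite addn0 big_geq // divff ?gt_eqF // ln1 add0r -mulrDl; apply: divr_ge0; last exact: ltW.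
  have := mertens_sum_ge (ltnW Y1); lra.
rewrite addnS; set n := (Y + d)%N in IH *.
have Yn : (Y <= n)%N by rewrite leq_addr.
have n0 : (0 < n)%N by apply: leq_trans Yn; apply: ltnW.
have lgn := lgpos n Yn; have lgn1 := lgpos n.+1 (leqW Yn).
rewrite big_mkcond big_nat_recr /= -?big_mkcond ?ltnS //.
have E : (if prime n.+1 then n.+1%:R^-1 else 0) = (mertens_sum n.+1 - mertens_sum n) / lg n.+1 :> R.
  rewrite /mertens_sum [in X in X - _]big_mkcond big_nat_recr //= -big_mkcond addrAC subrr add0r.
  by case: ifP => _; [rewrite mulrAC divff ?mul1r ?gt_eqF|rewrite mul0r].
rewrite E; apply: le_trans (lerD IH (lexx _)) _.
have ub := mertens_sum_le n0.
have lnE : ln (lg n.+1 / lg Y) = ln (lg n / lg Y) - ln (lg n / lg n.+1).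
  by rewrite !ln_div ?posrE //; ring.
have lnle : ln (lg n / lg n.+1) <= lg n / lg n.+1 - 1.
  have := @le_ln1Dx R (lg n / lg n.+1 - 1); rewrite (addrC 1) subrK; apply.
  by rewrite ltrBrDr addrC subrr divr_gt0.
rewrite lnE; have lgle := ler_lg n0 (leqnSn n).
move: (mertens_sum n) (mertens_sum n.+1) ub lgle lgn lgn1 lnle => A A1.
move: (ln (lg n / lg Y)) (ln (lg n / lg n.+1)) (6 / lg Y) (lg n) (lg n.+1) => l1 l2 y a b ub ab a0 b0 lnle.
have key : (A - a - 3) / a - (A - a - 3) / b <= 0.
  rewrite -mulrBr mulr_le0_ge0 //; first by move: ub; lra.
  by rewrite subr_ge0 lef_pV2.
have -> : (A1 - A) / b = (A1 - b - 3) / b - (A - a - 3) / b + (1 - a / b) by field; rewrite gt_eqF.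
move: key lnle; move: (_ / a) (_ / b) (_ / b) (a / b) => *; lra.
Qed.

End Mertens.

(** * Choice of the exponents *)

Section RealExponents.
Variable R : realType.
Local Notation lg n := (ln (n%:R : R)).

Lemma leq_lg m n : (0 < m)%N -> (0 < n)%N -> lg m <= lg n -> (m <= n)%N.
Proof. by move=> m0 n0; rewrite ler_ln ?posrE ?ltr0n // ler_nat. Qed.

Lemma ln2_le1 : ln 2 <= 1 :> R.
Proof. by have := @le_ln1Dx R 1; apply; lra. Qed.

Lemma lg_truncn (y : R) : 1 <= y -> [/\ (0 < Num.truncn y)%N, (Num.truncn y)%:R <= y,
  lg (Num.truncn y) <= ln y & ln y - 1 <= lg (Num.truncn y)].
Proof.
move=> y1; have y0 : 0 < y by lra.
have n0 : (0 < Num.truncn y)%N by rewrite truncn_gt0.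
have /andP[le_y lt_y] := truncn_itv (ltW y0).
have nR : 0 < (Num.truncn y)%:R :> R by rewrite ltr0n.
split=> //; first by rewrite ler_ln.
rewrite lerBlDr; apply: le_trans (_ : ln ((Num.truncn y)%:R * 2) <= _).
  rewrite ler_ln ?posrE ?mulr_gt0 //; apply: le_trans (ltW lt_y) _.
  by rewrite -natrM ler_nat muln2 -addnn -addn1 leq_add2l.
by rewrite lnM ?posrE // lerD2l ln2_le1.
Qed.

Lemma sum_div_primes_le Y N : (1 < Y)%N -> (Y <= N)%N ->
  (\sum_(Y.+1 <= p < N.+1 | prime p) N %/ p)%N%:R <= N%:R * (ln (lg N / lg Y) + 6 / lg Y) :> R.
Proof.
move=> Y1 YN; rewrite natr_sum; apply: le_trans (_ : N%:R * \sum_(Y.+1 <= p < N.+1 | prime p) p%:R^-1 <= _).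
  rewrite mulr_sumr; apply: ler_sum => p p_pr.
  by rewrite ler_pdivlMr ?ltr0n ?prime_gt0 // -natrM ler_nat leq_divM.
by rewrite ler_wpM2l ?ler0n // mertens.
Qed.

(** The exponential of -1/2 is the eighth power of that of -1/16, which is at least 15/16; three
    squarings give the bound. The third digit matters for the margin of the packing into 14
    factors. *)
Lemma expR_half_bounds : 595 / 1000 <= expR (- 2^-1 : R) < 1.
Proof.
apply/andP; split; last by rewrite expR_lt1 oppr_lt0 invr_gt0.
have -> : - 2^-1 = 8%:R * (- 16^-1) :> R by field.
rewrite expRM_natl; have := expR_ge1Dx (- 16^-1 : R); set z := expR _ => z_ge.
have z2 : 29 / 33 <= z ^+ 2 by rewrite expr2; nra.
have z4 : 61 / 79 <= (z ^+ 2) ^+ 2 by move: (z ^+ 2) z2 => y y2; rewrite expr2; nra.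
have z8 : 595 / 1000 <= ((z ^+ 2) ^+ 2) ^+ 2.
  by move: ((z ^+ 2) ^+ 2) z4 => y y2; rewrite expr2; nra.
by move: z8; rewrite -!exprM.
Qed.

Lemma leq_pow_lg N q Y i j k : (0 < N)%N -> (0 < q)%N -> (0 < Y)%N ->
  i%:R * lg N + j%:R * lg q <= k%:R * lg Y -> (N ^ i * q ^ j <= Y ^ k)%N.
Proof.
move=> N0 q0 Y0 H; apply: leq_lg; rewrite ?muln_gt0 ?expn_gt0 ?N0 ?q0 ?Y0 //.
by rewrite lgM ?expn_gt0 ?N0 ?q0 // !lgX.
Qed.

(** The coefficients are those of [smooth_products] at [h = 50]: [8 h = 400], [6 h + 15 = 315],
    [56 h = 2800]. The margin 3/2 is [700 * 595/1000 - 100 - 315], and the bound 47/1000 is for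
    [N <= Y^2]. *)
Lemma exponent_bounds (e x : R) : 0 < e -> e <= 1000^-1 -> 595 / 1000 <= x -> x < 1 ->
  let al := 4^-1 + e in let b := 4^-1 * x + e in
  [/\ 14 / 100 <= b, b <= al, al <= 1, 47 / 1000 <= 2 * b - al & 3 / 2 <= 2800 * b - 400 * al - 315].
Proof. by move=> e0 e1 x0 x1 /=; split; lra. Qed.

(** The exponent [(T + 10) / (4 T)] is at most [1/4 + e] as soon as [T e >= 5/2]. The further 1/4 in
    [11 / 4] gains [La], which is at least [4 T] and so pays for the -1 lost in rounding. *)
Lemma burgess_exponent (T e La l : R) : 1 <= T -> 11 / 4 <= T * e -> 4 * T <= La ->
  (4^-1 + e) * La - 1 <= l -> (T + 10) * La <= 2 * (2 * T) * l.
Proof.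
move=> T1 Te LaT l_ge.
have h1 : 4 * T * ((4^-1 + e) * La - 1) <= 4 * T * l by rewrite ler_wpM2l //; lra.
have h2 : 11 / 4 * La <= T * e * La by rewrite ler_wpM2r //; lra.
nra.
Qed.

(** Rounding changes the quotient of logarithms by a factor of at most [1 + 1/w], and Mertens' error
    is at most [6/w]. Together they make [7/w], at most [eta / 2] because [w >= 14 / eta]. *)
Lemma loglog_bound (al b La lN lY eta : R) : 0 < al -> 0 < b -> 0 < La -> 0 < eta -> 0 < lN ->
  ln (al / b) = 2^-1 - eta -> 14 / eta <= b * La - 1 -> lN <= al * La -> b * La - 1 <= lY ->
  ln (lN / lY) + 6 / lY <= 2^-1 - eta / 2.
Proof.
move=> al0 b0 La0 eta0 lN0 eta_def; set w := b * La - 1 => bLa lN_le lY_ge.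
have w0 : 0 < w by apply: lt_le_trans bLa; rewrite divr_gt0.
have lY0 : 0 < lY by apply: lt_le_trans lY_ge.
have wV0 : 0 < 1 / w by rewrite divr_gt0.
have le1 : ln (lN / lY) <= ln (al / b) + 1 / w.
  have aux : ln (al / b) + ln (1 + 1 / w) <= ln (al / b) + 1 / w.
    by rewrite lerD2l le_ln1Dx //; lra.
  have w1 : 0 < 1 + 1 / w by lra.
  apply: le_trans aux; rewrite -lnM ?posrE ?divr_gt0 //.
  have -> : al / b * (1 + 1 / w) = al * La / w.
    by rewrite /w; field; rewrite (gt_eqF b0) (gt_eqF w0).
  rewrite ler_ln ?posrE ?divr_gt0 ?mulr_gt0 //.
  by apply: ler_pM; rewrite ?invr_ge0 ?(ltW lN0) ?(ltW lY0) // lef_pV2 ?posrE.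
have le2 : 6 / lY <= 6 / w by rewrite ler_wpM2l // lef_pV2 ?posrE.
have le3 : 7 / w <= eta / 2.
  by rewrite ler_pdivrMr //; move: bLa; rewrite ler_pdivrMr //; lra.
have E : 1 / w + 6 / w = 7 / w by rewrite -mulrDl; congr (_ / _); ring.
lra.
Qed.

Lemma bad_proportion (c eta N S : R) : 3 <= c * eta -> 0 <= c -> 0 <= N ->
  S <= N * (2^-1 - eta / 2) -> c * (2 * S) + 3 * N <= c * N.
Proof.
move=> c_eta c0 N0 S_le.
have h1 : c * (2 * S) <= c * (2 * (N * (2^-1 - eta / 2))) by rewrite !ler_wpM2l.
have h2 : 3 * N <= c * eta * N by rewrite ler_wpM2r.
nra.
Qed.

Lemma parameters (e : R) : 0 < e -> e <= 1000^-1 -> exists q1 : nat, forall q a, (q1 <= q)%N ->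
  (forall p, prime p -> ~~ (p ^ 3 %| q)%N) -> coprime a q ->
  exists bs, [/\ size bs = 14,
    all (fun b => 0 < b <= Num.truncn (q%:R `^ (beta R + e)))%N bs & \prod_(b <- bs) b = a %[mod q]].
Proof.
move=> e0 e_le; have /andP[x_ge x_lt] := expR_half_bounds.
have [b_ge al_b al1 b_al exps] := exponent_bounds e0 e_le x_ge x_lt.
set b := 4^-1 * _ + e in b_ge al_b b_al exps; set al := 4^-1 + e in al_b al1 b_al exps.
rewrite -/(beta R) -/b.
have b0 : 0 < b by apply: lt_le_trans b_ge; rewrite divr_gt0.
have al0 : 0 < al by apply: lt_le_trans al_b.
(* Positive because both exponents are raised by the same [e]: at [e = 0] the quotient [al / b]
   would be exactly the exponential of 1/2, and the increase lowers it. *)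
set eta := 2^-1 - ln (al / b).
have eta0 : 0 < eta.
  rewrite subr_gt0 -ltr_expR lnK ?posrE ?divr_gt0 // -[2^-1]opprK expRN ltr_pdivrMr //.
  rewrite mulrC ltr_pdivlMr ?expR_gt0 // /al /b; move: (expR _) x_lt => x x_lt; nra.
pose c := (Num.truncn (3 / eta)).+1.
have c_ge : 3 <= c%:R * eta.
  have /andP[_ /ltW] := truncn_itv (ltW (divr_gt0 (ltr0n R 3) eta0)).
  by rewrite ler_pdivrMr.
(* As [2^(s - 1) > s - 1], this gives [T > 3 / e], more than the [11 / 4] that [burgess_exponent]
   requires of [T * e]. *)
pose s := (Num.truncn (3 / e) + 4)%N.
have s4 : (4 <= s)%N by rewrite leq_addl.
pose T : R := (2 ^ s.-1)%N%:R.
have Te : 11 / 4 <= T * e.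
  have sT : (s.-1 < 2 ^ s.-1)%N by rewrite ltn_expl.
  have T_ge : (Num.truncn (3 / e)).+1%:R <= T.
    by rewrite ler_nat; apply: leq_ltn_trans sT; rewrite /s addnS leq_addr.
  have /andP[_ lt_e] := truncn_itv (ltW (divr_gt0 (ltr0n R 3) e0)).
  by have := lt_le_trans lt_e T_ge; rewrite ltr_pdivrMr // => /ltW; apply: le_trans; lra.
pose L0 : R := 4 * T + 2000 + 8 * (1 + 14 / eta).
(* With [h = 50] the small primes have size about [q^(1/200)]. The packing margin and the odd prime
   then cost about [q^(15/200)], below the available [q^(14 beta - 2)]. *)
have [q1 Hq1] := smooth_products (isT : 0 < 50)%N s4 (ltn0Sn _ : 0 < c)%N.
exists (maxn (maxn 2 q1) (Num.truncn (expR L0)).+1) => q a; rewrite !geq_max -andbA => /and3P[q2 q1q qL] q_cf co_a.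
have {}Hq1 := Hq1 q a _ _ q1q q_cf co_a.
have q0 : (0 < q)%N by apply: ltnW.
have q0R : 0 < q%:R :> R by rewrite ltr0n.
have q1R : 1 <= q%:R :> R by rewrite ler1n.
set La := lg q; have La_ge : L0 <= La.
  rewrite -ler_expR lnK ?posrE //.
  have /andP[_ /ltW le1] := truncn_itv (expR_ge0 L0); apply: le_trans le1 _.
  by rewrite ler_nat.
have T1 : 1 <= T by rewrite ler1n expn_gt0.
have eta14 : 0 < 14 / eta by rewrite divr_gt0.
have [La_T La_2000 La_eta] : [/\ 4 * T <= La, 2000 <= La & 8 * (1 + 14 / eta) <= La].
  have aux (x y L : R) : 1 <= x -> 0 < y -> 4 * x + 2000 + 8 * (1 + y) <= L ->
      [/\ 4 * x <= L, 2000 <= L & 8 * (1 + y) <= L] by clear; move=> *; split; lra.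
  exact: aux.
have La0 : 0 < La by apply: lt_le_trans La_2000.
have pow_ge1 (y : R) : 0 <= y -> 1 <= q%:R `^ y.
  by move=> y0; have := ler_powR q1R y0; rewrite powRr0.
have [N0 N_le lgN_le lgN_ge] := lg_truncn (pow_ge1 al (ltW al0)).
have [Y0 Y_le lgY_le lgY_ge] := lg_truncn (pow_ge1 b (ltW b0)).
rewrite ln_powR -/La in lgN_le lgN_ge; rewrite ln_powR -/La in lgY_le lgY_ge.
have YN : (Num.truncn (q%:R `^ b) <= Num.truncn (q%:R `^ al))%N.
  by rewrite truncn_ge_nat ?powR_ge0 //; apply: le_trans Y_le _; apply: ler_powR.
move: (Num.truncn (q%:R `^ al)) (Num.truncn (q%:R `^ b)) N0 Y0 N_le Y_le lgN_le lgN_ge lgY_le lgY_ge YN.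
move=> N Y N0 Y0 N_le Y_le lgN_le lgN_ge lgY_le lgY_ge YN.
have bLa : 14 / eta <= b * La - 1.
  have aux (x y z : R) : 0 < x -> 14 / 100 <= z -> 8 * (1 + x) <= y -> x <= z * y - 1.
    by clear; nra.
  exact: aux.
have lgY0 : 0 < lg Y by apply: lt_le_trans lgY_ge; apply: lt_le_trans bLa.
have Y1 : (1 < Y)%N.
  rewrite ltnNge; apply/negP => Y1'; move: lgY0; rewrite ltNge => /negP; apply.
  by apply: ln_le0; rewrite -[1]/(1%:R) ler_nat.
have lgN0 : 0 < lg N by apply: lt_le_trans (ler_lg R Y0 YN).
apply: (Hq1 N Y).
- rewrite -[X in (X <= _)%N]mul1n -(exp1n 0); apply: leq_pow_lg => //.
  rewrite ln1 mulr0 add0r natrD -/T natrM.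
  have -> : (2 ^ s)%N%:R = 2 * T :> R by rewrite -natrM -expnS prednK // (leq_trans _ s4).
  exact: (burgess_exponent T1 Te).
- apply: leq_lg => //; apply: le_trans lgN_le _; rewrite -/La ler_piMl ?(ltW La0) //.
- rewrite -[X in (X <= _)%N]muln1 -(exp1n 0) -[X in (X * _)%N]expn1; apply: leq_pow_lg => //.
  have h1 : 47 / 1000 * La <= (2 * b - al) * La by rewrite ler_wpM2r ?(ltW La0).
  rewrite ln1 mulr0 addr0 mul1r; move: lgN_le lgY_ge h1 La_2000.
  by clear; move: (lg N) (lg Y) La b al => n y l b' a'; nra.
- apply: leq_pow_lg => //; rewrite natrD !natrM -/La.
  have h1 : 3 / 2 * La <= (2800 * b - 400 * al - 315) * La by rewrite ler_wpM2r ?(ltW La0).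
  move: lgN_le lgY_ge h1 La_2000.
  by clear; move: (lg N) (lg Y) La b al => n y l b' a'; nra.
rewrite -(ler_nat R) natrD !natrM; apply: (bad_proportion c_ge); rewrite ?ler0n //.
apply: le_trans (sum_div_primes_le Y1 YN) _; rewrite ler_wpM2l ?ler0n //.
by apply: (@loglog_bound al b La) => //; rewrite /eta opprB addrC subrK.
Qed.
End RealExponents.

Theorem theorem1 (R : realType) (eps : R) (heps : 0 < eps) :
  exists q0 : nat,
    forall q : nat, cube_free q -> (q0 <= q)%N ->
    forall a : int, coprimez a q%:Z ->
    exists n : 'I_14 -> int,
      (\prod_(i < 14) n i = a %[mod q%:Z])%Z /\
      forall i : 'I_14, 1 <= n i /\ (n i)%:~R <= q%:R `^ (beta R + eps).
Proof.
(* A smaller exponent only strengthens the bound, so [eps] is cut down to at most 1/1000, as the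
   numerical estimates for the exponents assume. *)
have [e [e0 e_le e_eps]] : exists e : R, [/\ 0 < e, e <= 1000^-1 & e <= eps].
  have [le|lt] := leP eps 1000^-1; first by exists eps.
  by exists 1000^-1; split=> //; rewrite ?ltW // invr_gt0.
have [q1 H] := parameters e0 e_le.
exists q1 => q [q_gt0 q_cf] q1q a co_a.
have q_cf' p : prime p -> ~~ (p ^ 3 %| q)%N by move=> p_pr; apply/negP/q_cf.
have qz : q%:Z != 0 by rewrite eqz_nat -lt0n.
pose a' := `|(a %% q%:Z)%Z|%N.
have a'E : a'%:Z = (a %% q%:Z)%Z by rewrite gez0_abs // modz_ge0.
have co_a' : coprime a' q.
  by move: co_a; rewrite /coprimez -gcdz_modl -a'E.
have [bs [sz bsY bsE]] := H q a' q1q q_cf' co_a'.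
exists (fun i => (nth 1%N bs i)%:Z); split.
  have -> : \prod_(i < 14) (nth 1%N bs i)%:Z = (\prod_(b <- bs) b)%N%:Z.
    rewrite (big_nth 1%N) sz big_mkord.
    by elim/big_rec2: _ => // i y1 y2 _ ->.
  by rewrite -[RHS](modz_mod a) -a'E !modz_nat bsE.
move=> i; have /andP[b0 bY] : (0 < nth 1%N bs i <= Num.truncn (q%:R `^ (beta R + e)))%N.
  by apply: (allP bsY); rewrite mem_nth // sz.
split; first by rewrite lez_nat.
rewrite -[X in X <= _]/((nth 1%N bs i)%:R); apply: le_trans (_ : _ <= q%:R `^ (beta R + e)) _.
  apply: le_trans (_ : _ <= (Num.truncn (q%:R `^ (beta R + e)))%:R) _; first by rewrite ler_nat.
  by rewrite truncn_le powR_ge0.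
by apply: ler_powR; rewrite ?ler1n // lerD2l.
Qed.
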